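(* Let $X=\mathcal{U}/\Gamma$ be a (compact, connected) non-orientable Klein surface with non-empty boundary, where $\Gamma$ is a surface crystallographic group. Let $SX$ be the Schottky double, $OX$ the orienting double and $X^{+}$ the complex double of $X$. Then there exists a Riemann surface $DX$ such that $\mathrm{Aut}^{\pm}(DX)$ contains a group $\langle s,t\rangle$ isomorphic to $C_{2}\times C_{2}$ and such that $DX/\langle s\rangle = OX$ is the orienting double of $X$, $DX/\langle t\rangle = SX$ is the Schottky double of $X$, and $DX/\langle st\rangle = X^{+}$ is the complex double of $X$ (equalities meaning isomorphism of Klein surfaces).
   Context: A (compact) Klein surface is a compact connected surface, possibly non-orientable and possibly with boundary, with a dianalytic structure: charts take values in open subsets of the closed upper half-plane and transition functions are analytic or anti-analytic. A Riemann surface is regarded as an orientable Klein surface without boundary. A smooth morphism of Klein surfaces is a map which is locally either an unbranched (conformal or anticonformal) map or the folding map $x+iy\mapsto x+i|y|$, the latter occurring over the boundary of the image. A double of $X$ is a Klein surface $Y$ with a degree two morphism $Y\to X$. For a Riemann surface $Y$, $\mathrm{Aut}^{\pm}(Y)$ is the group of all conformal and anticonformal automorphisms of $Y$. $C_2$ is the cyclic group of order $2$. Uniformization: a non-orientable Klein surface $X$ of genus $g\ge 1$ with $k\ge 1$ boundary components has algebraic genus $g+k-1$ and is a quotient $\mathcal{U}/\Gamma$, where $\mathcal{U}$ is the upper half-plane and $\Gamma$ is a non-Euclidean crystallographic (NEC) group without elliptic elements if the algebraic genus is $>1$; if the algebraic genus is $1$, $\mathcal{U}$ is to be replaced by $\mathbb{C}$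 and $\Gamma$ is a Euclidean crystallographic group without elliptic elements. $\Gamma$ has a canonical presentation $$\langle d_1,\dots,d_g,e_1,\dots,e_k,c_1,\dots,c_k \mid d_1^2\cdots d_g^2e_1\cdots e_k=1,\ c_i^2=1,\ e_ic_ie_i^{-1}=c_i\ (1\le i\le k)\rangle,$$ where the $d_i$ are glide reflections, the $e_i$ are orientation preserving and the $c_i$ are reflections. Natural doubles of a non-orientable $X=\mathcal{U}/\Gamma$ with non-empty boundary: (1) The complex double $X^{+}$ is the unique double of $X$ that is a Riemann surface without boundary: $X^{+}=\mathcal{U}/\Gamma^{+}$, where $\Gamma^{+}$ is the subgroup of orientation-preserving elements of $\Gamma$. (2) The orienting double $OX$ is the orientable unbranched two-sheeted covering of $X$ with $2k$ boundary components, obtained by filling each boundary component of $X$ with a disc, taking the complex double (orientation covering) of the resulting surface, and removing the $2k$ lifts of the discs. Equivalently $OX=\mathcal{U}/\ker\theta$ with $\theta:\Gamma\to C_2=\langle u\rangle$, $d_i\mapsto u$, $e_i\mapsto 1$, $c_i\mapsto 1$. (3) The Schottky double $SX$ is the Klein surface without boundary, with the same orientability as $X$, admitting a dianalytic involution $h$ whose fixed curves separate $SX$ and such that $SX/\langle h\rangle = X$. Equivalently $SX=\mathcal{U}/\ker\theta$ with $\theta:\Gamma\to C_2=\langle u\rangle$, $d_i\mapsto 1$, $e_i\mapsto 1$, $c_i\mapsto u$. *)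

(* Defs.v *)
From HB Require Import structures.
From mathcomp Require Import all_boot all_order all_algebra.
From mathcomp Require Import all_classical all_reals all_analysis.
From mathcomp Require Import complex.

Set Implicit Arguments.
Unset Strict Implicit.
Unset Printing Implicit Defensive.

Import Order.TTheory GRing.Theory Num.Theory numFieldNormedType.Exports.

Local Open Scope classical_set_scope.
Local Open Scope ring_scope.

Section Analytic.
Context {R : realType}.

(* The [^o] alias carries the usual topology of the complex numbers and makes
   [derivable F z 1] complex differentiability at z. *)
Definition Cplx := (R[i])^o.

Implicit Types (A : set Cplx) (f : Cplx -> Cplx) (z : Cplx).

Definition upper_half_plane : set Cplx := [set z | 0 <= complex.Im z].

Definition relatively_open_in (M A : set Cplx) : Prop :=
  exists2 O : set Cplx, open O & A = M `&` O.

(* On a set A that need not be open in the plane (charts at boundary points),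
   analytic means: locally the restriction of a function holomorphic in a
   neighbourhood in the plane. *)
Definition analytic_at A f z : Prop :=
  exists F : Cplx -> Cplx,
    \forall w \near z, derivable F w 1 /\ (A w -> F w = f w).

Definition antianalytic_at A f z : Prop :=
  analytic_at A (fun w => conjc (f w)) z.

Definition analytic_on A f : Prop := forall z, A z -> analytic_at A f z.

Definition antianalytic_on A f : Prop := forall z, A z -> antianalytic_at A f z.

(* The choice may differ between components of A. *)
Definition dianalytic_on A f : Prop :=
  forall z, A z -> analytic_at A f z \/ antianalytic_at A f z.

Definition fold z : Cplx := (complex.Re z +i* `|complex.Im z|)%C.

End Analytic.

Arguments Cplx : clear implicits.
Arguments upper_half_plane : clear implicits.

(* [cmap] and [cinv] are total; they are meaningful only on [cdom] and on its
   image respectively. *)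
Record chart (R : realType) (T : topologicalType) := Chart {
  cdom : set T;
  cmap :> T -> Cplx R;
  cinv : Cplx R -> T;
  cdom_open : open cdom;
  cmapK : forall x, cdom x -> cinv (cmap x) = x;
  cmap_cts : {within cdom, continuous cmap};
  cinv_cts : {within cmap @` cdom, continuous cinv} }.

Section Charts.
Context {R : realType}.

Definition cimage (T : topologicalType) (c : chart R T) : set (Cplx R) :=
  c @` cdom c.

Definition chart_into (T : topologicalType) (M : set (Cplx R))
  (c : chart R T) : Prop := relatively_open_in M (cimage c).

(* The expression d o f o c^-1 of f in the charts c and d, on its natural
   domain, has property P. *)
Definition in_charts (S T : topologicalType)
    (P : set (Cplx R) -> (Cplx R -> Cplx R) -> Prop)
    (c : chart R S) (d : chart R T) (f : S -> T) : Prop :=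
  P (c @` (cdom c `&` f @^-1` cdom d)) (fun z => d (f (cinv c z))).

End Charts.

(* The atlas need not be maximal: every notion below is stated through charts
   compatible with it. [connected] alone would allow the empty space. *)
Record klein_surface (R : realType) := KleinSurface {
  carrier :> topologicalType;
  atlas : set (chart R carrier);
  klein_nonempty : [set: carrier] !=set0;
  klein_hausdorff : hausdorff_space carrier;
  klein_compact : compact [set: carrier];
  klein_connected : connected [set: carrier];
  atlas_half_plane : forall c, atlas c -> chart_into (upper_half_plane R) c;
  atlas_cover : forall x, exists2 c, atlas c & cdom c x;
  atlas_dianalytic : forall c d, atlas c -> atlas d ->
    in_charts dianalytic_on c d id }.

Section Klein.
Context {R : realType}.
Implicit Types X Y : klein_surface R.

Definition compatible_chart X (c : chart R X) : Prop :=
  forall d, atlas d ->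
    in_charts dianalytic_on c d id /\ in_charts dianalytic_on d c id.

Definition dianalytic_chart X (c : chart R X) : Prop :=
  chart_into (upper_half_plane R) c /\ compatible_chart c.

(* A compatible chart onto an open subset of the whole plane; such charts exist
   exactly around interior points. *)
Definition plane_chart X (c : chart R X) : Prop :=
  chart_into [set: Cplx R] c /\ compatible_chart c.

Definition boundary X : set X :=
  [set x | exists c, [/\ atlas c, cdom c x & complex.Im (c x) = 0]].

Definition boundary_components X : set (set X) :=
  [set connected_component (@boundary X) x | x in @boundary X].

Definition orientation X (O : set (chart R X)) : Prop :=
  [/\ forall c, O c -> dianalytic_chart c,
      forall x, exists2 c, O c & cdom c x &
      forall c d, O c -> O d -> in_charts analytic_on c d id].

Definition orientable X : Prop := exists O : set (chart R X), orientation O.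

Definition riemann_surface X : Prop := orientable X /\ @boundary X = set0.

Definition dianalytic_map X Y (f : X -> Y) : Prop :=
  continuous f /\
  forall c d, atlas c -> atlas d -> in_charts dianalytic_on c d f.

(* f is the identity in suitable charts. Anticonformal local isomorphisms are
   included, since z |-> - conj z preserves the half-plane and so turns
   dianalytic charts into dianalytic charts. *)
Definition unbranched_at X Y (f : Y -> X) (y : Y) : Prop :=
  exists (c : chart R Y) (d : chart R X),
    [/\ dianalytic_chart c, dianalytic_chart d, cdom c y,
        f @` cdom c = cdom d & forall y', cdom c y' -> d (f y') = c y'].

Definition folds_at X Y (f : Y -> X) (y : Y) : Prop :=
  exists (c : chart R Y) (d : chart R X),
    [/\ plane_chart c, dianalytic_chart d, cdom c y /\ complex.Im (c y) = 0,
        f @` cdom c `<=` cdom d &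
        forall y', cdom c y' -> d (f y') = fold (c y')].

Definition smooth_morphism X Y (f : Y -> X) : Prop :=
  continuous f /\ forall y, unbranched_at f y \/ folds_at f y.

(* A point where f folds counts twice in its fibre. *)
Definition degree_two X Y (f : Y -> X) : Prop :=
  forall x,
    (exists y1 y2, [/\ y1 <> y2, f @^-1` [set x] = [set y1; y2],
                       unbranched_at f y1 & unbranched_at f y2])
    \/ (exists y, f @^-1` [set x] = [set y] /\ folds_at f y).

Definition double_map X Y (f : Y -> X) : Prop :=
  smooth_morphism f /\ degree_two f.

End Klein.

Arguments boundary {R} X _.
Arguments boundary_components {R} X _.

Section Groups.

Definition transformation_group (T : Type) (G : set (T -> T)) : Prop :=
  [/\ G id,
      forall f g, G f -> G g -> G (f \o g) &
      forall f, G f -> exists g, [/\ G g, cancel f g & cancel g f]].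

Definition generated (T : Type) (S : set (T -> T)) : set (T -> T) :=
  smallest (@transformation_group T) S.

Definition isomorphic_C2xC2 (T : Type) (G : set (T -> T)) : Prop :=
  exists phi : ('Z_2 * 'Z_2)%type -> T -> T,
    [/\ injective phi, range phi = G &
        forall a b, phi (a + b) = phi a \o phi b].

End Groups.

Section Doubles.
Context {R : realType}.
Implicit Types X Y : klein_surface R.

Definition conformal X (O : set (chart R X)) (h : X -> X) : Prop :=
  continuous h /\ forall c d, O c -> O d -> in_charts analytic_on c d h.

Definition anticonformal X (O : set (chart R X)) (h : X -> X) : Prop :=
  continuous h /\ forall c d, O c -> O d -> in_charts antianalytic_on c d h.

(* X being connected, it has at most two orientations up to equivalence, which
   are exchanged by conjugation; the choice of O is therefore immaterial. *)
Definition Aut_pm X : set (X -> X) :=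
  [set h : X -> X | exists (O : set (chart R X)) (g : X -> X),
     [/\ orientation O, cancel h g, cancel g h &
       (conformal O h /\ conformal O g) \/
       (anticonformal O h /\ anticonformal O g)]].

(* Y/G = X. The dianalytic structure of a quotient is the one making the
   projection a morphism, so Y/G is isomorphic to X exactly when X is the target
   of a surjective morphism from Y whose fibres are the G-orbits. *)
Definition is_quotient Y (G : set (Y -> Y)) X : Prop :=
  exists p : Y -> X,
    [/\ smooth_morphism p, range p = [set: X] &
        forall y y', p y = p y' <-> exists2 g, G g & g y = y'].

Definition complex_double X Y : Prop :=
  riemann_surface Y /\ exists p : Y -> X, double_map p.

Definition orienting_double X Y : Prop :=
  [/\ orientable Y,
      exists p : Y -> X, double_map p /\ forall y, unbranched_at p y &
      exists k : nat, (boundary_components X #= `I_k)%card /\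
                      (boundary_components Y #= `I_(2 * k)%N)%card].

Definition schottky_double X Y : Prop :=
  [/\ boundary Y = set0,
      orientable Y <-> orientable X &
      exists h : Y -> Y,
        [/\ dianalytic_map h, h \o h = id /\ h <> id,
            ~ connected (~` [set y | h y = y]) &
            is_quotient (generated [set h]) X]].

End Doubles.

Arguments Aut_pm {R} X _.

(* Main.v *)
Require Import Defs.
From mathcomp Require Import all_boot all_order all_algebra.
From mathcomp Require Import all_classical all_reals all_analysis.
From mathcomp Require Import complex ring.

(* DX is the fibre product of Xplus and OX over X. Let k and sigma be the deck
   involutions of Xplus -> X and OX -> X; then s = (k, id) and st = (id, sigma),
   and the projections of DX onto OX and Xplus are the quotients by s and st.
   Since OX -> X is unbranched, DX -> Xplus is a local homeomorphism, along which
   the Riemann surface structure of Xplus is pulled back. It is connected because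
   Xplus -> X folds over the boundary of X.

   Near a fold k is complex conjugation, so k is anticonformal everywhere. The
   involution sigma is anticonformal too, as otherwise the orientation of OX would
   descend to X. The mirrors of the involution h of SX separate it into two sides
   exchanged by h. Over an interior point x of X, a point (a, b) of DX is a pair of
   local orientations of X at x; sending (a, b) to the point of SX over x on one
   side if they agree, and on the other side if they do not, identifies SX with
   DX / t for t = (k, sigma). At the mirrors this map is dianalytic because changes
   of charts of X extend across the real axis by Schwarz reflection. *)

(** Atlases are not maximal, and the image of a chart at a boundary point is not open in the plane.
    Orientation is therefore tracked by signs: a map read in charts is analytic up to a power of
    conjugation recorded by a boolean. Signs add under composition, are unique because the identity
    is not antianalytic, and are locally constant, which reduces global statements to connectedness.
    Relative to a single chart of [X] they make sense although [X] has no orientation.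

    The involution of the Schottky double comes with little: the complement of its fixed points is
    disconnected. This gives two non-empty open sides, which need not be connected, and does not say
    that they are exchanged, nor that the fixed points are the folds of the quotient map. The second
    fact follows because an involution fixing a neighbourhood of a point would be the identity; the
    first by continuing a property of points across the mirrors, where the half-discs of a fold
    chart are exchanged by conjugation. *)

Set Implicit Arguments.
Unset Strict Implicit.
Unset Printing Implicit Defensive.

Import Order.TTheory GRing.Theory Num.Theory numFieldNormedType.Exports.

Local Open Scope classical_set_scope.
Local Open Scope ring_scope.

(** * First-order complex analysis *)

Section ComplexPlane.
Variable R : realType.
Local Notation C := (Cplx R).
Local Notation V := ((R[i])^o : normedModType R[i]).
Implicit Types (z w : C) (A B : set C) (f g F G : C -> C) (s : bool).

Lemma nbhs_cplxP z (P : set C) :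
  nbhs z P <-> exists2 d : R, 0 < d & forall w, `|w - z| < d%:C%C -> P w.
Proof.
split=> [/nbhs_ballP[e /= e0 eP]|[d d0 dP]].
  move: e0; rewrite ltcE /= => /andP[/eqP ie re].
  exists (complex.Re e) => // w wz; apply: eP; rewrite -ball_normE /ball_ /=.
  by rewrite distrC; case: e {re} ie wz => a b /= ->.
apply/nbhs_ballP; exists (d%:C%C : R[i]); first by rewrite /= ltcR.
by move=> w; rewrite -ball_normE /ball_ /= distrC; exact: dP.
Qed.

Lemma near_dist z (e : R[i]) : 0 < e -> \forall w \near z, `|z - w| < e.
Proof.
by move=> e0; apply/nbhs_ballP; exists e => // w; rewrite -ball_normE.
Qed.

Lemma cplx_continuousP (f : C -> C) z :
  (forall e : R[i], 0 < e -> \forall w \near z, `|f z - f w| < e) ->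
  {for z, continuous f}.
Proof. exact: (@cvgrPdist_lt _ C C (nbhs z) _ f (f z)).2. Qed.

Lemma realfun_continuousP (f : C -> R) z :
  (forall e : R, 0 < e -> \forall w \near z, `|f z - f w| < e) ->
  {for z, continuous f}.
Proof. exact: (@cvgrPdist_lt _ R^o C (nbhs z) _ f (f z)).2. Qed.

Lemma near_continuous f z (P : set C) : {for z, continuous f} ->
  (\forall w \near f z, P w) -> \forall w \near z, P (f w).
Proof. by move=> cf; exact: cf. Qed.

Lemma conjc_continuous : continuous (@conjc R : C -> C).
Proof.
move=> z; apply: cplx_continuousP => e e0.
by apply: filterS (near_dist z e0) => w; rewrite -rmorphB normcJ.
Qed.

Lemma Re_continuous : continuous (fun z : C => complex.Re z : R).
Proof.
move=> z; apply: realfun_continuousP => e e0.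
have e0' : 0 < e%:C%C :> R[i] by rewrite ltcR.
apply: filterS (near_dist z e0') => w zw.
by rewrite -raddfB -ltcR (le_lt_trans (normc_ge_Re _)).
Qed.

Lemma normc_ge_Im z : `|complex.Im z|%:C%C <= `|z|.
Proof.
rewrite normc_def lecR -sqrtr_sqr ler_sqrt ?addr_ge0 ?sqr_ge0//.
by rewrite lerDr sqr_ge0.
Qed.

Lemma Im_continuous : continuous (fun z : C => complex.Im z : R).
Proof.
move=> z; apply: realfun_continuousP => e e0.
have e0' : 0 < e%:C%C :> R[i] by rewrite ltcR.
apply: filterS (near_dist z e0') => w zw.
by rewrite -raddfB -ltcR (le_lt_trans (normc_ge_Im _)).
Qed.

Lemma fold_continuous : continuous (@fold R : C -> C).
Proof.
move=> z; apply: cplx_continuousP => e e0.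
apply: filterS (near_dist z e0) => w; apply: le_lt_trans.
case: z w => a b [c d]; rewrite !normc_def /= lecR ler_sqrt ?addr_ge0 ?sqr_ge0//.
rewrite lerD2l -(ger0_norm (sqr_ge0 (b - d))) -(ger0_norm (sqr_ge0 (`|b| - _))).
by rewrite !normrX ler_pXn2r ?nnegrE// ler_dist_dist.
Qed.

(** Indexing conjugation by a boolean treats analytic and antianalytic maps at once; composition
    becomes addition of signs ([conjnA]). *)
Definition conjn s z : C := if s then conjc z else z.

Lemma conjnK s : involutive (conjn s).
Proof. by case: s => z //=; rewrite conjcK. Qed.

Lemma conjnC s t z : conjn s (conjn t z) = conjn t (conjn s z).
Proof. by case: s; case: t. Qed.

Lemma conjnA s t z : conjn s (conjn t z) = conjn (s (+) t) z.
Proof. by case: s; case: t => //=; rewrite conjcK. Qed.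

Lemma conjn_continuous s : continuous (conjn s).
Proof. by case: s; [exact: conjc_continuous|move=> z; exact: cvg_id]. Qed.

Lemma norm_conjn s z : `|conjn s z| = `|z|.
Proof. by case: s; rewrite //= normcJ. Qed.

Lemma cderivP F z : derivable F z 1 <->
  cvg ((fun h : C => h^-1 * (F (h + z) - F z)) h @[h --> 0^']).
Proof.
rewrite /derivable.
by under [X in X @ _]eq_fun => h do rewrite [h *: 1]mulr1.
Qed.

(** Difference quotients are expressed in the nearby point [w], not in the increment, so that they
    combine with conditions on [w] coming from charts. *)
Lemma cderivable_lim F z l :
  (fun h : C => h^-1 * (F (h + z) - F z)) h @[h --> 0^'] --> l ->
  forall e : R, 0 < e -> \forall w \near z, w != z ->
   `|l - (F w - F z) / (w - z)| < e%:C%C.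
Proof.
move=> /cvgrPdist_lt Fl e e0.
have /Fl /nbhs_cplxP[d d0 dP] : 0 < (e%:C%C : C) by rewrite ltcR.
apply/nbhs_cplxP; exists d => // w wd wz.
have := dP (w - z); rewrite subr0 => /(_ wd).
by rewrite subr_eq0 subrK [X in _ - X]mulrC; apply.
Qed.

Lemma cderivable_limP F z l :
  (forall e : R, 0 < e -> \forall w \near z, w != z ->
    `|l - (F w - F z) / (w - z)| < e%:C%C) -> derivable F z 1.
Proof.
move=> Fl; apply/cderivP/cvg_ex; exists l.
apply: (@cvgrPdist_lt _ C C (0^') _ _ _).2 => e.
rewrite ltcE /= => /andP[/eqP ie re].
have -> : e = (complex.Re e)%:C%C by case: e ie {re} => a b /= ->.
have /Fl /nbhs_cplxP[d d0 dP] := re.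
apply/nbhs_cplxP; exists d => // w; rewrite subr0 => wd w0.
have := dP (w + z); rewrite addrK => /(_ wd).
by rewrite -subr_eq0 addrK [X in _ - X]mulrC; apply.
Qed.

Lemma conjc_quot (l a b c d : R[i]) :
  `|conjc l - (conjc a - conjc b) / (conjc c - conjc d)| = `|l - (a - b) / (c - d)|.
Proof. by rewrite -!rmorphB -fmorphV -rmorphM -rmorphB normcJ. Qed.

Lemma derivable_conjn s F z :
  derivable F z 1 -> derivable (fun w => conjn s (F (conjn s w))) (conjn s z) 1.
Proof.
case: s; last by [].
move=> /cderivP/cvg_ex[l /cderivable_lim Fl].
apply: (@cderivable_limP _ _ (conjc l)) => e /Fl.
move=> /nbhs_cplxP[d d0 dP]; apply/nbhs_cplxP; exists d => // w.
rewrite /conjn -[w]conjcK; move: (conjc w) => {}w wz wN.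
rewrite !conjcK conjc_quot; apply: dP.
  by rewrite -normcJ rmorphB.
by apply: contra_neq wN => ->.
Qed.

(** For [s] equal to [false] and [true] this is convertible to [analytic_at] and [antianalytic_at],
    so later proofs pass between them silently. *)
Definition dianalytic_at s A f z := analytic_at A (fun w => conjn s (f w)) z.

Lemma dianalytic_atW s A B f g z :
  (\forall w \near z, B w -> A w /\ f w = g w) ->
  dianalytic_at s A f z -> dianalytic_at s B g z.
Proof.
move=> BA [F nF]; exists F; near=> w.
have [dF eF] : derivable F w 1 /\ (A w -> F w = conjn s (f w)) by near: w.
split=> // Bw; have [Aw fg] : A w /\ f w = g w by move: Bw; near: w.
by rewrite eF// fg.
Unshelve. all: by end_near. Qed.

Lemma dianalytic_at_near s A f z : dianalytic_at s A f z ->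
  \forall w \near z, dianalytic_at s A f w.
Proof.
by move=> [F /near_join nF]; near=> w; exists F; near: w.
Unshelve. all: by end_near. Qed.

Lemma dianalytic_at_conjn s z A : dianalytic_at s A (conjn s) z.
Proof.
exists id; near=> w; split; first exact: derivable_id.
by rewrite conjnK.
Unshelve. all: by end_near. Qed.

Lemma cderivable_continuous F z : derivable F z 1 -> {for z, continuous F}.
Proof. by move/derivable1_diffP/differentiable_continuous. Qed.

Lemma cderivable_comp F G z : derivable F z 1 -> derivable G (F z) 1 ->
  derivable (G \o F) z 1.
Proof.
move=> /(@derivable1_diffP _ V) dF /(@derivable1_diffP _ V) dG.
apply/(@derivable1_diffP _ V).
exact: (@differentiable_comp _ V V V F G z dF dG).
Qed.

(** With holomorphic extensions [F] and [G], the map [g \o f] is [conjn t (G (conjn s F))].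
    Conjugating [G] on both sides keeps it holomorphic, and this leaves the sign [s (+) t]
    outside. *)
Lemma dianalytic_at_comp s t A B f g z : A z ->
  (\forall w \near z, A w -> B (f w)) ->
  dianalytic_at s A f z -> dianalytic_at t B g (f z) ->
  dianalytic_at (s (+) t) A (g \o f) z.
Proof.
move=> Az AB [F nF] [G nG].
have Fz : conjn s (F z) = f z.
  by rewrite (proj2 (nbhs_singleton nF))// conjnK.
have nGF : \forall w \near z, (fun v => \forall u \near v, derivable G u 1 /\
    (B u -> G u = conjn t (g u))) (conjn s (F w)).
  apply: (@near_continuous (fun w => conjn s (F w)) z
    (fun v => \forall u \near v, derivable G u 1 /\ (B u -> G u = conjn t (g u))));
    last by rewrite Fz; exact: near_join nG.
  apply: (@continuous_comp _ _ _ F (conjn s)); last exact: conjn_continuous.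
  exact: (cderivable_continuous (proj1 (nbhs_singleton nF))).
exists (fun w => conjn s (G (conjn s (F w)))); near=> w.
have [dF eF] : derivable F w 1 /\ (A w -> F w = conjn s (f w)) by near: w.
have := near nGF w => /(_ _)/nbhs_singleton[//|dG eG].
split; last first.
  move=> Aw; have Bw : B (f w) by move: Aw; near: w.
  have eFw : conjn s (F w) = f w by rewrite eF// conjnK.
  by rewrite eG eFw // conjnA.
have := derivable_conjn (s := s) dG; rewrite conjnK => dG'.
exact: (@cderivable_comp F (fun u => conjn s (G (conjn s u))) w dF dG').
Unshelve. all: by end_near. Qed.

(** Provides test points in every direction [u]; a real step [t] lets quotients be computed by real
    and imaginary parts. *)
Lemma near0_real (P : set C) z : (\forall w \near z, P w) ->
  exists2 d : R, 0 < d & forall t : R, 0 < t < d ->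
    forall u : C, `|u| <= 1 -> P (z + t%:C%C * u).
Proof.
move=> /nbhs_cplxP[d d0 dP]; exists d => // t /andP[t0 td] u u1; apply: dP.
rewrite addrAC subrr add0r normrM.
rewrite (@le_lt_trans _ _ `|t%:C%C : C|) ?ler_piMr//.
by rewrite normc_def /= expr0n/= addr0 sqrtr_sqr gtr0_norm// ltcR.
Qed.

(** The two models of charts: the half-plane for charts of the atlas, the whole plane for the charts
    at folds. *)
Definition half_or_plane (M : set C) := M = upper_half_plane R \/ M = setT.

(* The difference quotients of conjugation are 1 and -1 along the directions 1 and
   'i, both available in the closed half-plane. *)
Lemma conjc_not_analytic M A z : half_or_plane M -> relatively_open_in M A ->
  A z -> ~ dianalytic_at true A id z.
Proof.
move=> HM [U oU AE] Az [F nF].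
have Mz : M z /\ U z by move: Az; rewrite AE.
have nU : nbhs z U by apply: open_nbhs_nbhs; split=> //; case: Mz.
have /cderivP/cvg_ex[l Fl] := proj1 (nbhs_singleton nF).
have Fz := proj2 (nbhs_singleton nF) Az.
have /cderivable_lim/(_ _ (@ltr01 R)) nl := Fl.
have : \forall w \near z, [/\ U w, A w -> F w = conjc w & w != z ->
   `|l - (F w - F z) / (w - z)| < 1%:C%C].
  near=> w; split; first by near: w.
    by have [] : derivable F w 1 /\ (A w -> F w = conjn true w) by near: w.
  by near: w.
move=> /near0_real[d d0 dP].
have td : 0 < d / 2 < d by rewrite divr_gt0//= ltr_pdivrMr// ltr_pMr// ltr1n.
pose a : C := (d / 2)%:C%C.
have tN : (d / 2)%:C%C != 0 :> C.
  by rewrite (_ : 0 = 0%:C%C) // (inj_eq (@complexI _)); case/andP: td => /gt_eqF->.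
have dP' u := dP _ td u; rewrite -/a in tN dP'.
have HA u : U (z + a * u) -> 0 <= complex.Im u ->
    A (z + a * u).
  move=> Uu Iu; rewrite AE; split=> //; case: HM Mz => -> // [+ _].
  rewrite /upper_half_plane /=; case: u {Uu} Iu => p b /= b0; case: (z) => x y /=.
  by move=> y0; rewrite /a /= mul0r addr0 addr_ge0// mulr_ge0// divr_ge0// ltW.
have key u : `|u| <= 1 -> u != 0 -> 0 <= complex.Im u -> `|l - conjc u / u| < 1.
  move=> u1 u0 Iu; have [Uw Fw lw] := dP' _ u1.
  have := lw _; rewrite Fw; last exact: HA.
  have e : conjc (a * u) / (a * u) = conjc u / u.
    have -> : conjc (a * u) = a * conjc u.
      rewrite rmorphM; congr (_ * _).
      by apply/eqP; rewrite eq_complex /= oppr0 !eqxx.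
    by rewrite invfM mulrACA divff// mul1r.
  rewrite Fz /conjn -rmorphB [z + _]addrC addrK e; apply.
  by rewrite -subr_eq0 addrK mulf_neq0.
have l1 : `|l - 1| < 1.
  by have := key 1; rewrite rmorph1 divr1 normr1 lexx oner_neq0; apply.
have l2 : `|l + 1| < 1.
  have ni : `|'i%C : C| = 1 by rewrite normc_def /= expr0n expr1n add0r sqrtr1.
  have i0 : 'i%C != 0 :> C by rewrite -normr_gt0 ni ltr01.
  have ci : conjc 'i%C = - 'i%C :> R[i] by apply/eqP; rewrite eq_complex /= oppr0 !eqxx.
  by have := key 'i%C; rewrite ci mulNr divff// opprK ni lexx i0; apply=> //.
have := ltrD l1 l2; rewrite addrC => /(le_lt_trans (ler_normB _ _)).
by rewrite opprB [l + 1]addrC addrACA subrr addr0 -[1 + 1]/(2%:R) normr_nat ltxx.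
Unshelve. all: by end_near. Qed.

Lemma dianalytic_continuous s A f z : nbhs z A -> dianalytic_at s A f z ->
  {for z, continuous f}.
Proof.
move=> nA [F nF].
have fF : \forall w \near z, conjn s (F w) = f w.
  near=> w; have Aw : A w by near: w.
  have [_ ->//] : derivable F w 1 /\ (A w -> F w = conjn s (f w)) by near: w.
  by rewrite conjnK.
have fz : conjn s (F z) = f z by exact: nbhs_singleton fF.
suff : f w @[w --> z] --> conjn s (F z) by rewrite fz.
apply: (cvg_trans (near_eq_cvg fF)).
apply: (@continuous_comp _ _ _ F (conjn s)); last exact: conjn_continuous.
exact: (cderivable_continuous (proj1 (nbhs_singleton nF))).
Unshelve. all: by end_near. Qed.

Lemma near_derivable F G z : (\forall w \near z, F w = G w) ->
  derivable F z 1 -> derivable G z 1.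
Proof. exact: (@near_eq_derivable _ V V F G z 1). Qed.

Lemma conjnB s z w : conjn s (z - w) = conjn s z - conjn s w.
Proof. by case: s; rewrite //= rmorphB. Qed.

Lemma cderivable_lipschitz G z : derivable G z 1 ->
  exists M : R, \forall w \near z, `|G w - G z| <= M%:C%C * `|w - z|.
Proof.
move=> /cderivP/cvg_ex[m /cderivable_lim /(_ _ (@ltr01 R)) Gm].
exists (complex.Re `|m| + 1); apply: filterS Gm => w.
have mM : `|m| = (complex.Re `|m|)%:C%C by rewrite normc_def.
have [->|wz /(_ isT)] := eqVneq w z; first by rewrite !subrr normr0 mulr0.
have wz0 : w - z != 0 by rewrite subr_eq0.
rewrite -ler_pdivrMr ?normr_gt0// -normf_div; set q := _ / _ => qm.
rewrite -[q](subrK m) (le_trans (ler_normD _ _))// [(_ + 1)%:C%C]rmorphD /= -mM.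
by rewrite distrC addrC lerD2l ltW.
Qed.

Lemma near_neq (P : set C) z : (\forall w \near z, P w) -> exists2 w, w != z & P w.
Proof.
move=> /near0_real[d d0 dP].
have td : 0 < d / 2 < d by rewrite divr_gt0//= ltr_pdivrMr// ltr_pMr// ltr1n.
exists (z + (d / 2)%:C%C * 1); last by apply: dP; rewrite ?normr1.
rewrite mulr1 -subr_eq0 addrAC subrr add0r (_ : 0 = 0%:C%C)// (inj_eq (@complexI _)).
by case/andP: td => /gt_eqF->.
Qed.

(** The first hypothesis says that an inverse of [F] is Lipschitz at [F z], so the difference
    quotients of [F] are bounded away from 0. *)
Lemma cderive_neq0 F z l (M : R) :
  (\forall w \near z, `|w - z| <= M%:C%C * `|F w - F z|) ->
  (forall e : R, 0 < e -> \forall w \near z, w != z ->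
    `|l - (F w - F z) / (w - z)| < e%:C%C) -> l != 0.
Proof.
move=> FM Fl; apply/eqP => l0; rewrite l0 in Fl.
pose e : R := (`|M| + 1)^-1.
have M0 : 0 < `|M| + 1 by rewrite ltr_wpDl.
have e0 : 0 < e by rewrite invr_gt0.
have [w wz [Mw lw]] : exists2 w, w != z & `|w - z| <= M%:C%C * `|F w - F z| /\
    (w != z -> `|0 - (F w - F z) / (w - z)| < e%:C%C).
  by apply: near_neq; near=> w; split; near: w => //; exact: Fl.
have := lw wz; rewrite sub0r normrN normf_div ltr_pdivrMr ?normr_gt0 ?subr_eq0// => lw'.
have : `|w - z| <= (`|M| + 1)%:C%C * `|F w - F z|.
  by apply: (le_trans Mw); rewrite ler_wpM2r// lecR (le_trans (ler_norm _))// lerDl.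
have -> : (`|M| + 1)%:C%C = (e%:C%C)^-1 :> R[i] by rewrite -fmorphV invrK.
rewrite ler_pdivlMl ?ltcR// => /le_lt_trans/(_ lw').
by rewrite ltxx.
Unshelve. all: by end_near. Qed.

(* A first-order substitute for the open mapping theorem: the derivative of an
   invertible map is nonzero, so the map leaves the half-plane near a point sent
   to the real axis. *)
Lemma dianalytic_interior s t A B f g z : nbhs z A ->
  dianalytic_at s A f z -> dianalytic_at t B g (f z) ->
  (\forall w \near z, A w -> [/\ B (f w), g (f w) = w & 0 <= complex.Im (f w)]) ->
  0 < complex.Im (f z).
Proof.
move=> nA [F nF] [G nG] Af.
have fF : \forall w \near z, conjn s (F w) = f w.
  near=> w; have Aw : A w by near: w.
  have [_ ->//] : derivable F w 1 /\ (A w -> F w = conjn s (f w)) by near: w.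
  by rewrite conjnK.
have dF := proj1 (nbhs_singleton nF).
have cf := dianalytic_continuous nA (ex_intro _ F nF).
have [_ _ Ifz] := nbhs_singleton Af (nbhs_singleton nA).
have /cderivP/cvg_ex[l /cderivable_lim Fl] := dF.
have Fz : conjn s (F z) = f z by exact: nbhs_singleton fF.
have FzE : F z = conjn s (f z) by rewrite -Fz conjnK.
have nGf : \forall w \near z, derivable G (f w) 1 /\
    (B (f w) -> G (f w) = conjn t (g (f w))).
  exact: (near_continuous cf nG).
have [M GM] := cderivable_lipschitz (proj1 (nbhs_singleton nG)).
have GfM := near_continuous cf GM.
have [Bz gz _] := nbhs_singleton Af (nbhs_singleton nA).
have Gfz := proj2 (nbhs_singleton nG) Bz.
have l0 : l != 0.
  apply: (@cderive_neq0 F z l M) => //; near=> w.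
  have Aw : A w by near: w.
  have [Bw gw _] : [/\ B (f w), g (f w) = w & 0 <= complex.Im (f w)].
    by move: Aw; near: w.
  have [_ /(_ Bw) Gw] : derivable G (f w) 1 /\ (B (f w) -> G (f w) = conjn t (g (f w))).
    by near: w.
  have Fw : conjn s (F w) = f w by near: w.
  rewrite -(norm_conjn t (w - z)) -[X in _ <= _ * X](norm_conjn s) !conjnB Fw Fz.
  by rewrite -[X in conjn t X - _]gw -[X in _ - conjn t X]gz -Gw -Gfz; near: w.
rewrite lt_neqAle Ifz andbT; apply/eqP => Ifz0.
pose e := complex.Re `|l|.
have le : `|l| = e%:C%C by rewrite /e normc_def.
have e0 : 0 < e by have := normr_gt0 l; rewrite l0 le ltcE /= => /andP[].
have /near0_real[d d0 dP] : \forall w \near z, 0 <= complex.Im (f w) /\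
    [/\ F w = conjn s (f w) & w != z -> `|l - (F w - F z) / (w - z)| < e%:C%C].
  near=> w; have Aw : A w by near: w.
  have [_ _ If] : [/\ B (f w), g (f w) = w & 0 <= complex.Im (f w)].
    by move: Aw; near: w.
  split=> //; split; first by have <- : conjn s (F w) = f w; [near: w|rewrite conjnK].
  by near: w; exact: Fl.
have td : 0 < d / 2 < d by rewrite divr_gt0//= ltr_pdivrMr// ltr_pMr// ltr1n.
(* The direction is chosen so that [l * u] is [-'i] times the norm of [l], or ['i] times it when [s]
   is true: to first order [f] moves straight down. The error per unit step is smaller than that
   norm and cannot bring [f] back to the half-plane. *)
pose u : C := conjn (~~ s) 'i%C * (`|l| / l).
have u1 : `|u| = 1.
  rewrite normrM norm_conjn normrM normfV normr_id divff ?normr_eq0// mulr1.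
  by rewrite normc_def /= expr0n expr1n add0r sqrtr1.
have := dP _ td u; rewrite u1 lexx => /(_ isT).
set a : C := (d / 2)%:C%C.
have a0 : a != 0.
  by rewrite /a (_ : 0 = 0%:C%C)// (inj_eq (@complexI _)); case/andP: td => /gt_eqF->.
set w := z + a * u; move=> [If [Fw]].
have wz : w - z = a * u by rewrite /w addrAC subrr add0r.
have u0 : u != 0 by rewrite -normr_gt0 u1.
rewrite -subr_eq0 wz mulf_neq0// => /(_ isT).
have lu : l * u = conjn (~~ s) 'i%C * `|l|.
  by rewrite /u mulrCA [l * _]mulrC divfK.
pose D := (F w - F z) / a.
have -> : (F w - F z) / (a * u) = D / u by rewrite invfM mulrA.
have -> : l - D / u = (conjn (~~ s) 'i%C * `|l| - D) / u.
  by rewrite -lu mulrBl mulfK.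
rewrite normrM normfV u1 invr1 mulr1 le => /(le_lt_trans (normc_ge_Im _)).
rewrite ltcR raddfB /=.
have -> : complex.Im D = complex.Im (F w) / (d / 2).
  have IFz : complex.Im (F z) = 0.
    by rewrite FzE; case: (s); rewrite //=; case: (f z) Ifz0 => ? ? /= <-; rewrite oppr0.
  have -> : D = (F w - F z) * ((d / 2)^-1)%:C%C by rewrite /D /a fmorphV.
  case: (F w) (F z) IFz => p q [p' q'] /= ->.
  by rewrite mulr0 add0r subr0.
have -> : complex.Im (conjn (~~ s) 'i%C * e%:C%C) = (-1) ^+ (~~ s) * e.
  by case: (s); rewrite /= ?mulr0 ?mul0r ?add0r ?mulN1r ?mul1r ?mulNr.
have d20 : 0 < d / 2 by case/andP: td.
rewrite Fw; case: (s); rewrite /conjn /negb.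
  have -> : complex.Im (conjc (f w)) = - complex.Im (f w) by case: (f w).
  have y0 : 0 <= complex.Im (f w) / (d / 2) by rewrite divr_ge0// ltW.
  by rewrite expr0 mul1r mulNr opprK ger0_norm ?addr_ge0 ?(ltW e0)// gtrDl ltNge y0.
have y0 : 0 <= complex.Im (f w) / (d / 2) by rewrite divr_ge0// ltW.
by rewrite expr1 mulN1r -opprD normrN ger0_norm ?addr_ge0 ?(ltW e0)// gtrDl ltNge y0.
Unshelve. all: by end_near. Qed.

Lemma Im_conjc z : complex.Im (conjc z) = - complex.Im z.
Proof. by case: z. Qed.

Lemma foldE z : fold z = conjn (complex.Im z < 0) z.
Proof.
case: z => a b; rewrite /fold /=; case: ltP => b0 /=.
  by rewrite ltr0_norm.
by rewrite ger0_norm.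
Qed.

(** Writing the reflection through [fold] gives one formula for both half-planes: [f] above and on
    the axis, [conjc \o f \o conjc] below. *)
Definition schwarz f z := conjn (complex.Im z < 0) (f (fold z)).

Lemma Im_fold_ge0 z : 0 <= complex.Im (fold z).
Proof. by case: z => a b /=. Qed.

Lemma fold_Im_ge0 z : 0 <= complex.Im z -> fold z = z.
Proof. by rewrite foldE leNgt => /negbTE ->. Qed.

Lemma fold_conjc z : fold (conjc z) = fold z.
Proof. by case: z => a b; rewrite /fold /= normrN. Qed.

Lemma conjc_Im0 z : complex.Im z = 0 -> conjc z = z.
Proof. by case: z => a b /= ->; rewrite oppr0. Qed.

Lemma conjn_Im0 s z : complex.Im z = 0 -> conjn s z = z.
Proof. by case: s => //; exact: conjc_Im0. Qed.

Lemma conjc_eqP z : conjc z = z -> complex.Im z = 0.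
Proof.
by case: z => a b /= [] /eqP; rewrite -subr_eq0 -opprD oppr_eq0 -mulr2n mulrn_eq0 => /eqP.
Qed.

Lemma fold_schwarz f z : 0 <= complex.Im (f (fold z)) -> fold (schwarz f z) = f (fold z).
Proof.
by move=> If; rewrite /schwarz /conjn; case: ifP => _; rewrite ?fold_conjc fold_Im_ge0.
Qed.

(** Along the real axis the difference quotients are real, hence so is their limit. *)
Lemma derivable_real_lim F z l : complex.Im z = 0 ->
  (\forall w \near z, complex.Im w = 0 -> complex.Im (F w) = 0) ->
  (forall e : R, 0 < e -> \forall w \near z, w != z ->
    `|l - (F w - F z) / (w - z)| < e%:C%C) -> conjc l = l.
Proof.
move=> Iz FR Fl; apply: conjc_Im0; apply/eqP/negPn/negP => Il.
have e0 : 0 < `|complex.Im l| by rewrite normr_gt0.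
have /near0_real[d d0 dP] : \forall w \near z,
    (complex.Im w = 0 -> complex.Im (F w) = 0) /\ (w != z ->
    `|l - (F w - F z) / (w - z)| < `|complex.Im l|%:C%C).
  by near=> w; split; near: w => //; exact: Fl.
have td : 0 < d / 2 < d by rewrite divr_gt0//= ltr_pdivrMr// ltr_pMr// ltr1n.
have := dP _ td 1; rewrite normr1 lexx mulr1 => /(_ isT)[].
set w := z + _; have -> : complex.Im w = 0 by rewrite /w raddfD /= Iz addr0.
move=> /(_ erefl) IFw; have wz : w - z = (d / 2)%:C%C by rewrite /w addrAC subrr add0r.
rewrite -subr_eq0 wz (_ : 0 = 0%:C%C)// (inj_eq (@complexI _)).
rewrite gt_eqF; last by case/andP: td.
move=> /(_ isT)/(le_lt_trans (normc_ge_Im _)); rewrite ltcR raddfB /=.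
have -> : complex.Im ((F w - F z) / (d / 2)%:C%C) = 0.
  rewrite -fmorphV; have := nbhs_singleton FR Iz.
  by case: (F w) (F z) IFw => p q [p' q'] /= -> ->; rewrite subrr mul0r mulr0 addr0.
by rewrite subr0 ltxx.
Unshelve. all: by end_near. Qed.

(* Pointwise complex differentiability suffices: on the real axis the difference
   quotients of the extension are those of [F] or their conjugates, and the
   derivative of [F] is real. *)
Lemma derivable_schwarz_real F z : complex.Im z = 0 ->
  (\forall w \near z, complex.Im w = 0 -> complex.Im (F w) = 0) ->
  derivable F z 1 -> derivable (schwarz F) z 1.
Proof.
move=> Iz FR /cderivP/cvg_ex[l /cderivable_lim Fl].
have lR := derivable_real_lim Iz FR Fl.
have Fz := nbhs_singleton FR Iz.
apply: (@cderivable_limP _ _ l) => e /Fl/nbhs_cplxP[d d0 dP].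
apply/nbhs_cplxP; exists d => // w wd wz.
have fz : fold z = z by rewrite fold_Im_ge0 ?Iz.
pose b := complex.Im w < 0; have wE : w = conjn b (fold w) by rewrite foldE conjnK.
have fw : `|fold w - z| < d%:C%C.
  by rewrite -(norm_conjn b) conjnB -wE (conjn_Im0 _ Iz).
have fwz : fold w != z.
  by apply: contra_neq wz => fwz; rewrite wE fwz conjn_Im0.
have := dP _ fw fwz.
have -> : schwarz F w = conjn b (F (fold w)) by [].
have -> : schwarz F z = F z by rewrite /schwarz Iz ltxx fz.
have -> : w - z = conjn b (fold w) - z by rewrite -wE.
have conjn_quot u v x y : conjn b u = u ->
    `|u - (conjn b v - conjn b x) / (conjn b y - conjn b z)| = `|u - (v - x) / (y - z)|.
  by case: (b) => // uR; rewrite -{1}uR conjc_quot.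
have lb : conjn b l = l by case: (b) => //; exact: lR.
have := conjn_quot l (F (fold w)) (F z) (fold w) lb.
by rewrite (conjn_Im0 b Fz) (conjn_Im0 b Iz) => ->.
Qed.

Lemma near_Im_gt0 z : 0 < complex.Im z -> \forall w \near z, 0 < complex.Im w.
Proof.
move=> z0; apply: (@Im_continuous z [set x | 0 < x]).
by apply: open_nbhs_nbhs; split; [exact: open_gt|].
Qed.

Lemma near_Im_lt0 z : complex.Im z < 0 -> \forall w \near z, complex.Im w < 0.
Proof.
move=> z0; apply: (@Im_continuous z [set x | x < 0]).
by apply: open_nbhs_nbhs; split; [exact: open_lt|].
Qed.

Lemma derivable_schwarz F z : derivable F (fold z) 1 ->
  (complex.Im z = 0 ->
    \forall w \near z, complex.Im w = 0 -> complex.Im (F w) = 0) ->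
  derivable (schwarz F) z 1.
Proof.
move=> dF FR; have [Iz|Iz|Iz] := ltgtP 0 (complex.Im z).
- have dFz : derivable F z 1 by rewrite -(fold_Im_ge0 (ltW Iz)).
  apply: (@near_derivable F (schwarz F) z _ dFz).
  apply: filterS (near_Im_gt0 Iz) => u u0.
  by rewrite /schwarz ltNge ltW//= fold_Im_ge0// ltW.
- have fz : fold z = conjc z by rewrite foldE Iz.
  rewrite fz in dF; have := derivable_conjn (s := true) dF; rewrite /conjn conjcK.
  apply: near_derivable; apply: filterS (near_Im_lt0 Iz) => u u0.
  by rewrite /schwarz foldE u0.
- have z0 : 0 <= complex.Im z by rewrite Iz.
  rewrite (fold_Im_ge0 z0) in dF.
  exact: derivable_schwarz_real (esym Iz) (FR (esym Iz)) dF.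
Qed.

Lemma relatively_open_near A z : relatively_open_in (upper_half_plane R) A ->
  A (fold z) -> \forall w \near z, A (fold w).
Proof.
move=> [U oU ->] [_ Uz].
have nU : \forall w \near fold z, U w by apply: open_nbhs_nbhs.
apply: filterS (near_continuous (@fold_continuous z) nU) => w Uw.
by split=> //; exact: Im_fold_ge0.
Qed.

(** Only values on the closed upper half-plane enter [schwarz F], and there the extension [F] agrees
    with [conjn s \o f] on [A]. Its values below the axis are discarded and replaced by the
    reflected ones. *)
Lemma dianalytic_schwarz s A f z : relatively_open_in (upper_half_plane R) A ->
  (forall w, A w -> complex.Im w = 0 -> complex.Im (f w) = 0) ->
  A (fold z) -> dianalytic_at s A f (fold z) ->
  dianalytic_at s (@fold R @^-1` A) (schwarz f) z.
Proof.
move=> oA fR Az [F nF]; exists (schwarz F).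
have nAz := relatively_open_near oA Az.
have nFz := near_continuous (@fold_continuous z) nF.
have /near_join nAF : \forall w \near z, A (fold w) /\
  (derivable F (fold w) 1 /\ (A (fold w) -> F (fold w) = conjn s (f (fold w)))).
  by near=> w; split; near: w.
near=> w; have nw : \forall u \near w, A (fold u) /\
  (derivable F (fold u) 1 /\ (A (fold u) -> F (fold u) = conjn s (f (fold u)))).
  by near: w.
have [Aw [dF Fw]] := nbhs_singleton nw.
split; last by move=> _; rewrite /schwarz Fw// conjnC.
apply: derivable_schwarz => // Iw; apply: filterS nw => u [Au [_ /(_ Au)]] + u0.
move: Au; rewrite fold_Im_ge0 ?u0// => Au ->.
by rewrite (conjn_Im0 _ (fR _ Au u0)); exact: fR.
Unshelve. all: by end_near. Qed.

End ComplexPlane.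

(** * Charts and their signs *)

Section ChartCalculus.
Context {R : realType}.
Local Notation C := (Cplx R).

Lemma within_continuousP (S T : topologicalType) (A : set S) (f : S -> T) :
  {within A, continuous f} <->
  forall x, A x -> forall P, nbhs (f x) P -> \forall y \near x, A y -> P (f y).
Proof.
rewrite subspace_continuousP; split=> H x Ax P fP; first exact: H fP.
by apply: H => //; exact: fP.
Qed.

Lemma cmap_continuous (T : topologicalType) (c : chart R T) x :
  cdom c x -> {for x, continuous c}.
Proof.
move=> cx P nP; have /within_continuousP/(_ _ cx _ nP) := @cmap_cts _ _ c.
have nx : \forall y \near x, cdom c y.
  by apply: open_nbhs_nbhs; split=> //; exact: cdom_open.
by move=> nc; apply: filterS (filterI nx nc) => y [cy]; apply.
Qed.

Lemma near_cmap (T : topologicalType) (c : chart R T) x (P : set C) : cdom c x ->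
  (\forall z \near c x, P z) -> \forall y \near x, P (c y).
Proof. by move=> cx; exact: cmap_continuous. Qed.

Lemma near_cdom (T : topologicalType) (c : chart R T) x :
  cdom c x -> \forall y \near x, cdom c y.
Proof. by move=> cx; apply: open_nbhs_nbhs; split=> //; exact: cdom_open. Qed.

(** The conclusion is restricted to [cimage c], which need not be a neighbourhood of [c x] at a
    boundary point. *)
Lemma near_cinv (T : topologicalType) (c : chart R T) x (P : set T) : cdom c x ->
  (\forall y \near x, P y) -> \forall z \near c x, cimage c z -> P (cinv c z).
Proof.
move=> cx nP; have /within_continuousP := @cinv_cts _ _ c.
by apply; [exists x|rewrite cmapK].
Qed.

Lemma cimage_cmap (T : topologicalType) (c : chart R T) x :
  cdom c x -> cimage c (c x).
Proof. by exists x. Qed.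

(* The sign records whether [f] is analytic ([false]) or antianalytic ([true])
   at [x] when read in the charts [c] and [d]. *)
Definition chart_sign (S T : topologicalType) s (c : chart R S) (d : chart R T)
    (f : S -> T) x :=
  dianalytic_at s (c @` (cdom c `&` f @^-1` cdom d))
    (fun z => d (f (cinv c z))) (c x).

Lemma in_charts_dianalyticP (S T : topologicalType) (c : chart R S)
    (d : chart R T) f :
  in_charts dianalytic_on c d f <->
  forall x, cdom c x -> cdom d (f x) -> exists s, chart_sign s c d f x.
Proof.
split=> [H x cx dx|H _ [x [cx dx] <-]].
  have [|a|a] := H (c x); first by exists x.
    by exists false.
  by exists true.
by have [[] a] := H x cx dx; [right|left].
Qed.

Section Composition.
Context (S T U : topologicalType).
Implicit Types (c : chart R S) (d : chart R T) (e : chart R U).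
Implicit Types (f : S -> T) (g : T -> U).

Lemma chart_sign_comp s t c d e f g x :
  cdom c x -> cdom d (f x) -> {for x, continuous f} ->
  chart_sign s c d f x -> chart_sign t d e g (f x) ->
  cdom e (g (f x)) -> chart_sign (s (+) t) c e (g \o f) x.
Proof.
move=> cx dx cf fs gt egx.
have nd : \forall y \near x, cdom d (f y) by apply: cf; exact: near_cdom.
have nz := near_cinv cx nd.
(* [A] keeps only the points whose image passes through the intermediate chart [d]; near [c x] this
   loses nothing, by continuity of [f]. *)
pose A := c @` (cdom c `&` (f @^-1` cdom d `&` (g \o f) @^-1` cdom e)).
apply: (@dianalytic_atW _ _ A _ ((fun w => e (g (cinv d w))) \o
  (fun z => d (f (cinv c z))))).
  apply: filterS nz => z nz [y [cy ey] yz].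
  have := nz; rewrite -yz => /(_ (cimage_cmap cy)); rewrite cmapK// => dy.
  by split; [exists y|rewrite /= cmapK// cmapK].
apply: (dianalytic_at_comp (B := d @` (cdom d `&` g @^-1` cdom e))).
- by exists x.
- near=> z => -[y [cy [dy ey]] <-]; rewrite cmapK//.
  by exists (f y).
- apply: dianalytic_atW fs; near=> z => -[y [cy [dy ey]] <-].
  by split=> //; exists y.
- by rewrite cmapK.
Unshelve. all: by end_near. Qed.

Lemma chart_sign_near s c d f f' x : cdom c x ->
  (\forall y \near x, f y = f' y) -> chart_sign s c d f x ->
  chart_sign s c d f' x.
Proof.
move=> cx ff'; apply: dianalytic_atW.
apply: filterS (near_cinv cx ff') => z + [y [cy dy] yz].
rewrite -yz => /(_ (cimage_cmap cy)); rewrite cmapK// => fy.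
by split; [exists y => //; split=> //; rewrite /= fy|rewrite fy].
Qed.

Lemma chart_sign_open s c d f x : cdom c x -> chart_sign s c d f x ->
  \forall y \near x, cdom c y -> chart_sign s c d f y.
Proof.
move=> cx /dianalytic_at_near fs.
by apply: filterS (near_cmap cx fs).
Qed.

End Composition.

Lemma chart_sign_id (T : topologicalType) (c : chart R T) x :
  chart_sign false c c id x.
Proof.
apply: dianalytic_atW (dianalytic_at_conjn false (c x) setT).
by near=> z => -[y [cy _] <-]; split=> //=; rewrite cmapK.
Unshelve. all: by end_near. Qed.

(** The source of all uniqueness of signs: conjugation is not analytic on a relatively open subset
    of the half-plane or of the plane. *)
Lemma chart_sign_id_false (T : topologicalType) s M (c : chart R T) x :
  half_or_plane M -> chart_into M c -> cdom c x ->
  chart_sign s c c id x -> s = false.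
Proof.
case: s => // HM oc cx cs; exfalso.
apply: (conjc_not_analytic HM oc (cimage_cmap cx)).
apply: dianalytic_atW cs; near=> z => -[y cy <-].
by split; [exists y|rewrite cmapK].
Unshelve. all: by end_near. Qed.

Lemma chart_sign_compl (S T : topologicalType) s t (c d : chart R S) (e : chart R T)
    (f : S -> T) x :
  cdom c x -> cdom d x -> cdom e (f x) ->
  chart_sign s c d id x -> chart_sign t d e f x -> chart_sign (s (+) t) c e f x.
Proof.
move=> cx dx ex cd df; have ci : {for x, continuous (@id S)} by exact: cvg_id.
exact: (chart_sign_comp cx dx ci cd df ex).
Qed.

Lemma chart_sign_compr (S T : topologicalType) s t (c : chart R S)
    (d e : chart R T) (f : S -> T) x :
  cdom c x -> cdom d (f x) -> cdom e (f x) -> {for x, continuous f} ->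
  chart_sign s c d f x -> chart_sign t d e id (f x) -> chart_sign (s (+) t) c e f x.
Proof.
by move=> cx dx ex cf cd de; exact: (chart_sign_comp (g := id) cx dx cf cd de ex).
Qed.

(** The inverse is given as a total function because a chart carries a total [cinv], which
    [pull_chart] has to produce. *)
Definition local_homeo (S T : topologicalType) (f : S -> T) (U : set S)
    (g : T -> S) :=
  [/\ open U, open (f @` U), forall x, U x -> g (f x) = x,
      forall x, U x -> {for x, continuous f} &
      forall y, (f @` U) y -> {for y, continuous g}].

Section PullChart.
Context (S T : topologicalType) (f : S -> T) (U : set S) (g : T -> S).
Hypothesis fUg : local_homeo f U g.
Variable c : chart R T.

Let D := U `&` f @^-1` cdom c.

Fact pull_open : open D.
Proof.
case: fUg => oU _ _ cf _; rewrite openE => x [Ux cx].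
apply: filterI; first by apply: open_nbhs_nbhs.
by apply: cf => //; exact: near_cdom.
Qed.

Fact pullK x : D x -> (g \o cinv c) ((c \o f) x) = x.
Proof. by case: fUg => _ _ gf _ _ [Ux cx]; rewrite /= cmapK// gf. Qed.

Fact pull_cts : {within D, continuous (c \o f)}.
Proof.
case: fUg => oU _ _ cf _; apply/within_continuousP => x [Ux cx] P nP.
have nfP := near_cmap (x := f x) cx nP.
have : \forall y \near x, P (c (f y)) by exact: cf nfP.
by apply: filterS => y.
Qed.

Fact pull_inv_cts : {within (c \o f) @` D, continuous (g \o cinv c)}.
Proof.
case: fUg => oU _ gf cf cg; apply/within_continuousP => _ [x [Ux cx] <-] P.
rewrite /= cmapK// => nP.
have : nbhs (f x) (g @^-1` P) by apply: cg => //; exists x.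
move/(near_cinv cx); apply: filterS => z nz [y [Uy cy] yz].
by apply: nz; exists (f y).
Qed.

Definition pull_chart : chart R S := Chart pull_open pullK pull_cts pull_inv_cts.

Lemma pull_chart_into M : chart_into M c -> chart_into M pull_chart.
Proof.
case: fUg => oU ofU gf cf cg [V oV cV].
pose W := \bigcup_(W in [set W | open W /\ forall z, W z -> cimage c z ->
  (f @` U) (cinv c z)]) W.
have oW : open W by apply: bigcup_open => ? [].
exists (V `&` W); first exact: openI.
apply/seteqP; split=> z.
  move=> [x [Ux cx] <-].
  have : cimage c (c (f x)) by exists (f x).
  rewrite cV => -[Mz Vz]; split=> //; split=> //.
  have nU : nbhs (f x) (f @` U).
    by apply: open_nbhs_nbhs; split=> //; exists x.
  have := near_cinv cx nU; rewrite /prop_near1 nbhsE => -[V' [oV' V'z] V'U].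
  by exists V'.
move=> [Mz [Vz [V' [oV' V'U] V'z]]].
have cz : cimage c z by rewrite cV.
have [x Ux xz] := V'U _ V'z cz; case: cz xz => y cy <-; rewrite cmapK// => xy.
by exists x; rewrite /= ?xy//; split=> //=; rewrite xy.
Qed.

End PullChart.

Section Dianalytic.
Implicit Types X Y Z : klein_surface R.

Lemma atlas_compatible X (c : chart R X) : atlas c -> compatible_chart c.
Proof. by move=> ac d ad; split; exact: atlas_dianalytic. Qed.

Lemma atlas_dianalytic_chart X (c : chart R X) : atlas c -> dianalytic_chart c.
Proof. by move=> ac; split; [exact: atlas_half_plane|exact: atlas_compatible]. Qed.

(** Compatibility is tested only against the atlas, so the transition is factored through an atlas
    chart at [x]. *)
Lemma compatible_sign X (c d : chart R X) x : compatible_chart c ->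
  compatible_chart d -> cdom c x -> cdom d x -> exists s, chart_sign s c d id x.
Proof.
move=> cc cd cx dx; have [e ae ex] := atlas_cover x.
have [/in_charts_dianalyticP/(_ x cx ex)[s cs] _] := cc _ ae.
have [_ /in_charts_dianalyticP/(_ x ex dx)[t dt]] := cd _ ae.
by exists (s (+) t); exact: (chart_sign_compl cx ex dx cs dt).
Qed.

Lemma compatible_chartP X (c : chart R X) :
  (forall x, cdom c x -> exists d, [/\ compatible_chart d, cdom d x,
    exists s, chart_sign s c d id x & exists s, chart_sign s d c id x]) ->
  compatible_chart c.
Proof.
move=> H e ae; have ce := atlas_compatible ae.
split; apply/in_charts_dianalyticP => x cx ex.
  have [d [cd dx [s cs] _]] := H x cx.
  have [t dt] := compatible_sign cd ce dx ex.
  by exists (s (+) t); exact: (chart_sign_compl cx dx ex cs dt).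
have [d [cd dx _ [s cs]]] := H x ex.
have [t dt] := compatible_sign ce cd cx dx.
by exists (t (+) s); exact: (chart_sign_compl cx dx ex dt cs).
Qed.

(** The image of a compatible chart is unconstrained, so the sign is first conjugated by an atlas
    chart, to which [chart_sign_id_false] applies. *)
Lemma sign_uniq X s t (c : chart R X) x : cdom c x -> compatible_chart c ->
  chart_sign s c c id x -> chart_sign t c c id x -> s = t.
Proof.
move=> cx cc cs ct; have [d ad dx] := atlas_cover x.
have Hd : half_or_plane (upper_half_plane R) by left.
have [u cd] := compatible_sign cc (atlas_compatible ad) cx dx.
have [v dc] := compatible_sign (atlas_compatible ad) cc dx cx.
have key w : chart_sign w c c id x -> v (+) w (+) u = false.
  move=> cw; apply: (chart_sign_id_false Hd (atlas_half_plane ad) dx).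
  have vw : chart_sign (v (+) w) d c id x.
    exact: (chart_sign_compl dx cx cx dc cw).
  exact: (chart_sign_compl dx cx dx vw cd).
by have := key s cs; have := key t ct; case: (s) (t) (u) (v) => [] [] [] [].
Qed.

(** One pair of charts suffices here; [dian_sign] then yields a sign in every compatible pair. *)
Definition dian X Y (f : X -> Y) x :=
  {for x, continuous f} /\ exists c d, [/\ compatible_chart c,
    compatible_chart d, cdom c x, cdom d (f x) & exists s, chart_sign s c d f x].

Lemma dian_sign X Y (f : X -> Y) x c d : dian f x -> compatible_chart c ->
  compatible_chart d -> cdom c x -> cdom d (f x) -> exists s, chart_sign s c d f x.
Proof.
move=> [cf [c' [d' [cc' cd' cx' dx' [s fs]]]]] cc cd cx dx.
have [t ct] := compatible_sign cc cc' cx cx'.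
have [u du] := compatible_sign cd' cd dx' dx.
exists (t (+) s (+) u).
have ts : chart_sign (t (+) s) c d' f x.
  exact: (chart_sign_compl cx cx' dx' ct fs).
exact: (chart_sign_compr cx dx' dx cf ts du).
Qed.

Lemma dian_id X (x : X) : dian id x.
Proof.
split; first exact: cvg_id.
have [c ac cx] := atlas_cover x; have cc := atlas_compatible ac.
by exists c, c; split=> //; exists false; exact: chart_sign_id.
Qed.

Lemma dian_comp X Y Z (f : X -> Y) (g : Y -> Z) x :
  dian f x -> dian g (f x) -> dian (g \o f) x.
Proof.
move=> df dg; split; first by apply: continuous_comp; [case: df|case: dg].
have [c ac cx] := atlas_cover x; have cc := atlas_compatible ac.
have [d ad dx] := atlas_cover (f x); have cd := atlas_compatible ad.
have [e ae ex] := atlas_cover (g (f x)); have ce := atlas_compatible ae.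
exists c, e; split=> //.
have [s fs] := dian_sign df cc cd cx dx.
have [t gt] := dian_sign dg cd ce dx ex.
by exists (s (+) t); apply: (chart_sign_comp cx dx _ fs gt) => //; case: df.
Qed.

Lemma near_for_continuous (S T : topologicalType) (f g : S -> T) x :
  (\forall y \near x, f y = g y) -> {for x, continuous f} -> {for x, continuous g}.
Proof.
move=> fg cf; have fgx : f x = g x := nbhs_singleton fg.
suff : g y @[y --> x] --> f x by rewrite fgx.
by apply: cvg_trans cf; apply: near_eq_cvg; apply: filterS fg => y ->.
Qed.

Lemma dian_near X Y (f g : X -> Y) x :
  (\forall y \near x, f y = g y) -> dian f x -> dian g x.
Proof.
move=> fg df; have fgx : f x = g x := nbhs_singleton fg.
split; first by apply: near_for_continuous fg _; case: df.
have [_ [c [d [cc cd cx dx [s fs]]]]] := df.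
exists c, d; split; rewrite -?fgx//.
by exists s; exact: chart_sign_near fg fs.
Qed.

(** Composing with the local left inverse [g] turns two signs of [f] into two signs of the
    identity. *)
Lemma dian_sign_uniq X Y s t (f : X -> Y) (g : Y -> X) x c d :
  {for x, continuous f} -> dian g (f x) -> (\forall y \near x, g (f y) = y) ->
  compatible_chart c -> compatible_chart d -> cdom c x -> cdom d (f x) ->
  chart_sign s c d f x -> chart_sign t c d f x -> s = t.
Proof.
move=> cf dg gf cc cd cx dx fs ft.
have gfx : g (f x) = x := nbhs_singleton gf.
have cgx : cdom c (g (f x)) by rewrite gfx.
have [u gu] := dian_sign dg cd cc dx cgx.
have key w : chart_sign w c d f x -> chart_sign (w (+) u) c c id x.
  by move=> fw; apply: (chart_sign_near cx gf); exact: (chart_sign_comp cx dx cf fw gu cgx).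
have := sign_uniq cx cc (key s fs) (key t ft).
by case: (s) (t) (u) => [] [] [].
Qed.

(* Local dianalytic isomorphism: the local inverse [g] is total but only
   meaningful on [f @` U]. *)
Definition liso X Y (f : X -> Y) (U : set X) (g : Y -> X) :=
  [/\ local_homeo f U g, forall x, U x -> dian f x &
      forall y, (f @` U) y -> dian g y].

Definition liso_at X Y (f : X -> Y) x := exists U g, U x /\ liso f U g.

End Dianalytic.

End ChartCalculus.

(** * Local dianalytic isomorphisms, folds and the boundary *)

Section LocalIso.
Context {R : realType}.
Local Notation C := (Cplx R).
Implicit Types X Y Z : klein_surface R.

Lemma local_homeo_open (S T : topologicalType) (f : S -> T) U g W :
  local_homeo f U g -> open W -> W `<=` U -> open (f @` W).
Proof.
move=> [oU ofU gf cf cg] oW WU; rewrite openE => _ [x Wx <-].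
have nW : \forall y \near f x, W (g y).
  apply: cg; first by exists x => //; exact: WU.
  by apply: open_nbhs_nbhs; split=> //; rewrite gf//; exact: WU.
have nU : \forall y \near f x, (f @` U) y.
  by apply: open_nbhs_nbhs; split=> //; exists x => //; exact: WU.
apply: filterS (filterI nW nU) => y [Wy [u Uu uy]].
by exists u => //; rewrite -uy gf in Wy.
Qed.

Lemma local_homeo_sub (S T : topologicalType) (f : S -> T) U g W :
  local_homeo f U g -> open W -> W `<=` U -> local_homeo f W g.
Proof.
move=> fUg oW WU; have := local_homeo_open fUg oW WU.
case: fUg => oU ofU gf cf cg ofW; split=> //.
- by move=> x Wx; apply: gf; exact: WU.
- by move=> x Wx; apply: cf; exact: WU.
- by move=> _ [x Wx <-]; apply: cg; exists x => //; exact: WU.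
Qed.

Lemma local_homeo_inv (S T : topologicalType) (f : S -> T) U g :
  local_homeo f U g -> local_homeo g (f @` U) f.
Proof.
move=> [oU ofU gf cf cg].
have gfU : g @` (f @` U) = U.
  apply/seteqP; split=> [_ [_ [x Ux <-] <-]|x Ux]; first by rewrite gf.
  by exists (f x); [exists x|rewrite gf].
split=> //; rewrite ?gfU//.
by move=> _ [x Ux <-]; rewrite gf.
Qed.

Lemma local_homeo_comp (S T V : topologicalType) (f : S -> T) (f' : T -> V)
    U g U' g' :
  local_homeo f U g -> local_homeo f' U' g' ->
  local_homeo (f' \o f) (U `&` f @^-1` U') (g \o g').
Proof.
move=> fUg fUg'.
have [oU ofU gf cf cg] := fUg; have [oU' ofU' gf' cf' cg'] := fUg'.
have oW : open (U `&` f @^-1` U').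
  rewrite openE => x [Ux U'x]; apply: filterI; first exact: open_nbhs_nbhs.
  by apply: cf => //; exact: open_nbhs_nbhs.
have WE : (f' \o f) @` (U `&` f @^-1` U') = f' @` (f @` (U `&` f @^-1` U')).
  by rewrite image_comp.
split=> //.
- rewrite WE; apply: (local_homeo_open fUg').
    by apply: (local_homeo_open fUg oW) => x [].
  by move=> _ [x [_ ?] <-].
- by move=> x [Ux U'x] /=; rewrite gf' ?gf.
- by move=> x [Ux U'x]; apply: continuous_comp; [exact: cf|exact: cf'].
- move=> _ [x [Ux U'x] <-]; apply: continuous_comp.
    by apply: cg'; exists (f x).
  by rewrite /= gf'//; apply: cg; exists x.
Qed.

Lemma local_homeo_eq (S T : topologicalType) (f f' : S -> T) U g :
  local_homeo f U g -> (forall x, U x -> f x = f' x) -> local_homeo f' U g.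
Proof.
move=> [oU ofU gf cf cg] ff'.
have E : f' @` U = f @` U.
  by apply/seteqP; split=> _ [x Ux <-]; exists x; rewrite // ff'.
split=> //; rewrite ?E//.
- by move=> x Ux; rewrite -ff'// gf.
- move=> x Ux; apply: near_for_continuous (cf x Ux).
  have nU : nbhs x U by exact: open_nbhs_nbhs.
  exact: filterS nU.
Qed.

Lemma local_homeo_id (T : topologicalType) (U : set T) :
  open U -> local_homeo id U id.
Proof. by move=> oU; split; rewrite ?image_id//; move=> x _; exact: cvg_id. Qed.

Lemma liso_sub X Y (f : X -> Y) U g W : liso f U g -> open W -> W `<=` U -> liso f W g.
Proof.
move=> [fUg df dg] oW WU; split; first exact: local_homeo_sub fUg oW WU.
  by move=> x /WU; exact: df.
by move=> _ [x Wx <-]; apply: dg; exists x => //; exact: WU.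
Qed.

Lemma liso_inv X Y (f : X -> Y) U g : liso f U g -> liso g (f @` U) f.
Proof.
move=> [fUg df dg]; split=> //; first exact: local_homeo_inv.
case: fUg => _ _ gf _ _ x [_ [y Uy <-] <-].
by rewrite gf//; exact: df.
Qed.

Lemma liso_comp X Y Z (f : X -> Y) (f' : Y -> Z) U g U' g' :
  liso f U g -> liso f' U' g' -> liso (f' \o f) (U `&` f @^-1` U') (g \o g').
Proof.
move=> [fUg df dg] [fUg' df' dg']; split; first exact: local_homeo_comp.
  by move=> x [Ux U'x]; apply: dian_comp; [exact: df|exact: df'].
case: fUg' => _ _ gf' _ _ _ [x [Ux U'x] <-]; apply: dian_comp.
  by apply: dg'; exists (f x).
by rewrite /= gf'//; apply: dg; exists x.
Qed.

Lemma liso_eq X Y (f f' : X -> Y) U g :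
  liso f U g -> (forall x, U x -> f x = f' x) -> liso f' U g.
Proof.
move=> [fUg df dg] ff'; split; first exact: local_homeo_eq ff'.
  move=> x Ux; apply: dian_near (df x Ux).
  have nU : nbhs x U by case: fUg => oU _ _ _ _; exact: open_nbhs_nbhs.
  exact: filterS nU.
by move=> _ [x Ux <-]; apply: dg; exists x => //; rewrite ff'.
Qed.

Lemma liso_id X (U : set X) : open U -> liso id U id.
Proof. by move=> oU; split; [exact: local_homeo_id| |]; move=> x _; exact: dian_id. Qed.

Lemma liso_at_within X Y (f : X -> Y) x (W : set X) : liso_at f x -> nbhs x W ->
  exists U g, [/\ U x, U `<=` W & liso f U g].
Proof.
move=> [U [g [Ux fUg]]]; rewrite nbhsE => -[V [oV Vx] VW].
have oU : open U by case: fUg => -[].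
exists (U `&` V), g; split=> //.
  by move=> y [_ /VW].
by apply: liso_sub fUg _ _; [exact: openI|move=> y []].
Qed.

Lemma liso_at_comp X Y Z (f : X -> Y) (g : Y -> Z) x :
  liso_at f x -> liso_at g (f x) -> liso_at (g \o f) x.
Proof.
move=> [U [f' [Ux fU]]] [V [g' [Vx gV]]].
by exists (U `&` f @^-1` V), (f' \o g'); split=> //; exact: liso_comp.
Qed.

Lemma liso_at_near X Y (f g : X -> Y) x :
  (\forall y \near x, f y = g y) -> liso_at f x -> liso_at g x.
Proof.
move=> fg fx; have [U [f' [Ux UW fU]]] := liso_at_within fx fg.
by exists U, f'; split=> //; exact: liso_eq fU UW.
Qed.

Lemma liso_at_dian X Y (f : X -> Y) x : liso_at f x -> dian f x.
Proof. by move=> [U [g [Ux [_ df _]]]]; exact: df. Qed.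

Lemma liso_at_continuous X Y (f : X -> Y) x : liso_at f x -> {for x, continuous f}.
Proof. by case/liso_at_dian. Qed.

Lemma pull_compatible X Y (f : X -> Y) U g (fUg : liso f U g) (c : chart R Y) :
  compatible_chart c ->
  compatible_chart (pull_chart (let: And3 h _ _ := fUg in h) c).
Proof.
case: fUg => fUg df dg cc; apply/compatible_chartP => x [Ux cx].
have gf : g (f x) = x by case: fUg => _ _ ->.
have [d ad dx] := atlas_cover x; have cd := atlas_compatible ad.
exists d; split=> //.
  have fx : dian g (f x) by apply: dg; exists x.
  have [|s gs] := dian_sign fx cc cd cx; first by rewrite gf.
  exists s; apply: dianalytic_atW gs; near=> z => -[y [[Uy cy] dy] <-] /=.
  rewrite cmapK//; split=> //; exists (f y) => //; split=> //=.
  by case: fUg => _ _ ->.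
have [s fs] := dian_sign (df x Ux) cd cc dx cx.
exists s; apply: dianalytic_atW fs; near=> z => -[y [dy [Uy cy]] <-].
by split=> //; exists y.
Unshelve. all: by end_near. Qed.

Definition restr_chart X (c : chart R X) (U : set X) (oU : open U) :=
  pull_chart (local_homeo_id oU) c.

Lemma restr_compatible X (c : chart R X) (U : set X) (oU : open U) :
  compatible_chart c -> compatible_chart (restr_chart c oU).
Proof. exact: (pull_compatible (liso_id oU)). Qed.

Lemma restr_dianalytic X (c : chart R X) (U : set X) (oU : open U) :
  dianalytic_chart c -> dianalytic_chart (restr_chart c oU).
Proof. by move=> [? ?]; split; [exact: pull_chart_into|exact: restr_compatible]. Qed.

Lemma local_homeo_charts X Y (f : X -> Y) (c : chart R X) (d : chart R Y) :
  f @` cdom c = cdom d -> (forall x, cdom c x -> d (f x) = c x) ->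
  local_homeo f (cdom c) (cinv c \o d).
Proof.
move=> fcd df.
have dfx x : cdom c x -> cdom d (f x) by move=> cx; rewrite -fcd; exists x.
split; rewrite ?fcd; try exact: cdom_open.
- by move=> x cx; rewrite /= df// cmapK.
- move=> x cx P nP.
  have := near_cinv (dfx x cx) nP; rewrite df// => /(near_cmap cx) n1.
  apply: filterS (filterI n1 (near_cdom cx)) => y [+ cy].
  by rewrite -df// cmapK; [apply; apply: cimage_cmap|]; exact: dfx.
- move=> y; rewrite -fcd => -[x cx <-] P.
  rewrite /= df// cmapK// => nP.
  have := near_cinv cx nP; rewrite -df// => /(near_cmap (dfx x cx)) n1.
  apply: filterS (filterI n1 (near_cdom (dfx x cx))) => v [+ dv].
  by apply; move: dv; rewrite -fcd => -[u cu <-]; rewrite df//; exact: cimage_cmap.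
Qed.

Lemma unbranched_liso X Y (f : X -> Y) x : unbranched_at f x -> liso_at f x.
Proof.
move=> [c [d [[_ cc] [_ cd] cx fcd df]]].
exists (cdom c), (cinv c \o d); split=> //.
have fh := local_homeo_charts fcd df.
have dfx y : cdom c y -> cdom d (f y) by move=> cy; rewrite -fcd; exists y.
have [_ _ gf cf cg] := fh.
split=> // [y cy|_ [y cy <-]].
  split; first exact: cf.
  exists c, d; split=> //; first exact: dfx.
  exists false; apply: dianalytic_atW (dianalytic_at_conjn false (c y) setT).
  by near=> z => -[u [cu du] <-]; split=> //=; rewrite cmapK// df.
split; first by apply: cg; exists y.
exists d, c; split=> //; [exact: dfx|by rewrite gf|].
exists false; apply: dianalytic_atW (dianalytic_at_conjn false (d (f y)) setT).
near=> z => -[u [du cu] <-]; split=> //=; rewrite cmapK//.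
by move: du; rewrite -fcd => -[v cv <-]; rewrite df// cmapK.
Unshelve. all: by end_near. Qed.

(** Upstairs one takes the pull-back of a chart downstairs, and in these two charts [f] is literally
    the identity. *)
Lemma liso_unbranched X Y (f : X -> Y) x : liso_at f x -> unbranched_at f x.
Proof.
move=> [U [g [Ux fUg]]]; have [d ad dx] := atlas_cover (f x).
have [hd cd] := atlas_dianalytic_chart ad.
have ofU : open (f @` U) by case: fUg => -[].
exists (pull_chart (let: And3 h _ _ := fUg in h) d), (restr_chart d ofU).
split=> //.
- by split; [exact: pull_chart_into|exact: pull_compatible].
- exact: restr_dianalytic.
- apply/seteqP; split=> [_ [y [Uy dy] <-]|_ [[y Uy <-] dy]].
    by split=> //; exists y.
  by exists y.
Qed.

Lemma near_cimage (T : topologicalType) (c : chart R T) x M (P : set T) :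
  chart_into M c -> cdom c x -> nbhs (c x) M -> (\forall y \near x, P y) ->
  \forall z \near c x, cimage c z /\ P (cinv c z).
Proof.
move=> [V oV cV] cx nM nP.
have nV : nbhs (c x) V.
  apply: open_nbhs_nbhs; split=> //.
  by have := cimage_cmap cx; rewrite cV => -[].
apply: filterS (filterI (filterI nM nV) (near_cinv cx nP)) => z [[Mz Vz] nz].
have cz : cimage c z by rewrite cV.
by split=> //; exact: nz.
Qed.

Lemma nbhs_half_plane (z : C) : 0 < complex.Im z -> nbhs z (upper_half_plane R).
Proof. by move=> /near_Im_gt0; apply: filterS => w; exact: ltW. Qed.

Lemma dianalytic_chart_Im X (c : chart R X) x :
  dianalytic_chart c -> cdom c x -> 0 <= complex.Im (c x).
Proof. by move=> [[V _ cV] _] /cimage_cmap; rewrite cV => -[]. Qed.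

(** At an interior point of [c] the image of [c] is a full neighbourhood; the transition to [d] is
    invertible and stays in the half-plane, so [dianalytic_interior] keeps it off the real axis. *)
Lemma boundary_chart_invariance X (c d : chart R X) x :
  dianalytic_chart c -> dianalytic_chart d -> cdom c x -> cdom d x ->
  0 < complex.Im (c x) -> 0 < complex.Im (d x).
Proof.
move=> [hc cc] hd cx dx cx0; have [_ cd] := hd.
have [s cds] := compatible_sign cc cd cx dx.
have [t dct] := compatible_sign cd cc dx cx.
have ndx := near_cimage hc cx (nbhs_half_plane cx0) (near_cdom dx).
rewrite -[in d x](cmapK cx).
apply: (@dianalytic_interior _ s t (c @` (cdom c `&` id @^-1` cdom d))
  (d @` (cdom d `&` id @^-1` cdom c)) (fun z => d (cinv c z)) (fun z => c (cinv d z))).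
- by apply: filterS ndx => z [[y cy <-]]; rewrite cmapK// => dy; exists y.
- exact: cds.
- by rewrite cmapK.
- near=> z => -[y [cy dy] <-]; rewrite cmapK//; split; first by exists y.
    by rewrite cmapK.
  exact: dianalytic_chart_Im hd dy.
Unshelve. all: by end_near. Qed.

Lemma boundaryP X (c : chart R X) x : dianalytic_chart c -> cdom c x ->
  boundary X x <-> complex.Im (c x) = 0.
Proof.
move=> hc cx; split=> [[d [ad dx d0]]|c0].
  apply/eqP/negPn/negP => cN.
  have c0 : 0 < complex.Im (c x).
    by rewrite lt_neqAle eq_sym cN (dianalytic_chart_Im hc).
  have := boundary_chart_invariance hc (atlas_dianalytic_chart ad) cx dx c0.
  by rewrite d0 ltxx.
have [d ad dx] := atlas_cover x; exists d; split=> //.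
have hd := atlas_dianalytic_chart ad.
apply/eqP/negPn/negP => dN.
have d0 : 0 < complex.Im (d x).
  by rewrite lt_neqAle eq_sym dN (dianalytic_chart_Im hd).
by have := boundary_chart_invariance hd hc dx cx d0; rewrite c0 ltxx.
Qed.

Lemma folds_boundary X Y (f : X -> Y) x : folds_at f x -> boundary Y (f x).
Proof.
move=> [c [d [_ hd [cx c0] fcd df]]].
have dx : cdom d (f x) by apply: fcd; exists x.
by apply/(boundaryP hd dx); rewrite df//; case: (c x) c0 => a b /= ->; rewrite normr0.
Qed.

Lemma unbranched_boundary X Y (f : X -> Y) x : unbranched_at f x ->
  boundary Y (f x) <-> boundary X x.
Proof.
move=> [c [d [hc hd cx fcd df]]].
have dx : cdom d (f x) by rewrite -fcd; exists x.
by rewrite (boundaryP hc cx) (boundaryP hd dx) df.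
Qed.

(** The image of a plane chart is open, so near a real point it contains conjugate pairs; these have
    the same fold, and [d] is injective. *)
Lemma fold_local X Y (f : Y -> X) y (c : chart R Y) (d : chart R X) (W : set Y) :
  plane_chart c -> cdom c y -> complex.Im (c y) = 0 ->
  f @` cdom c `<=` cdom d -> (forall y', cdom c y' -> d (f y') = fold (c y')) ->
  nbhs y W ->
  \forall z \near c y, [/\ cimage c z, cimage c (conjc z), W (cinv c z),
    W (cinv c (conjc z)) & f (cinv c z) = f (cinv c (conjc z))].
Proof.
move=> [hc _] cy c0 fcd df nW.
have nT : nbhs (c y) [set: C] by exact: filterT.
have n1 := near_cimage hc cy nT nW.
have n2 : \forall z \near c y, cimage c (conjc z) /\ W (cinv c (conjc z)).
  apply: (@near_continuous _ (@conjc R) (c y) (fun z => cimage c z /\ W (cinv c z))).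
    exact: conjc_continuous.
  by rewrite conjc_Im0.
apply: filterS (filterI n1 n2) => z [[cz Wz] [cz' Wz']]; split=> //.
case: cz Wz => u cu uz _; case: cz' Wz' => v cv vz _.
rewrite -vz -uz !cmapK//.
have du : cdom d (f u) by apply: fcd; exists u.
have dv : cdom d (f v) by apply: fcd; exists v.
by rewrite -(cmapK du) -(cmapK dv) !df// uz vz fold_conjc.
Qed.

Lemma near_nonreal (P : set C) (z : C) : complex.Im z = 0 -> (\forall w \near z, P w) ->
  exists2 w, 0 < complex.Im w & P w.
Proof.
move=> z0 /near0_real[d d0 dP].
have td : 0 < d / 2 < d by rewrite divr_gt0//= ltr_pdivrMr// ltr_pMr// ltr1n.
exists (z + (d / 2)%:C%C * 'i%C).
  by rewrite raddfD /= z0 mulr1 mul0r addr0 add0r; case/andP: td.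
by apply: dP => //; rewrite normc_def /= expr0n expr1n add0r sqrtr1.
Qed.

(** Conjugate non-real points witness that a fold is injective on no neighbourhood; this is how
    folds are told apart from unbranched points. *)
Lemma fold_pairs X Y (f : Y -> X) y (W : set Y) : folds_at f y -> nbhs y W ->
  exists u u', [/\ W u, W u', u <> u' & f u = f u'].
Proof.
move=> [c [d [hc hd [cy c0] fcd df]]] nW.
have [z z0 [cz cz' Wz Wz' fz]] := near_nonreal c0 (fold_local hc cy c0 fcd df nW).
exists (cinv c z), (cinv c (conjc z)); split=> // zz'.
have : z = conjc z.
  by case: cz cz' zz' => u cu <- [v cv <-]; rewrite !cmapK// => ->.
by move/esym/conjc_eqP => zR; rewrite zR ltxx in z0.
Qed.

Lemma folds_not_liso X Y (f : Y -> X) y : folds_at f y -> ~ liso_at f y.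
Proof.
move=> fy [U [g [Uy [[oU _ gf _ _] _ _]]]].
have nU : nbhs y U by exact: open_nbhs_nbhs.
have [u [u' [Uu Uu' uu' fu]]] := fold_pairs fy nU.
by apply: uu'; rewrite -(gf u)// -(gf u')// fu.
Qed.

(** In a commuting square with local isomorphisms [h] and [q], the fold charts of [p] are pulled
    back along them. It serves for the projection of the fibre product onto the orienting double. *)
Lemma folds_transport X Y Z (T : klein_surface R) (p : Y -> X) (q : Z -> X)
    (h : T -> Y) (f : T -> Z) t :
  folds_at p (h t) -> liso_at h t -> liso_at q (f t) -> {for t, continuous f} ->
  (\forall t' \near t, q (f t') = p (h t')) -> folds_at f t.
Proof.
move=> [c [d [hc hd [cy c0] pcd dp]]] ht [V [q' [Vt qV]]] cf qf.
have oV : open V by case: qV => -[].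
have nV : \forall t' \near t, V (f t') by apply: cf; exact: open_nbhs_nbhs.
have [U [h' [Ut UW hU]]] := liso_at_within ht (filterI qf nV).
exists (pull_chart (let: And3 h _ _ := hU in h) c).
exists (pull_chart (let: And3 h _ _ := qV in h) d).
split.
- by case: hc => ? ?; split; [exact: pull_chart_into|exact: pull_compatible].
- by case: hd => ? ?; split; [exact: pull_chart_into|exact: pull_compatible].
- by [].
- move=> _ [u [Uu cu] <-]; have [qfu Vu] := UW u Uu.
  by split=> //=; rewrite qfu; apply: pcd; exists (h u).
- by move=> u [Uu cu] /=; have [-> _] := UW u Uu; exact: dp.
Qed.

End LocalIso.

(** * Changing coordinates by plane maps: Schwarz reflection and reversal of a chart *)

Section Schwarz.
Context {R : realType}.
Local Notation C := (Cplx R).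
Implicit Types X Y Z : klein_surface R.

Section PostChart.
Context (T : topologicalType) (c : chart R T) (V : set T) (phi psi : C -> C).
Hypotheses (oV : open V) (Vc : V `<=` cdom c).
Hypothesis psiK : forall x, V x -> psi (phi (c x)) = c x.
Hypothesis cphi : forall x, V x -> {for c x, continuous phi}.
Hypothesis cpsi : forall x, V x -> {for phi (c x), continuous psi}.

Fact postK x : V x -> (cinv c \o psi) ((phi \o c) x) = x.
Proof. by move=> Vx; rewrite /= psiK// cmapK//; exact: Vc. Qed.

Fact post_cts : {within V, continuous (phi \o c)}.
Proof.
apply/within_continuousP => x Vx P nP.
have : \forall y \near x, P (phi (c y)).
  apply: (near_cmap (P := fun z => P (phi z)) (Vc Vx)).
  exact: (near_continuous (cphi Vx) nP).
exact: filterS.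
Qed.

Fact post_inv_cts : {within (phi \o c) @` V, continuous (cinv c \o psi)}.
Proof.
apply/within_continuousP => _ [x Vx <-] P; rewrite postK// => nP.
have := near_cinv (Vc Vx) nP; rewrite -{1}(psiK Vx).
move=> /(near_continuous (cpsi Vx)); apply: filterS => z nz [y Vy yz].
by apply: nz; rewrite -yz /= psiK//; exact: cimage_cmap (Vc Vy).
Qed.

(** Used with [phi] a reflected change of charts, which adapts fold charts, and with
    [phi := negconj], which reverses a chart. *)
Definition post_chart : chart R T := Chart oV postK post_cts post_inv_cts.

Lemma post_sign_to s x : V x -> dianalytic_at s (c @` V) phi (c x) ->
  chart_sign s c post_chart id x.
Proof.
move=> Vx; apply: dianalytic_atW; near=> z => -[y [cy Vy] <-].
by split; [exists y|rewrite /= cmapK].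
Unshelve. all: by end_near. Qed.

Lemma post_sign_from s x : V x ->
  dianalytic_at s (phi @` (c @` V)) psi (phi (c x)) -> chart_sign s post_chart c id x.
Proof.
move=> Vx; apply: dianalytic_atW; near=> z => -[y [Vy cy] <-].
by split; [exists (c y) => //; exists y|rewrite /= psiK// cmapK].
Unshelve. all: by end_near. Qed.

End PostChart.

Lemma post_compatible X (c : chart R X) V phi psi (oV : open V)
    (Vc : V `<=` cdom c) psiK cphi cpsi : compatible_chart c ->
  (forall x, V x -> exists s, dianalytic_at s (c @` V) phi (c x)) ->
  (forall x, V x -> exists s, dianalytic_at s (phi @` (c @` V)) psi (phi (c x))) ->
  compatible_chart (@post_chart _ c V phi psi oV Vc psiK cphi cpsi).
Proof.
move=> cc dphi dpsi; apply/compatible_chartP => x Vx; exists c; split=> //.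
- exact: (Vc x Vx).
- by have [s sx] := dpsi x Vx; exists s; exact: post_sign_from.
- by have [s sx] := dphi x Vx; exists s; exact: post_sign_to.
Qed.

(** The reflections cancel only if [schwarz f] preserves the half-plane in which a point lies; hence
    the requirement that [f] sends no non-real point to the axis. *)
Lemma schwarz_cancel (A : set C) (f g : C -> C) :
  (forall w, A w -> [/\ 0 <= complex.Im (f w),
    complex.Im (f w) = 0 -> complex.Im w = 0 & g (f w) = w]) ->
  forall z, A (fold z) -> schwarz g (schwarz f z) = z.
Proof.
move=> Af z Az; have [f0 f1 gf] := Af _ Az.
rewrite {1}/schwarz fold_schwarz// gf -[RHS](conjnK (complex.Im z < 0)) -foldE.
congr conjn; rewrite /schwarz; case: (ltP (complex.Im z) 0) => z0 /=.
  rewrite Im_conjc oppr_lt0 lt_neqAle f0 andbT; apply/eqP => /esym/f1.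
  by case: z z0 {Az f0 f1 gf} => a b /= b0 /eqP; rewrite normr_eq0 (lt_eqF b0).
by rewrite ltNge f0.
Qed.

Lemma relatively_open_transition X (c d : chart R X) M : chart_into M c ->
  relatively_open_in M (c @` (cdom c `&` id @^-1` cdom d)).
Proof.
move=> hc; have := pull_chart_into (local_homeo_id (@cdom_open _ _ d)) hc.
suff -> : c @` (cdom c `&` id @^-1` cdom d) =
  cimage (pull_chart (local_homeo_id (@cdom_open _ _ d)) c) by [].
by apply/seteqP; split=> _ [x [? ?] <-]; exists x.
Qed.

Lemma fold_chart_continuous X Y (f : Y -> X) (c : chart R Y) (d : chart R X) y :
  cdom c y -> f @` cdom c `<=` cdom d ->
  (forall y', cdom c y' -> d (f y') = fold (c y')) -> {for y, continuous f}.
Proof.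
move=> cy fcd df P nP.
have dy : cdom d (f y) by apply: fcd; exists y.
have := near_cinv dy nP; rewrite df// => /(near_continuous (@fold_continuous _ (c y))).
move=> /(near_cmap cy) n1; apply: filterS (filterI n1 (near_cdom cy)) => u [+ cu].
have du : cdom d (f u) by apply: fcd; exists u.
by rewrite -df// cmapK//; apply; exact: cimage_cmap.
Qed.

(* The fold chart upstairs may be adapted to any chart [e] downstairs: the
   change of charts downstairs extends across the real axis by Schwarz
   reflection. *)
Lemma folds_at_chart X Y (f : Y -> X) y (e : chart R X) :
  folds_at f y -> dianalytic_chart e -> cdom e (f y) ->
  exists c : chart R Y, [/\ plane_chart c, cdom c y /\ complex.Im (c y) = 0,
    f @` cdom c `<=` cdom e & forall y', cdom c y' -> e (f y') = fold (c y')].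
Proof.
move=> fy he ey; have byd := folds_boundary fy.
have [c [d [[pc cc] hd [cy c0] fcd df]]] := fy.
(* Inverse changes of charts downstairs. By invariance of the boundary they match real points with
   real points, as both the reflection and its cancellation require. The new chart upstairs is
   [schwarz tau \o c]. *)
pose tau z := e (cinv d z); pose sig z := d (cinv e z).
pose A := d @` (cdom d `&` id @^-1` cdom e).
pose B := e @` (cdom e `&` id @^-1` cdom d).
have oA : relatively_open_in (upper_half_plane R) A.
  by apply: relatively_open_transition; case: hd.
have oB : relatively_open_in (upper_half_plane R) B.
  by apply: relatively_open_transition; case: he.
have tauA w : A w -> [/\ 0 <= complex.Im (tau w),
    complex.Im (tau w) = 0 <-> complex.Im w = 0, sig (tau w) = w & B (tau w)].
  move=> [x [dx ex] <-]; rewrite /tau /sig !cmapK//; split=> //.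
  - exact: dianalytic_chart_Im.
  - by rewrite -(boundaryP hd dx) (boundaryP he ex).
  - by exists x.
have sigB w : B w -> [/\ 0 <= complex.Im (sig w),
    complex.Im (sig w) = 0 <-> complex.Im w = 0, tau (sig w) = w & A (sig w)].
  move=> [x [ex dx] <-]; rewrite /tau /sig !cmapK//; split=> //.
  - exact: dianalytic_chart_Im.
  - by rewrite -(boundaryP hd dx) (boundaryP he ex).
  - by exists x.
pose V := cdom c `&` f @^-1` cdom e.
have oV : open V.
  rewrite openE => u [cu eu]; apply: filterI; first exact: near_cdom.
  exact: (fold_chart_continuous cu fcd df (near_cdom eu)).
have Vc : V `<=` cdom c by move=> u [].
have AV u : V u -> A (fold (c u)).
  by move=> [cu eu]; exists (f u); [split=> //; apply: fcd; exists u|exact: df].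
have phiB u : V u -> B (fold (schwarz tau (c u))).
  by move=> /AV/tauA[t0 _ _ Bt]; rewrite fold_schwarz.
have dphi u : V u -> exists s, dianalytic_at s (@fold R @^-1` A) (schwarz tau) (c u).
  move=> Vu; have [cu eu] := Vu; have du : cdom d (f u) by apply: fcd; exists u.
  have [s ds] := compatible_sign (proj2 hd) (proj2 he) du eu.
  exists s; apply: dianalytic_schwarz oA _ (AV u Vu) _.
    by move=> w /tauA[_ tw _ _] /tw.
  by rewrite -df//; exact: ds.
have dpsi u : V u -> exists s,
    dianalytic_at s (@fold R @^-1` B) (schwarz sig) (schwarz tau (c u)).
  move=> Vu; have [cu eu] := Vu; have du : cdom d (f u) by apply: fcd; exists u.
  have [s ds] := compatible_sign (proj2 he) (proj2 hd) eu du.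
  exists s; apply: dianalytic_schwarz oB _ (phiB u Vu) _.
    by move=> w /sigB[_ tw _ _] /tw.
  have [t0 _ _ _] := tauA _ (AV u Vu).
  have -> : fold (schwarz tau (c u)) = e (f u).
    by rewrite fold_schwarz// -(df u cu) /tau (cmapK du).
  exact: ds.
have psiK u : V u -> schwarz sig (schwarz tau (c u)) = c u.
  move=> /AV; apply: (schwarz_cancel (A := A)) => w /tauA[t0 t1 t2 _].
  by split=> // /t1.
have cphi u : V u -> {for c u, continuous (schwarz tau)}.
  move=> Vu; have [s ds] := dphi u Vu.
  by apply: dianalytic_continuous ds; exact: relatively_open_near oA (AV u Vu).
have cpsi u : V u -> {for schwarz tau (c u), continuous (schwarz sig)}.
  move=> Vu; have [s ds] := dpsi u Vu.
  by apply: dianalytic_continuous ds; exact: relatively_open_near oB (phiB u Vu).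
exists (post_chart oV Vc psiK cphi cpsi); split.
- split; last first.
    apply: post_compatible => // u Vu.
      have [s ds] := dphi u Vu; exists s; apply: dianalytic_atW ds.
      by near=> z => -[u' Vu' <-]; split=> //; exact: AV.
    have [s ds] := dpsi u Vu; exists s; apply: dianalytic_atW ds.
    by near=> z => -[_ [u' Vu' <-] <-]; split=> //; exact: phiB.
  exists (schwarz tau @` (c @` V)); last by rewrite setTI image_comp.
  rewrite openE => _ [_ [u Vu <-] <-].
  have nT : nbhs (c u) [set: C] by exact: filterT.
  have nV : nbhs u V by exact: open_nbhs_nbhs.
  have := near_cimage pc (Vc u Vu) nT nV; rewrite -{1}(psiK u Vu).
  move=> /(near_continuous (cpsi u Vu)) n1.
  have n2 := relatively_open_near oB (phiB u Vu).
  apply: filterS (filterI n1 n2) => z [[[v cv vz] Vz] Bz].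
  exists (schwarz sig z).
    by exists v => //; rewrite -vz cmapK// in Vz.
  apply: (schwarz_cancel (A := B)) Bz => w /sigB[s0 s1 s2 _].
  by split=> // /s1.
- have Vy : V y by [].
  split=> //=; have [t0 t1 _ _] := tauA _ (AV y Vy).
  rewrite /schwarz c0 ltxx; apply/t1.
  by case: (c y) c0 => a b /= ->; rewrite normr0.
- by move=> _ [u [cu eu] <-].
- move=> u Vu /=; have [t0 _ _ _] := tauA _ (AV u Vu); have [cu eu] := Vu.
  have du : cdom d (f u) by apply: fcd; exists u.
  by rewrite fold_schwarz// -(df u cu) /tau (cmapK du).
Unshelve. all: by end_near. Qed.

(** Reflection in the imaginary axis: antianalytic, yet preserving the half-plane, so it reverses
    the orientation of a dianalytic chart and leaves it dianalytic. *)
Definition negconj (z : C) : C := - conjc z.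

Lemma negconjK : involutive negconj.
Proof. by case=> a b; apply/eqP; rewrite eq_complex /= !opprK !eqxx. Qed.

Lemma opp_negconj z : - z = conjn true (negconj z).
Proof. by case: z => a b; apply/eqP; rewrite eq_complex /= !opprK !eqxx. Qed.

Lemma Im_negconj z : complex.Im (negconj z) = complex.Im z.
Proof. by case: z => a b; rewrite /negconj /= opprK. Qed.

Lemma negconj_continuous (z : C) : {for z, continuous negconj}.
Proof.
apply: cplx_continuousP => e e0; apply: filterS (near_dist z e0) => w.
have -> : negconj z - negconj w = - conjc (z - w).
  by case: z w => a b [a' b']; apply/eqP; rewrite eq_complex /= !opprB !opprK !(addrC (- _)) !eqxx.
by rewrite normrN normcJ.
Qed.

Section Reflection.
Context (T : topologicalType) (c : chart R T).

Definition refl_chart : chart R T :=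
  post_chart (@cdom_open _ _ c) (@subset_refl _ (cdom c)) (fun x _ => negconjK (c x))
    (fun x _ => @negconj_continuous (c x))
    (fun x _ => @negconj_continuous (negconj (c x))).

Lemma dianalytic_at_refl A z : dianalytic_at true A negconj z.
Proof.
exists (fun z => - z); near=> w; split; first exact/derivableN/derivable_id.
by move=> _; exact: opp_negconj w.
Unshelve. all: by end_near. Qed.

Lemma refl_sign x : cdom c x -> chart_sign true c refl_chart id x.
Proof. by move=> cx; apply: post_sign_to => //; exact: dianalytic_at_refl. Qed.

Lemma refl_chart_into :
  chart_into (upper_half_plane R) c -> chart_into (upper_half_plane R) refl_chart.
Proof.
move=> [V oV cV]; exists (negconj @^-1` V).
  exact: (open_comp (fun z _ => @negconj_continuous z)).
apply/seteqP; split=> [_ [x cx <-] /=|z [z0 Vz]].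
  have := @cimage_cmap _ _ c x cx; rewrite cV => -[c0 Vx].
  by split; rewrite /= ?negconjK// /upper_half_plane /= Im_negconj.
have : cimage c (negconj z).
  by rewrite cV; split=> //; rewrite /upper_half_plane /= Im_negconj.
by move=> [x cx xz]; exists x; rewrite //= xz negconjK.
Qed.

End Reflection.

Lemma refl_dianalytic X (c : chart R X) :
  dianalytic_chart c -> dianalytic_chart (refl_chart c).
Proof.
move=> [hc cc]; split; first exact: refl_chart_into.
by apply: post_compatible => // x cx; exists true; exact: dianalytic_at_refl.
Qed.

End Schwarz.

(** * Deck involutions of double maps *)

Section Deck.
Context {R : realType}.
Local Notation C := (Cplx R).
Implicit Types X Y Z : klein_surface R.

Lemma connected_open_cover (T : topologicalType) (A B : set T) :
  connected [set: T] -> open A -> open B -> A `|` B = setT -> A `&` B = set0 ->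
  A !=set0 -> A = setT.
Proof.
move=> cT oA oB AB AB0 A0.
apply: cT A0 _ _; first by exists A; rewrite ?setTI.
exists (~` B); first exact: open_closedC.
rewrite setTI; apply/seteqP; split=> x.
  by move=> Ax Bx; have : (A `&` B) x by []; rewrite AB0.
by move=> nBx; have [] : (A `|` B) x by rewrite AB.
Qed.

(* At a fold the predicate is empty, and [xget] returns its default [y]. *)
Definition deck X Y (p : Y -> X) (y : Y) : Y :=
  xget y [set y' | y' <> y /\ p y' = p y].

Section DoubleMap.
Context X Y (p : Y -> X).
Hypothesis dp : double_map p.

Lemma double_surjective x : exists y, p y = x.
Proof.
case: dp => _ /(_ x)[[y [y' [_ E _ _]]]|[y [E _]]]; exists y.
  by have : (p @^-1` [set x]) y by rewrite E; left.
by have : (p @^-1` [set x]) y by rewrite E.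
Qed.

Lemma double_cases y :
  (unbranched_at p y /\ exists y', [/\ y' <> y, unbranched_at p y',
     p y' = p y & forall u, p u = p y -> u = y \/ u = y']) \/
  (folds_at p y /\ forall u, p u = p y -> u = y).
Proof.
case: dp => _ /(_ (p y))[[y1 [y2 [y12 E u1 u2]]]|[y1 [E fy]]].
  left; have py1 : p y1 = p y by have : (p @^-1` [set p y]) y1 by rewrite E; left.
  have py2 : p y2 = p y by have : (p @^-1` [set p y]) y2 by rewrite E; right.
  have inE u : p u = p y -> u = y1 \/ u = y2.
    by move=> pu; have : (p @^-1` [set p y]) u by []; rewrite E.
  have [yE|yE] := inE y erefl; rewrite yE.
    split=> //; exists y2; split=> //; first by move/esym.
      by rewrite py1 py2.
    by move=> u; rewrite py1; exact: inE.
  split=> //; exists y1; split=> //; first by rewrite py1 py2.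
  by move=> u; rewrite py2 => /inE[]; [right|left].
have inE u : p u = p y -> u = y1.
  by move=> pu; have : (p @^-1` [set p y]) u by []; rewrite E.
right; rewrite (inE y erefl); split=> // u; rewrite -(inE y erefl).
by move/inE ->; rewrite (inE y erefl).
Qed.

Lemma deck_unbranched y : unbranched_at p y ->
  [/\ deck p y <> y, p (deck p y) = p y & unbranched_at p (deck p y)].
Proof.
move=> uy; have [[_ [y' [y'y uy' py' E]]]|[fy _]] := double_cases y; last first.
  by case: (folds_not_liso fy (unbranched_liso uy)).
have [dy pd] : [set y' | y' <> y /\ p y' = p y] (deck p y).
  by apply: xgetPex; exists y'.
split=> //; have [|->//] := E _ pd.
by move/dy.
Qed.

Lemma deck_folds y : folds_at p y -> deck p y = y.
Proof.
move=> fy; have [[uy _]|[_ E]] := double_cases y.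
  by case: (folds_not_liso fy (unbranched_liso uy)).
by apply: xgetPN => y' [] /[swap] /E.
Qed.

Lemma deck_proj y : p (deck p y) = p y.
Proof.
have [[/deck_unbranched[]//]|[/deck_folds -> //]] := double_cases y.
Qed.

Lemma deck_fibre y u : p u = p y -> u = y \/ u = deck p y.
Proof.
move=> puy; have [[uy [y' [_ _ _ E]]]|[fy E]] := double_cases y; last by left; exact: E.
have [dy pd _] := deck_unbranched uy.
by have [//|->] := E u puy; [left|right; have [/dy|] := E _ pd].
Qed.

Lemma deckK : involutive (deck p).
Proof.
move=> y; have [[uy _]|[fy _]] := double_cases y; last by rewrite !(deck_folds fy).
have [dy pd ud] := deck_unbranched uy.
have [ddy _ _] := deck_unbranched ud.
by have [E|<-//] := @deck_fibre (deck p y) y (esym pd); case: dy.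
Qed.

(** Near [y], [f u] is [u] or [deck p u]. Disjoint neighbourhoods of [y] and [deck p y] exclude the
    first value. *)
Lemma deck_near y (f : Y -> Y) : f y = deck p y -> {for y, continuous f} ->
  unbranched_at p y -> (\forall u \near y, p (f u) = p u) ->
  \forall u \near y, f u = deck p u.
Proof.
move=> fy cf uy pf; have [/eqP dy _ _] := deck_unbranched uy.
have := @klein_hausdorff _ Y; rewrite open_hausdorff => /(_ _ _ dy).
move=> [[V W] [/set_mem Vd /set_mem Wy] [oV oW VW]].
have nV : \forall u \near y, V (f u).
  by apply: cf; apply: open_nbhs_nbhs; rewrite fy.
have nW : \forall u \near y, W u by apply: open_nbhs_nbhs.
apply: filterS (filterI pf (filterI nV nW)) => u [pu [Vu Wu]].
have [fu|//] := deck_fibre pu.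
have : (V `&` W) u by split=> //; rewrite -fu.
by rewrite (eqP VW).
Qed.

(** Near [y] the deck involution is [g \o p], where [g] is the local inverse of [p] at the other
    point of the fibre. *)
Lemma deck_dian_unbranched y : unbranched_at p y -> dian (deck p) y.
Proof.
move=> uy; have [_ pd ud] := deck_unbranched uy.
have [U [g [Ud pU]]] := unbranched_liso ud.
have lg : liso_at g (p y).
  by exists (p @` U), p; split; [exists (deck p y)|exact: liso_inv].
have lgp : liso_at (g \o p) y by apply: liso_at_comp => //; exact: unbranched_liso.
apply: dian_near (liso_at_dian lgp); apply: deck_near uy _.
- by rewrite /= -pd; case: pU => -[_ _ ->].
- exact: liso_at_continuous lgp.
have cp : {for y, continuous p} by case: dp => -[+ _] _ => /(_ y).
have nU : \forall u \near y, (p @` U) (p u).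
  apply: cp; apply: open_nbhs_nbhs; split; first by case: pU => -[].
  by exists (deck p y).
by apply: filterS nU => u [v Uv vu] /=; case: pU => -[_ _ gf _ _] _ _; rewrite -vu gf.
Qed.

(** Conjugate points lie in one fibre. If they differ, they form the whole fibre; if they coincide,
    the point is itself a fold, fixed by [deck p]. *)
Lemma deck_folds_local y (c : chart R Y) (d : chart R X) :
  plane_chart c -> dianalytic_chart d -> cdom c y -> complex.Im (c y) = 0 ->
  p @` cdom c `<=` cdom d -> (forall y', cdom c y' -> d (p y') = fold (c y')) ->
  \forall z \near c y, cimage c (conjc z) /\
    (cimage c z -> deck p (cinv c z) = cinv c (conjc z)).
Proof.
move=> pc hd cy c0 pcd df.
have nT : nbhs y [set: Y] by exact: filterT.
apply: filterS (fold_local pc cy c0 pcd df nT) => z [cz cz' _ _ pz].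
split=> // _; have [zR|zN] := eqVneq (complex.Im z) 0.
  rewrite conjc_Im0//; apply: deck_folds; case: cz => u cu uz.
  exists c, d; split=> //; rewrite -uz cmapK//.
  by split=> //; rewrite uz.
have [zz|//] := deck_fibre (esym pz).
case/negP: zN; apply/eqP/conjc_eqP.
case: cz cz' zz => u cu <- [v cv <-]; rewrite !cmapK// => ->.
by [].
Qed.

Lemma deck_folds_dian y (c : chart R Y) (d : chart R X) :
  plane_chart c -> dianalytic_chart d -> cdom c y -> complex.Im (c y) = 0 ->
  p @` cdom c `<=` cdom d -> (forall y', cdom c y' -> d (p y') = fold (c y')) ->
  dian (deck p) y /\ chart_sign true c c (deck p) y.
Proof.
move=> pc hd cy c0 pcd df; have n1 := deck_folds_local pc hd cy c0 pcd df.
have dy : deck p y = y by apply: deck_folds; exists c, d.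
have cd : {for y, continuous (deck p)}.
  move=> P; rewrite dy => nP.
  have := near_cinv cy nP; rewrite -{1}(conjc_Im0 c0).
  move=> /(near_continuous (@conjc_continuous _ (c y))) n2.
  have n3 : \forall z \near c y, (cimage c (conjc z) /\
      (cimage c z -> deck p (cinv c z) = cinv c (conjc z))) /\
      (cimage c (conjc z) -> P (cinv c (conjc z))).
    exact: filterI n1 n2.
  have n4 := near_cmap cy n3.
  apply: filterS (filterI n4 (near_cdom cy)) => u [[[cu +] +] uc].
  by rewrite (cmapK uc) => /(_ (cimage_cmap uc)) du /(_ cu); rewrite -du.
have s1 : chart_sign true c c (deck p) y.
  apply: dianalytic_atW (dianalytic_at_conjn true (c y) setT).
  apply: filterS n1 => z [[v cv vz] +] [u [cu _] uz].
  by rewrite -uz => /(_ (cimage_cmap cu)) ->; split=> //=; rewrite uz -vz cmapK.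
split=> //; split=> //; exists c, c; split; rewrite ?dy//; try by case: pc.
by exists true.
Qed.

Lemma deck_dian y : dian (deck p) y.
Proof.
have [[uy _]|[[c [d [pc hd [cy c0] pcd df]]] _]] := double_cases y.
  exact: deck_dian_unbranched.
by have [] := deck_folds_dian pc hd cy c0 pcd df.
Qed.

Lemma deck_continuous : continuous (deck p).
Proof. by move=> y; case: (deck_dian y). Qed.

Lemma involution_liso (h : Y -> Y) : involutive h -> (forall y, dian h y) ->
  liso h setT h.
Proof.
move=> hK dh; have hT : h @` setT = setT.
  by apply/seteqP; split=> // y _; exists (h y).
have oT := @openT Y.
split=> //; split; rewrite ?hT//; by move=> y _; case: (dh y).
Qed.

End DoubleMap.

(** * Signs relative to coherent families of charts *)

Section RelativeSign.

(** An orientation without the covering condition. A single compatible chart is coherent, so signs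
    can be taken relative to one chart of a non-orientable surface. *)
Definition coherent X (Q : set (chart R X)) :=
  (forall c, Q c -> compatible_chart c) /\
  forall c d, Q c -> Q d -> in_charts analytic_on c d id.

Lemma coherent_sign X (Q : set (chart R X)) c d x : coherent Q -> Q c -> Q d ->
  cdom c x -> cdom d x -> chart_sign false c d id x.
Proof. by move=> [_ Qan] Qc Qd cx dx; apply: (Qan _ _ Qc Qd); exists x. Qed.

Lemma orientation_coherent X (Q : set (chart R X)) : orientation Q -> coherent Q.
Proof. by move=> [Qc _ Qan]; split=> // c /Qc[]. Qed.

Lemma coherent1 X (c : chart R X) : compatible_chart c -> coherent [set c].
Proof.
move=> cc; split=> [_ -> //|_ _ -> ->] _ [x [cx _] <-].
exact: chart_sign_id.
Qed.

(** Existential in the charts; by [rsign_chart] the choice inside coherent families is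
    immaterial. *)
Definition rsign X Y (P : set (chart R X)) (Q : set (chart R Y)) s (f : X -> Y) x :=
  exists c d, [/\ P c, Q d, cdom c x, cdom d (f x) & chart_sign s c d f x].

Context X Y (P : set (chart R X)) (Q : set (chart R Y)).
Hypotheses (hP : coherent P) (hQ : coherent Q).

Lemma rsign_chart s (f : X -> Y) x c d : {for x, continuous f} ->
  rsign P Q s f x -> P c -> Q d -> cdom c x -> cdom d (f x) -> chart_sign s c d f x.
Proof.
move=> cf [c' [d' [Pc' Qd' cx' dx' fs]]] Pc Qd cx dx.
have cc' := coherent_sign hP Pc Pc' cx cx'.
have dd' := coherent_sign hQ Qd' Qd dx' dx.
have := chart_sign_compl cx cx' dx' cc' fs.
by move=> /(chart_sign_compr cx dx' dx cf)/(_ dd'); rewrite addbF.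
Qed.

Lemma rsign_exists (f : X -> Y) x c d : dian f x -> P c -> Q d -> cdom c x ->
  cdom d (f x) -> exists s, rsign P Q s f x.
Proof.
move=> df Pc Qd cx dx.
have [s fs] := dian_sign df (hP.1 _ Pc) (hQ.1 _ Qd) cx dx.
by exists s, c, d.
Qed.

Lemma rsign_near s (f g : X -> Y) x : (\forall y \near x, f y = g y) ->
  rsign P Q s f x -> rsign P Q s g x.
Proof.
move=> fg [c [d [Pc Qd cx dx fs]]]; exists c, d; split=> //.
  by rewrite -(nbhs_singleton fg).
exact: chart_sign_near fg fs.
Qed.

Lemma rsign_open s (f : X -> Y) x : {for x, continuous f} -> rsign P Q s f x ->
  \forall y \near x, rsign P Q s f y.
Proof.
move=> cf [c [d [Pc Qd cx dx fs]]].
have nd : \forall y \near x, cdom d (f y) by exact: cf (near_cdom dx).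
apply: filterS (filterI (chart_sign_open cx fs) (filterI nd (near_cdom cx))).
by move=> y [fy [dy cy]]; exists c, d; exact: And5 Pc Qd cy dy (fy cy).
Qed.

Lemma rsign_uniq s t (f : X -> Y) x : liso_at f x ->
  rsign P Q s f x -> rsign P Q t f x -> s = t.
Proof.
move=> lf [c [d [Pc Qd cx dx fs]]] ft.
have cf := liso_at_continuous lf.
have {}ft := rsign_chart cf ft Pc Qd cx dx.
have [U [g [Ux [[oU ofU gf cf' cg] df dg]]]] := lf.
apply: (dian_sign_uniq cf _ _ (hP.1 _ Pc) (hQ.1 _ Qd) cx dx fs ft).
  by apply: dg; exists x.
have nU : \forall y \near x, U y by exact: open_nbhs_nbhs.
exact: filterS nU.
Qed.

End RelativeSign.

Lemma rsign_comp X Y Z (P : set (chart R X)) (Q : set (chart R Y))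
    (S : set (chart R Z)) s t (f : X -> Y) (g : Y -> Z) x :
  coherent Q -> {for x, continuous f} -> {for f x, continuous g} ->
  rsign P Q s f x -> rsign Q S t g (f x) -> rsign P S (s (+) t) (g \o f) x.
Proof.
move=> hQ cf cg [c [d [Pc Qd cx dx fs]]] [d' [e [Qd' Se dx' ex gt]]].
exists c, e; split=> //.
have gd := chart_sign_compl dx dx' ex (coherent_sign hQ Qd Qd' dx dx') gt.
exact: (chart_sign_comp cx dx cf fs gd ex).
Qed.

Lemma orientation_cover X (P : set (chart R X)) x : orientation P ->
  exists2 c, P c & cdom c x.
Proof. by case=> _ /(_ x). Qed.

(** The sign is locally constant and unique, so the loci of the two signs are disjoint open sets
    covering a connected surface. *)
Lemma involution_rsign X (P : set (chart R X)) (h : X -> X) s x0 :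
  orientation P -> involutive h -> (forall x, dian h x) ->
  rsign P P s h x0 -> forall x, rsign P P s h x.
Proof.
move=> oP hK dh hs; have hP := orientation_coherent oP.
have lh x : liso_at h x by exists setT, h; split=> //; exact: involution_liso.
have ch x : {for x, continuous h} by case: (dh x).
have oA t : open [set x | rsign P P t h x].
  by rewrite openE => x hx; exact: rsign_open (ch x) hx.
suff : [set x | rsign P P s h x] = setT.
  by move=> E x; have : [set x | rsign P P s h x] x by rewrite E.
apply: (connected_open_cover (B := [set x | rsign P P (~~ s) h x])) => //.
- exact: klein_connected.
- apply/seteqP; split=> // x _.
  have [c Pc cx] := orientation_cover x oP.
  have [d Pd dx] := orientation_cover (h x) oP.
  have [t ht] := rsign_exists hP hP (dh x) Pc Pd cx dx.
  have [<-|st] := eqVneq t s; first by left.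
  have ts : t = ~~ s by move: st; clear; case: t; case: s.
  by right; rewrite /= -ts; exact: ht.
- apply/seteqP; split=> // x [h1 h2].
  by have := rsign_uniq hP hP (lh x) h1 h2; case: (s).
- by exists x0.
Qed.

Lemma double_folds_boundary X Y (p : Y -> X) y : double_map p ->
  boundary Y = set0 -> folds_at p y <-> boundary X (p y).
Proof.
move=> dp bY; split; first exact: folds_boundary.
move=> bX; have [[uy _]|[]//] := double_cases dp y.
by move/(unbranched_boundary uy): bX; rewrite bY.
Qed.

(* Near a fold the deck involution is complex conjugation. *)
Lemma deck_anticonformal X Y (p : Y -> X) (P : set (chart R Y)) :
  double_map p -> orientation P -> (exists y, folds_at p y) ->
  forall y, rsign P P true (deck p) y.
Proof.
move=> dp oP [y fy]; have hP := orientation_coherent oP.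
apply: (involution_rsign (x0 := y) oP (deckK dp) (deck_dian dp)).
have [c [d [pc hd [cy c0] pcd df]]] := fy.
have [ddy dcs] := deck_folds_dian dp pc hd cy c0 pcd df.
have [e Pe ey] := orientation_cover y oP.
have ce : compatible_chart e := hP.1 _ Pe; have [_ cc] := pc.
have dy := deck_folds dp fy.
have [s es] := compatible_sign ce cc ey cy.
have [t ct] := compatible_sign cc ce cy ey.
(* The fold chart [c] need not belong to [P], but the signs of passing from [e] to [c] and back
   cancel, leaving that of conjugation. *)
have st : s (+) t = false.
  apply: (sign_uniq ey ce _ (chart_sign_id _ _)).
  exact: (chart_sign_compl ey cy ey es ct).
exists e, e; split; rewrite ?dy//.
have cdy : cdom c (deck p y) by rewrite dy.
have edy : cdom e (deck p y) by rewrite dy.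
have -> : true = s (+) true (+) t by move: st; case: (s) (t) => [] [].
apply: (chart_sign_compr ey cdy edy (deck_continuous dp (x := y))).
  exact: (chart_sign_compl ey cy cdy es dcs).
by rewrite dy.
Qed.

(* If the deck involution preserved the orientation upstairs, the orientation
   would descend. *)
Lemma deck_reverses X Y (p : Y -> X) (P : set (chart R Y)) :
  double_map p -> (forall y, unbranched_at p y) -> orientation P ->
  ~ orientable X -> forall y, rsign P P true (deck p) y.
Proof.
move=> dp up oP nX; have hP := orientation_coherent oP.
have [y0 _] := @klein_nonempty _ Y.
have [c0 Pc0 cy0] := orientation_cover y0 oP.
have [d0 Pd0 dy0] := orientation_cover (deck p y0) oP.
have [[] hs] := rsign_exists hP hP (deck_dian dp y0) Pc0 Pd0 cy0 dy0.
  exact: (involution_rsign oP (deckK dp) (deck_dian dp) hs).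
have dks := involution_rsign oP (deckK dp) (deck_dian dp) hs.
case: nX.
(* The descended orientation: the charts of [X] in which [p] is conformal at every preimage. *)
pose Q := [set e | dianalytic_chart e /\ forall y, cdom e (p y) ->
  rsign P [set e] false p y].
have lp y : liso_at p y := unbranched_liso (up y).
have cp y : {for y, continuous p} := liso_at_continuous (lp y).
exists Q; split=> [e []//|x|e e' [he He] [he' He'] _ [x [ex ex'] <-]]; last first.
  have [y yx] := double_surjective dp x; rewrite -yx in ex ex' *.
  have /= ce' := coherent1 (proj2 he'); have /= ce := coherent1 (proj2 he).
  have [c Pc cy] := orientation_cover y oP.
  have es := rsign_chart hP ce (cp y) (He y ex) Pc erefl cy ex.
  have es' := rsign_chart hP ce' (cp y) (He' y ex') Pc erefl cy ex'.
  have [s ee'] := compatible_sign (proj2 he) (proj2 he') ex ex'.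
  suff s0 : s = false by rewrite s0 in ee'.
  apply: (rsign_uniq (f := p) hP ce' (lp y)); last first.
    by exists c, e'; split=> //; exact: es'.
  by exists c, e'; split=> //; exact: (chart_sign_compr cy ex ex' (cp y) es ee').
have [y yx] := double_surjective dp x.
have [c Pc cy] := orientation_cover y oP.
have [e [he ex es]] : exists e, [/\ dianalytic_chart e, cdom e x &
    chart_sign false c e p y].
  have [e ae ex] := atlas_cover x; have he := atlas_dianalytic_chart ae.
  have ey : cdom e (p y) by rewrite yx.
  have [s es] := dian_sign (liso_at_dian (lp y)) (hP.1 _ Pc) (proj2 he) cy ey.
  case: s es => es; last by exists e.
  (* If [p] has the wrong sign in [e], the reversed chart has the right one. *)
  exists (refl_chart e); split=> //; first exact: refl_dianalytic.
  have ey' : cdom (refl_chart e) (p y) := ey.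
  exact: (chart_sign_compr cy ey ey' (cp y) es (refl_sign ey)).
have ey : cdom e (p y) by rewrite yx.
have ce := coherent1 (proj2 he).
have re : rsign P [set e] false p y by exists c, e; split.
have [U [g [Uy UW pU]]] := liso_at_within (lp y) (rsign_open (cp y) re).
have opU : open (p @` U) by case: pU => -[].
exists (restr_chart e opU); last by split=> //; rewrite -yx; exists y.
split; first exact: restr_dianalytic.
move=> z [[u Uu uz] ez].
(* On a small domain the sign is known at one preimage; since [p] equals [p \o deck p] and the deck
   involution is now conformal, it is the same at the other. *)
have rz : rsign P [set e] false p z.
  have [->|->] := deck_fibre dp (esym uz); first exact: UW.
  have ru : rsign P [set e] false p u by exact: UW.
  have := @rsign_comp _ _ _ P P [set e] false false (deck p) p (deck p u) hP
    (deck_continuous dp (x := deck p u)) (cp _) (dks _).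
  rewrite (deckK dp) => /(_ ru); apply: rsign_near.
  by near=> w; rewrite /= (deck_proj dp).
have [c' Pc' cz] := orientation_cover z oP.
have zs := rsign_chart hP ce (cp z) rz Pc' erefl cz ez.
exists c', (restr_chart e opU); split=> //; first by split=> //; exists u.
apply: dianalytic_atW zs; near=> w => -[v [cv [_ ev]] <-].
by split=> //; exists v.
Unshelve. all: by end_near. Qed.

End Deck.

(** * Surfaces pulled back along a local homeomorphism *)

Section Pullback.
Context {R : realType} (T : topologicalType) (Y : klein_surface R) (h : T -> Y).
Hypotheses (T0 : [set: T] !=set0) (hT : hausdorff_space T) (kT : compact [set: T])
  (cT : connected [set: T]).
Hypothesis lh : forall t, exists U g, U t /\ local_homeo h U g.

(** A relation rather than the construction [pull_chart], so that the choice of local inverses of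
    [h] does not enter the atlas. *)
Definition lifts_chart (C : chart R T) (c : chart R Y) :=
  forall t, cdom C t -> cdom c (h t) /\ C t = c (h t).

Definition lifted_charts (P : set (chart R Y)) : set (chart R T) :=
  [set C | exists2 c, P c & lifts_chart C c].

Definition pullback_atlas : set (chart R T) :=
  [set C | chart_into (upper_half_plane R) C /\ lifted_charts (@atlas R Y) C].

Lemma lift_exists (c : chart R Y) t M : chart_into M c -> cdom c (h t) ->
  exists C, [/\ chart_into M C, lifts_chart C c & cdom C t].
Proof.
move=> hc ct; have [U [g [Ut hU]]] := lh t.
exists (pull_chart hU c); split=> //; first exact: pull_chart_into.
by move=> u [].
Qed.

Fact pullback_cover t : exists2 C, pullback_atlas C & cdom C t.
Proof.
have [c ac ct] := atlas_cover (h t).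
have [C [hC lC Ct]] := lift_exists (atlas_half_plane ac) ct.
by exists C => //; split=> //; exists c.
Qed.

Lemma lift_sign s (C D : chart R T) (c d : chart R Y) t :
  lifts_chart C c -> lifts_chart D d -> cdom C t ->
  chart_sign s c d id (h t) -> chart_sign s C D id t.
Proof.
move=> Cc Dd Ct; have [_ tE] := Cc t Ct; rewrite /chart_sign -tE; apply: dianalytic_atW.
near=> z => -[u [Cu Du] <-].
have [cu ->] := Cc u Cu; have [du _] := Dd u Du.
split; first by exists (h u).
by rewrite -(Cc u Cu).2 !cmapK// (Cc u Cu).2 cmapK//= (Dd u Du).2.
Unshelve. all: by end_near. Qed.

Fact pullback_dianalytic C D : pullback_atlas C -> pullback_atlas D ->
  in_charts dianalytic_on C D id.
Proof.
move=> [_ [c ac Cc]] [_ [d ad Dd]]; apply/in_charts_dianalyticP => t Ct Dt.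
have [ct _] := Cc t Ct; have [dt _] := Dd t Dt.
have /in_charts_dianalyticP/(_ _ ct dt)[s cd] := atlas_dianalytic ac ad.
by exists s; exact: (lift_sign Cc Dd Ct cd).
Qed.

Definition pullback_surface : klein_surface R :=
  @KleinSurface R T pullback_atlas T0 hT kT cT
    (fun C aC => aC.1) pullback_cover pullback_dianalytic.

Let h' : pullback_surface -> Y := h.

Lemma pullback_liso t : liso_at h' t.
Proof.
have [U [g [Ut hU]]] := lh t; exists U, g; split=> //; split=> //.
  move=> u Uu; have [c ac cu] := atlas_cover (h u).
  have [C [hC lC Cu]] := lift_exists (atlas_half_plane ac) cu.
  split; first by case: hU => _ _ _ ch _; exact: ch.
  exists C, c; split=> //; try exact: atlas_compatible.
    by apply: (@atlas_compatible _ pullback_surface); split=> //; exists c.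
  exists false; apply: dianalytic_atW (dianalytic_at_conjn false (C u) setT).
  by near=> z => -[v [Cv cv] <-]; split=> //=; rewrite cmapK// (lC v Cv).2.
move=> _ [u Uu <-]; have [c ac cu] := atlas_cover (h u).
have [C [hC lC Cu]] := lift_exists (atlas_half_plane ac) cu.
have gh : g (h u) = u by case: hU => _ _ ->.
split; first by case: hU => _ _ _ _ cg; apply: cg; exists u.
exists c, C; split=> //; try exact: atlas_compatible.
  - by apply: (@atlas_compatible _ pullback_surface); split=> //; exists c.
  - by rewrite gh.
exists false; apply: dianalytic_atW (dianalytic_at_conjn false (c (h u)) setT).
have nU : \forall y \near h u, (h @` U) y.
  by case: hU => oU ohU _ _ _; apply: open_nbhs_nbhs; split=> //; exists u.
apply: filterS (near_cinv cu nU) => z nz [y [cy Cy] yz]; split=> //=.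
rewrite -yz cmapK// (lC _ Cy).2; congr (c _).
have := nz; rewrite -yz => /(_ (cimage_cmap cy)); rewrite cmapK// => -[v Uv <-].
by case: hU => _ _ ->.
Unshelve. all: by end_near. Qed.

Lemma pullback_boundary : boundary Y = set0 -> boundary pullback_surface = set0.
Proof.
move=> bY; apply/seteqP; split=> // t [C [[hC [c ac Cc]] Ct C0]].
have [ct E] := Cc t Ct; have : boundary Y (h t) by exists c; rewrite -E.
by rewrite bY.
Qed.

Definition pullback_orientation (P : set (chart R Y)) : set (chart R pullback_surface) :=
  [set C | dianalytic_chart (X := pullback_surface) C /\ lifted_charts P C].

Lemma lift_compatible (C : chart R T) (c : chart R Y) : lifts_chart C c ->
  compatible_chart c -> compatible_chart (X := pullback_surface) C.
Proof.
move=> Cc cc; apply/(@compatible_chartP _ pullback_surface) => t Ct.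
have [D aD Dt] := pullback_cover t; have [_ [d ad Dd]] := aD.
have [ct _] := Cc t Ct; have [dt _] := Dd t Dt.
have [s cs] := compatible_sign cc (atlas_compatible ad) ct dt.
have [s' ds] := compatible_sign (atlas_compatible ad) cc dt ct.
exists D; split=> //; first exact: (@atlas_compatible _ pullback_surface).
  by exists s; exact: (lift_sign Cc Dd Ct cs).
by exists s'; exact: (lift_sign Dd Cc Dt ds).
Qed.

Lemma pullback_orientationP (P : set (chart R Y)) : orientation P ->
  orientation (pullback_orientation P).
Proof.
move=> oP; have hP := orientation_coherent oP.
split=> [C []//|t|C D [_ [c Pc Cc]] [_ [d Pd Dd]] _ [t [Ct Dt] <-]].
  have [c Pc ct] := orientation_cover (h t) oP.
  have hc : dianalytic_chart c by case: oP => + _ _; apply.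
  have [C [hC lC Ct]] := lift_exists hc.1 ct.
  exists C => //; split; last by exists c.
  by split=> //; exact: lift_compatible lC hc.2.
have [ct _] := Cc t Ct; have [dt _] := Dd t Dt.
exact: (lift_sign Cc Dd Ct (coherent_sign hP Pc Pd ct dt)).
Qed.

(** In lifted charts [f] reads as [f0], so its sign can be computed downstairs. *)
Lemma pullback_in_charts s (P : set (chart R Y)) (f : T -> T) (f0 : Y -> Y) :
  (forall t, h (f t) = f0 (h t)) ->
  (forall y c d, P c -> P d -> cdom c y -> cdom d (f0 y) -> chart_sign s c d f0 y) ->
  forall C D t, lifted_charts P C -> lifted_charts P D -> cdom C t -> cdom D (f t) ->
  chart_sign s C D f t.
Proof.
move=> hf f0s C D t [c Pc Cc] [d Pd Dd] Ct Dt.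
have [ct tE] := Cc t Ct; have [dt _] := Dd _ Dt; rewrite hf in dt.
have := f0s _ _ _ Pc Pd ct dt; rewrite /chart_sign -tE; apply: dianalytic_atW.
near=> z => -[u [Cu Du] <-].
have [cu uE] := Cc u Cu; have [du duE] := Dd _ Du; rewrite hf in du.
split; first by exists (h u).
by rewrite (cmapK Cu) uE (cmapK cu) duE hf.
Unshelve. all: by end_near. Qed.

End Pullback.

(** * The fibre product *)

Section FibreProduct.
Context {R : realType} (X Y Z : klein_surface R) (p : Y -> X) (q : Z -> X).
Hypotheses (dp : double_map p) (dq : double_map q).
Hypothesis uq : forall z, unbranched_at q z.
Hypothesis fp : exists y, folds_at p y.

Definition fibre_product : set (Y * Z) := [set yz | p yz.1 = q yz.2].
Local Notation T := (set_type fibre_product).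

Definition fst_proj (t : T) : Y := (\val t).1.
Definition snd_proj (t : T) : Z := (\val t).2.

Definition fibre_pair y z (e : p y = q z) : T := exist _ (y, z) (mem_set e).

Lemma fibre_productE (t : T) : p (fst_proj t) = q (snd_proj t).
Proof. exact: set_mem (valP t). Qed.

Lemma fibre_eq (t u : T) : fst_proj t = fst_proj u -> snd_proj t = snd_proj u -> t = u.
Proof.
by case: t u => -[y z] yz [[y' z'] yz'] /= ? ?; apply: val_inj; congr pair.
Qed.

Lemma nbhs_fibre (t : T) (P : set T) : nbhs t P <->
  exists A B, [/\ nbhs (fst_proj t) A, nbhs (snd_proj t) B &
    forall u, A (fst_proj u) -> B (snd_proj u) -> P u].
Proof.
split.
  move=> nP; have [_ [[V oV <-] Vt] VP] : exists2 B, open_nbhs t B & B `<=` P.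
    by move: nP; rewrite nbhsE.
  have : nbhs (\val t) V by exact: open_nbhs_nbhs.
  move=> [[A B] [nA nB] AB]; exists A, B; split=> //.
  - by move=> u Au Bu; apply: VP; apply: AB.
move=> [A [B [nA nB AB]]].
have : nbhs t (\val @^-1` (A `*` B)).
  apply: (@initial_continuous T (Y * Z)%type \val t).
  by exists (A, B).
by apply: filterS => u [Au Bu]; exact: AB.
Qed.

Lemma fst_continuous : continuous fst_proj.
Proof.
by move=> t P nP; apply/nbhs_fibre; exists P, setT; split=> //; exact: filterT.
Qed.

Lemma snd_continuous : continuous snd_proj.
Proof.
by move=> t P nP; apply/nbhs_fibre; exists setT, P; split=> //; exact: filterT.
Qed.

Lemma fibre_continuous (S : topologicalType) (f : S -> T) s :
  {for s, continuous (fst_proj \o f)} -> {for s, continuous (snd_proj \o f)} ->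
  {for s, continuous f}.
Proof.
move=> c1 c2 P /nbhs_fibre[A [B [nA nB AB]]].
have n1 : \forall u \near s, A (fst_proj (f u)) by exact: c1 nA.
have n2 : \forall u \near s, B (snd_proj (f u)) by exact: c2 nB.
have n3 : \forall u \near s, P (f u).
  by apply: filterS (filterI n1 n2) => u [Au Bu]; exact: AB.
exact: n3.
Qed.

Lemma fibre_hausdorff : hausdorff_space T.
Proof.
move=> t u tu; apply: fibre_eq.
  apply: (@klein_hausdorff _ Y) => A B nA nB.
  have [v [Av Bv]] := tu _ _ (fst_continuous nA) (fst_continuous nB).
  by exists (fst_proj v).
apply: (@klein_hausdorff _ Z) => A B nA nB.
have [v [Av Bv]] := tu _ _ (snd_continuous nA) (snd_continuous nB).
by exists (snd_proj v).
Qed.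

Lemma fibre_nonempty : [set: T] !=set0.
Proof.
have [z _] := @klein_nonempty _ Z; have [y yz] := double_surjective dp (q z).
by exists (fibre_pair yz).
Qed.

Let cp : continuous p. Proof. by case: dp => -[]. Qed.
Let cq : continuous q. Proof. by case: dq => -[]. Qed.

(** A cluster point in the compact product satisfies [p y = q z], because [X] is Hausdorff. *)
Lemma fibre_compact : compact [set: T].
Proof.
move=> F FF _.
pose G := (\val : T -> Y * Z) @ F.
have kYZ : compact [set: Y * Z].
  by rewrite -setXTT; apply: compact_setX; exact: klein_compact.
have [[y z] [_ yzG]] := kYZ G _ filterT.
have e : p y = q z.
  apply: (@klein_hausdorff _ X) => A B nA nB.
  have nAB : nbhs (y, z) ((p @^-1` A) `*` (q @^-1` B)).
    by exists (p @^-1` A, q @^-1` B) => //; split; [exact: cp|exact: cq].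
  have FT : G (range (\val : T -> Y * Z)).
    by apply: (@filterS _ F _ setT) => // [u _|]; [exists u|exact: filterT].
  have [_ [[u _ <-] [Au Bu]]] := yzG _ _ FT nAB.
  by exists (p (fst_proj u)); split=> //; rewrite fibre_productE.
exists (fibre_pair e); split=> // A B FA /nbhs_fibre[A1 [B1 [nA nB AB]]].
have nAB : nbhs (y, z) (A1 `*` B1) by exists (A1, B1).
have GA : G (\val @` A).
  have -> : G (\val @` A) = F ((\val : T -> Y * Z) @^-1` (\val @` A)) by [].
  by apply: filterS FA => u Au; exists u.
have [_ [[u Au <-] [A1u B1u]]] := yzG _ _ GA nAB.
by exists u; split=> //; exact: AB.
Qed.

Lemma fst_local_homeo t : exists U g, U t /\ local_homeo fst_proj U g.
Proof.
have [U [g [Ut [qU _ _]]]] := unbranched_liso (uq (snd_proj t)).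
have [oU oqU gq _ cg] := qU.
(* The local section. Off the domain of [g] the pair may leave the fibre product, and [insubd] then
   returns the default [t]. *)
pose h y : T := insubd t (y, g (p y)).
have hE y : (q @` U) (p y) -> \val (h y) = (y, g (p y)).
  move=> [u Uu uy]; rewrite insubdK//; apply/mem_set.
  by rewrite /fibre_product /= -uy gq.
exists (snd_proj @^-1` U), h; split=> //.
have WE : fst_proj @` (snd_proj @^-1` U) = p @^-1` (q @` U).
  apply/seteqP; split=> [_ [u Uu <-]|y [u Uu uy]].
    by exists (snd_proj u) => //; rewrite fibre_productE.
  by exists (fibre_pair (esym uy)).
split.
- by apply: open_comp oU => u _; exact: snd_continuous.
- by rewrite WE; apply: open_comp oqU => u _; exact: cp.
- move=> u Uu; apply: val_inj; rewrite hE.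
    by rewrite fibre_productE gq// /fst_proj /snd_proj; case: (\val u).
  by exists (snd_proj u) => //; rewrite fibre_productE.
- by move=> u _; exact: fst_continuous.
- rewrite WE => y qy.
  have nqy : \forall y' \near y, (q @` U) (p y').
    by apply: cp; exact: open_nbhs_nbhs.
  apply: fibre_continuous.
    apply: (@near_for_continuous _ _ id); last exact: cvg_id.
    by apply: filterS nqy => y' qy'; rewrite /fst_proj /= hE.
  apply: (@near_for_continuous _ _ (g \o p)).
    by apply: filterS nqy => y' qy'; rewrite /snd_proj /= hE.
  by apply: continuous_comp; [exact: cp|exact: cg].
Qed.

(** Where [p] has a local inverse [g], [z] lifts to the pair of [g (q z)] and [z]: the second
    projection is open there. *)
Lemma fibre_lift (t : T) (E : set T) : unbranched_at p (fst_proj t) -> open E -> E t ->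
  \forall z \near snd_proj t, exists2 u, snd_proj u = z & E u.
Proof.
move=> /unbranched_liso[U [g [Ut [[oU opU gp _ cg] _ _]]]] oE Et.
have /nbhs_fibre[A [B [nA nB AB]]] : nbhs t E by exact: open_nbhs_nbhs.
have eqt := fibre_productE t.
have nU : \forall z \near snd_proj t, (p @` U) (q z).
  by apply: cq; apply: open_nbhs_nbhs; split=> //; rewrite -eqt; exists (fst_proj t).
have nA' : \forall z \near snd_proj t, A (g (q z)).
  have nA0 : nbhs (q (snd_proj t)) (g @^-1` A).
    by rewrite -eqt; apply: cg; [exists (fst_proj t)|rewrite gp].
  exact: cq nA0.
apply: filterS (filterI nU (filterI nA' nB)) => z [[v Uv vz] [Az Bz]].
have e : p (g (q z)) = q z by rewrite -vz gp.
by exists (fibre_pair e) => //; exact: AB.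
Qed.

Lemma snd_closed (E : set T) : closed E -> closed (snd_proj @` E).
Proof.
move=> cE; apply: compact_closed; first exact: klein_hausdorff.
apply: continuous_compact; last by apply: (subclosed_compact cE fibre_compact).
exact: continuous_subspaceT snd_continuous.
Qed.

(* A clopen set [E] meets every fibre of the second projection either fully or
   not at all: the points over which it does neither form a clopen set that
   avoids the fold locus. *)
Lemma fibre_connected : connected [set: T].
Proof.
move=> E E0 [C oC EC] [D cD ED]; rewrite !setTI in EC ED.
have oE : open E by rewrite EC.
have cE : closed E by rewrite ED.
have oE' : open (~` E) by exact: closed_openC.
have cE' : closed (~` E) by exact: open_closedC.
apply/seteqP; split=> // t _; apply: contrapT => nEt.
pose M := (snd_proj @` E) `&` (snd_proj @` ~` E).
(* The first components are distinct points of one fibre of [p], so neither is a fold. *)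
have unb u u' : snd_proj u = snd_proj u' -> E u -> ~ E u' ->
    unbranched_at p (fst_proj u) /\ unbranched_at p (fst_proj u').
  move=> uu' Eu nEu'.
  have pu : p (fst_proj u) = p (fst_proj u') by rewrite !fibre_productE uu'.
  have uN : fst_proj u <> fst_proj u'.
    by move=> e; apply: nEu'; rewrite -(fibre_eq e uu').
  split.
    by have [[]//|[_ /(_ _ (esym pu))/esym]] := double_cases dp (fst_proj u).
  by have [[]//|[_ /(_ _ pu)]] := double_cases dp (fst_proj u').
have oM : open M.
  rewrite openE => z [[u Eu uz] [u' nEu' u'z]].
  have [un un'] := unb u u' (etrans uz (esym u'z)) Eu nEu'.
  have n1 := fibre_lift un oE Eu; have n2 := fibre_lift un' oE' nEu'.
  rewrite uz in n1; rewrite u'z in n2.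
  by apply: filterS (filterI n1 n2) => w [[v vw Ev] [v' v'w nEv']]; split;
    [exists v|exists v'].
have oN : open (~` M).
  by apply: closed_openC; apply: closedI; exact: snd_closed.
have M0 : ~` M = setT.
  apply: (connected_open_cover (@klein_connected _ Z) oN oM).
  - by rewrite setUC setUv.
  - by rewrite setIC setICr.
  have [y fy] := fp; have [z zy] := double_surjective dq (p y).
  exists z => -[[u Eu uz] [u' nEu' u'z]]; apply: nEu'.
  have E1 v : snd_proj v = z -> fst_proj v = y.
    move=> vz; have pv : p (fst_proj v) = p y by rewrite fibre_productE vz.
    have [vy|->] := deck_fibre dp pv; first by [].
    exact: deck_folds.
  by rewrite -(@fibre_eq u u')// ?uz ?u'z// !E1.
have o1 : open (~` (snd_proj @` E)) by apply: closed_openC; exact: snd_closed.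
have o2 : open (~` (snd_proj @` ~` E)) by apply: closed_openC; exact: snd_closed.
(* Since [M] is empty, the images of [E] and of its complement split [Z] into two closed sets, one
   of which must be empty. *)
have : ~` (snd_proj @` ~` E) = setT.
  apply: (connected_open_cover (@klein_connected _ Z) o2 o1).
  - by rewrite -setCI setIC; exact: M0.
  - apply/seteqP; split=> // z [n1 n2].
    have [y yz] := double_surjective dp (q z).
    have [Eu|nEu] := pselect (E (fibre_pair yz)).
      by apply: n2; exists (fibre_pair yz).
    by apply: n1; exists (fibre_pair yz).
  case: E0 => u Eu; exists (snd_proj u) => nEu.
  have : (~` M) (snd_proj u) by rewrite M0.
  by apply; split=> //; exists u.
move=> E1; have : (~` (snd_proj @` ~` E)) (snd_proj t) by rewrite E1.
by apply; exists t.
Qed.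

Definition fibre_surface : klein_surface R :=
  pullback_surface fibre_nonempty fibre_hausdorff fibre_compact fibre_connected
    fst_local_homeo.

End FibreProduct.

(** * The two sides of a Schottky double *)

Section HalfBox.
Variable R : realType.
Local Notation C := (Cplx R).

Lemma near_box (z : C) (P : set C) : (\forall w \near z, P w) ->
  exists2 r : R, 0 < r & forall w, `|complex.Re w - complex.Re z| < r ->
    `|complex.Im w - complex.Im z| < r -> P w.
Proof.
move=> /nbhs_cplxP[d d0 dP]; exists (d / 2); first by rewrite divr_gt0.
move=> w; rewrite -!raddfB => rw iw; apply: dP.
rewrite normc_def ltcR; case: (w - z) rw iw => a b /= ad bd.
rewrite -[ltRHS](@gtr0_norm _ d)// -sqrtr_sqr ltr_sqrt ?exprn_gt0//.
have h (x : R) : `|x| < d / 2 -> x ^+ 2 < d ^+ 2 / 4.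
  move=> xd; rewrite -[x ^+ 2]ger0_norm ?sqr_ge0// normrX.
  have -> : d ^+ 2 / 4 = (d / 2) ^+ 2 by rewrite expr_div_n -natrX.
  by rewrite ltr_pXn2r// nnegrE divr_ge0// ltW.
have := ltrD (h _ ad) (h _ bd); move=> /lt_trans; apply.
by rewrite -mulrDr gtr_pMr ?exprn_gt0// -mulr2n -[_ *+ 2]mulr_natl ltr_pdivrMr// mul1r ltr_nat.
Qed.

Lemma segment_continuous (z w : C) :
  continuous (fun t : R => z + t%:C%C * (w - z) : C).
Proof.
move=> t; apply: (@cvgrPdist_lt _ C R^o (nbhs t) _ _ _).2 => e.
rewrite ltcE /= => /andP[/eqP ie re].
have eE : e = (complex.Re e)%:C%C by case: e ie {re} => a b /= ->.
pose M : R := complex.Re `|w - z| + 1.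
have wM : `|w - z| = (complex.Re `|w - z|)%:C%C by rewrite normc_def.
have M0 : 0 <= complex.Re `|w - z| by have := normr_ge0 (w - z); rewrite lecE => /andP[].
have M1 : 0 < M by rewrite ltr_wpDl.
have eM : 0 < complex.Re e / M by rewrite divr_gt0.
have n1 : \forall s \near t, `|t - s| < complex.Re e / M.
  exact: (nbhsx_ballx t _ eM).
apply: filterS n1 => s ts.
have -> : z + t%:C%C * (w - z) - (z + s%:C%C * (w - z)) = (t - s)%:C%C * (w - z).
  by rewrite opprD addrACA subrr add0r -mulrBl rmorphB.
rewrite normrM wM normc_def /= expr0n addr0 sqrtr_sqr -rmorphM /= eE ltcR.
rewrite ltr_pdivlMr// in ts; apply: le_lt_trans ts.
by rewrite ler_wpM2l// lerDl.
Qed.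

Lemma convex_connected (D : set C) :
  (forall z w (t : R), D z -> D w -> 0 <= t <= 1 -> D (z + t%:C%C * (w - z))) ->
  connected D.
Proof.
move=> cD; have [->|/set0P[z Dz]] := eqVneq D set0; first exact: connected0.
pose seg w := (fun t : R => z + t%:C%C * (w - z) : C) @` `[0, 1].
have -> : D = \bigcup_(w in D) seg w.
  apply/seteqP; split=> [w Dw|_ [w Dw [t /= t01 <-]]].
    exists w => //; exists 1; first by rewrite /= in_itv /= ler01 lexx.
    by rewrite mul1r addrC subrK.
  by apply: cD => //; move: t01; rewrite in_itv.
apply: bigcup_connected.
  exists z => w Dw; exists 0; first by rewrite /= in_itv /= ler01 lexx.
  by rewrite mul0r addr0.
move=> w Dw; apply: connected_continuous_connected; first exact: segment_connected.
exact: continuous_subspaceT (@segment_continuous z w).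
Qed.

Definition half_box s (z : C) (r : R) : set C := [set w |
  [/\ `|complex.Re w - complex.Re z| < r, `|complex.Im w| < r &
    0 < (-1) ^+ nat_of_bool s * complex.Im w]].

Lemma half_box_connected s z r : connected (half_box s z r).
Proof.
apply: convex_connected => u v t [u1 u2 u3] [v1 v2 v3] /andP[t0 t1].
have E1 : complex.Re (u + t%:C%C * (v - u)) = (1 - t) * complex.Re u + t * complex.Re v.
  by case: u v {u1 u2 u3 v1 v2 v3} => a b [a' b'] /=; ring.
have E2 : complex.Im (u + t%:C%C * (v - u)) = (1 - t) * complex.Im u + t * complex.Im v.
  by case: u v {u1 u2 u3 v1 v2 v3 E1} => a b [a' b'] /=; ring.
have t1' : 0 <= 1 - t by rewrite subr_ge0.
have conv (a b m : R) : a < m -> b < m -> (1 - t) * a + t * b < m.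
  move=> am bm; rewrite -subr_gt0.
  have -> : m - ((1 - t) * a + t * b) = (1 - t) * (m - a) + t * (m - b) by ring.
  have [->|tN] := eqVneq t 0; first by rewrite mul0r addr0 subr0 mul1r subr_gt0.
  rewrite ltr_wpDl ?mulr_ge0 ?subr_ge0 ?(ltW am)// mulr_gt0 ?subr_gt0//.
  by rewrite lt_neqAle eq_sym tN.
have nconv (a b : R) : `|a| < r -> `|b| < r -> `|(1 - t) * a + t * b| < r.
  move=> ar br; apply: le_lt_trans (conv _ _ _ ar br).
  by rewrite (le_trans (ler_normD _ _))// !normrM (ger0_norm t0) (ger0_norm t1').
split; rewrite ?E1 ?E2.
- have -> : (1 - t) * complex.Re u + t * complex.Re v - complex.Re z =
    (1 - t) * (complex.Re u - complex.Re z) + t * (complex.Re v - complex.Re z) by ring.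
  exact: nconv.
- exact: nconv.
- rewrite mulrDr !(mulrCA ((-1) ^+ _)) -oppr_lt0 opprD -!mulrN.
  by apply: conv; rewrite mulrN oppr_lt0.
Qed.

End HalfBox.

Lemma generated1 (T : Type) (h : T -> T) : h \o h = id ->
  generated [set h] = [set id; h].
Proof.
move=> hh; apply/seteqP; split.
  move=> f; apply; split; last by move=> _ ->; right.
  split; first by left.
    by move=> f1 f2 [->|->] [->|->]; [left|right|right|left].
  move=> f1 [->|->]; [exists id|exists h]; split=> //; try by [left|right].
    by move=> x; rewrite -[RHS]/(id x) -hh.
  by move=> x; rewrite -[RHS]/(id x) -hh.
by move=> f [->|->] G [[G1 _ _] hG]; [exact: G1|exact: hG].
Qed.

Section Schottky.
Context {R : realType} (X S : klein_surface R) (h : S -> S) (p : S -> X).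
Local Notation C := (Cplx R).
Hypotheses (ch : continuous h) (hh : involutive h)
  (hN : h <> id) (sp : smooth_morphism p)
  (fibre : forall y u, p y = p u <-> u = y \/ u = h y).

Lemma quotient_image y : p (h y) = p y.
Proof. by apply/esym/fibre; right. Qed.

Lemma hausdorff_near (T : topologicalType) (x y : T) : hausdorff_space T -> x <> y ->
  exists A B : set T, [/\ open A, open B, A x, B y & forall z, A z -> B z -> False].
Proof.
move=> hT /eqP xy; move: hT; rewrite open_hausdorff => /(_ _ _ xy).
move=> [[A B] [/set_mem Ax /set_mem By] [oA oB AB]].
exists A, B; split=> // z Az Bz.
by have : (A `&` B) z by []; rewrite (eqP AB).
Qed.

Lemma near_not_fixed y : h y <> y -> \forall u \near y, h u <> u.
Proof.
move=> hy; have [A [B [oA oB Ah By AB]]] := hausdorff_near (@klein_hausdorff _ S) hy.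
have n1 : \forall u \near y, A (h u) by apply: ch; exact: open_nbhs_nbhs.
have n2 : \forall u \near y, B u by exact: open_nbhs_nbhs.
apply: filterS (filterI n1 n2) => u [Au Bu] hu.
by apply: (AB u) => //; rewrite -hu.
Qed.

(** Distinct points of one fibre near a fold are exchanged by [h], whereas [h] would move a small
    neighbourhood of a non-fixed point off itself. *)
Lemma folds_fixed y : folds_at p y -> h y = y.
Proof.
move=> fy; apply: contrapT => hy.
have [A [B [oA oB Ah By AB]]] := hausdorff_near (@klein_hausdorff _ S) hy.
have n1 : \forall u \near y, A (h u) by apply: ch; exact: open_nbhs_nbhs.
have n2 : \forall u \near y, B u by exact: open_nbhs_nbhs.
have [u [u' [[Au Bu] [_ Bu'] uu' puu']]] := fold_pairs fy (filterI n1 n2).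
have [/esym//|hu] := (fibre u u').1 puu'.
by apply: (AB u') => //; rewrite hu.
Qed.

Lemma fold_local_involution y (c : chart R S) (d : chart R X) :
  plane_chart c -> dianalytic_chart d -> cdom c y -> complex.Im (c y) = 0 ->
  p @` cdom c `<=` cdom d -> (forall y', cdom c y' -> d (p y') = fold (c y')) ->
  \forall z \near c y, [/\ cimage c z, h (cinv c z) = cinv c (conjc z) &
    complex.Im z != 0 -> h (cinv c z) <> cinv c z].
Proof.
move=> pc hd cy c0 pcd df.
have nT : nbhs y [set: S] by exact: filterT.
apply: filterS (fold_local pc cy c0 pcd df nT) => z [cz cz' _ _ pz].
have hN0 : complex.Im z != 0 -> h (cinv c z) = cinv c (conjc z) /\
    h (cinv c z) <> cinv c z.
  move=> zN; have neq : cinv c (conjc z) <> cinv c z.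
    move=> e; case/negP: zN; apply/eqP/conjc_eqP.
    by case: cz cz' e => u cu <- [v cv <-]; rewrite !cmapK// => ->.
  by have [//|e] := (fibre _ _).1 pz; rewrite -e.
split=> //; last by move=> /hN0[].
have [zR|/hN0[]//] := eqVneq (complex.Im z) 0.
rewrite conjc_Im0//; apply: folds_fixed; case: cz => u cu uz.
by exists c, d; split=> //; rewrite -uz cmapK//; split=> //; rewrite uz.
Qed.

(** At an unbranched fixed point [p] is injective nearby and [p \o h = p], so [h] is the identity
    there. Such points form an open and closed set, which would be all of [S]. *)
Lemma fixed_folds y : h y = y -> folds_at p y.
Proof.
have sc y' : unbranched_at p y' \/ folds_at p y' by case: sp.
have [uy hy|//] := sc y.
exfalso; apply: hN; apply/funext => u0.
pose Z := [set u | h u = u /\ unbranched_at p u].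
suff ZT : Z = setT by have [] : Z u0 by rewrite ZT.
apply: (connected_open_cover (B := ~` Z)) (@klein_connected _ S) _ _ _ _ _.
- rewrite openE => u [hu uu].
  have [U [g [Uu [[oU opU gp cp cg] dp dg]]]] := unbranched_liso uu.
  have nU : \forall v \near u, U v by exact: open_nbhs_nbhs.
  have nhU : \forall v \near u, U (h v).
    by apply: ch; rewrite hu; exact: open_nbhs_nbhs.
  apply: filterS (filterI nU nhU) => v [Uv Uhv]; split.
    by have := gp _ Uhv; rewrite quotient_image gp.
  by apply: liso_unbranched; exists U, g.
- rewrite openE => u nZ; have [hu|hu] := pselect (h u = u); last first.
    by apply: filterS (near_not_fixed hu) => v hv [].
  have [uu|[c [d [pc hd [cu c0] pcd df]]]] := sc u; first by case: nZ.
  have n1 := near_cmap cu (fold_local_involution pc hd cu c0 pcd df).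
  apply: filterS (filterI n1 (near_cdom cu)) => v [[_ _ vN] cv] [hv uv].
  rewrite cmapK// in vN; have [v0|/vN//] := eqVneq (complex.Im (c v)) 0.
  by apply: folds_not_liso (unbranched_liso uv); exists c, d.
- exact: setUv.
- exact: setICr.
- by exists y.
Qed.

Section Sides.
Context (A B : set S).
Hypotheses (oA : open A) (oB : open B) (A0 : A !=set0) (B0 : B !=set0)
  (AB : forall y, h y <> y <-> A y \/ B y) (dAB : forall y, A y -> ~ B y).

Lemma near_side y : h y <> y -> \forall u \near y, A u <-> A y.
Proof.
move=> /AB[Ay|By].
  have nA : \forall u \near y, A u by exact: open_nbhs_nbhs.
  by apply: filterS nA => u Au; split.
have nB : \forall u \near y, B u by exact: open_nbhs_nbhs.
apply: filterS nB => u Bu; split=> Au; by [case: (dAB Au)|case: (dAB Au By)].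
Qed.

(** The complement of the mirrors is not connected. The second hypothesis carries [P] across them:
    near a mirror point it takes one truth value off the mirror, so [E] and [E'] are open and cover
    the connected surface [S]. *)
Lemma off_fixed_constant (P : set S) :
  (forall y, h y <> y -> \forall u \near y, P u <-> P y) ->
  (forall y, h y = y -> exists a : Prop, \forall u \near y, h u <> u -> (P u <-> a)) ->
  (exists2 y, h y <> y & P y) -> forall y, h y <> y -> P y.
Proof.
move=> Pn Pf [y0 hy0 Py0] y1 hy1.
pose E := [set y : S | \forall u \near y, h u <> u -> P u].
pose E' := [set y : S | \forall u \near y, h u <> u -> ~ P u].
suff ET : E = setT.
  have Ey1 : E y1 by rewrite ET.
  exact: nbhs_singleton Ey1 hy1.
have dichot y (a : Prop) : (\forall u \near y, h u <> u -> (P u <-> a)) -> E y \/ E' y.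
  move=> na; have [aT|aF] := pselect a; [left|right].
    by apply: filterS na => u Pu /Pu ->.
  by apply: filterS na => u Pu /Pu ->.
apply: (connected_open_cover (B := E')) (@klein_connected _ S) _ _ _ _ _.
- by rewrite openE => y Ey; exact: near_join.
- by rewrite openE => y Ey; exact: near_join.
- apply/seteqP; split=> // y _; have [/Pf[a]|hy] := pselect (h y = y).
    exact: dichot.
  by apply: (dichot y (P y)); apply: filterS (Pn y hy).
- apply/seteqP; split=> // y [Ey Ey'].
  suff [u hu [Pu nPu]] : exists2 u, h u <> u & (h u <> u -> P u) /\ (h u <> u -> ~ P u).
    by case: (nPu hu); exact: Pu.
  have nn : \forall u \near y, (h u <> u -> P u) /\ (h u <> u -> ~ P u).
    exact: filterI Ey Ey'.
  have [hy|hy] := pselect (h y = y); last by exists y => //; exact: nbhs_singleton nn.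
  have [u [u' [nu _ uu' puu']]] := fold_pairs (fixed_folds hy) nn.
  exists u => //; have [/esym//|u'h] := (fibre u u').1 puu'.
  by rewrite -u'h => /esym.
- by exists y0; apply: filterS (Pn y0 hy0) => u Pu _; apply/Pu.
Qed.

(* The two half-discs at a fold are connected and exchanged by [h]. *)
Lemma fold_sides y (c : chart R S) (d : chart R X) :
  plane_chart c -> dianalytic_chart d -> cdom c y -> complex.Im (c y) = 0 ->
  p @` cdom c `<=` cdom d -> (forall y', cdom c y' -> d (p y') = fold (c y')) ->
  exists a b : Prop, \forall u \near y, [/\ complex.Im (c u) = 0 -> h u = u,
    0 < complex.Im (c u) -> (A u <-> a) /\ (A (h u) <-> b) &
    complex.Im (c u) < 0 -> (A u <-> b) /\ (A (h u) <-> a)].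
Proof.
move=> pc hd cy c0 pcd df.
have /near_box[r r0 box] := fold_local_involution pc hd cy c0 pcd df.
have side s : exists a : Prop, forall z, half_box s (c y) r z -> A (cinv c z) <-> a.
  have boxP z : half_box s (c y) r z -> cimage c z /\ (A (cinv c z) \/ B (cinv c z)).
    move=> [z1 z2 z3]; have [//||cz _ zN] := box z; first by rewrite c0 subr0.
    split=> //; apply/AB/zN; apply/eqP => zI.
    by move: z3; rewrite zI mulr0 ltxx.
  have sAB : separated A B.
    split; apply/seteqP; split=> // u [].
      move=> clA Bu; have [v [Av Bv]] : A `&` B !=set0.
        by apply: clA; exact: open_nbhs_nbhs.
      by case: (dAB Av).
    move=> Au clB; have [v [Bv Av]] : B `&` A !=set0.
      by apply: clB; exact: open_nbhs_nbhs.
    by case: (dAB Av).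
  have cD : connected (cinv c @` half_box s (c y) r).
    apply: connected_continuous_connected; first exact: half_box_connected.
    by apply: continuous_subspaceW (@cinv_cts _ _ c) => z /boxP[].
  have [|DA|DB] := connected_subset sAB _ cD.
  - by move=> _ [z /boxP[_ ?] <-].
  - by exists True => z zD; split=> // _; apply: DA; exists z.
  - exists False => z zD; split=> // Az; apply: (dAB Az); apply: DB; by exists z.

have [a ha] := side false; have [b hb] := side true.
exists a, b.
have nb : \forall z \near c y, `|complex.Re z - complex.Re (c y)| < r /\
    `|complex.Im z| < r.
  have n1 : \forall z \near c y, `|complex.Re (c y) - complex.Re z| < r.
    exact: (@Re_continuous R (c y) _ (nbhsx_ballx (complex.Re (c y)) _ r0)).
  have n2 : \forall z \near c y, `|complex.Im (c y) - complex.Im z| < r.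
    exact: (@Im_continuous R (c y) _ (nbhsx_ballx (complex.Im (c y)) _ r0)).
  apply: filterS (filterI n1 n2) => z [z1].
  by rewrite c0 sub0r normrN distrC.
apply: filterS (filterI (near_cmap cy nb) (near_cdom cy)) => u [[u1 u2] cu].
have [|_ hu nu] := box (c u) u1; first by rewrite c0 subr0.
rewrite cmapK// in hu nu.
have conjbox s : half_box s (c y) r (conjc (c u)) <-> half_box (~~ s) (c y) r (c u).
  have Ic : complex.Im (conjc (c u)) = - complex.Im (c u) by case: (c u).
  have Rc : complex.Re (conjc (c u)) = complex.Re (c u) by case: (c u).
  by rewrite /half_box /= Ic Rc normrN; case: s; rewrite /= ?expr0 ?expr1 ?mulN1r ?mul1r ?opprK.
split=> [u0|u0|u0].
- by rewrite hu conjc_Im0// cmapK.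
- split; first by rewrite -{1}(cmapK cu); apply: ha; split=> //; rewrite expr0 mul1r.
  by rewrite hu; apply: hb; apply/conjbox; split=> //; rewrite expr0 mul1r.
- split; first by rewrite -{1}(cmapK cu); apply: hb; split=> //; rewrite expr1 mulN1r oppr_gt0.
  by rewrite hu; apply: ha; apply/conjbox; split=> //; rewrite expr1 mulN1r oppr_gt0.
Qed.

(** If some point and its image are on the same side, this property continues across the mirrors, so
    it holds everywhere off them. Then both half-discs at each mirror point lie on one side, [A]
    continues across as well, and [B] would be empty. *)
Lemma sides_swapped y : h y <> y -> A (h y) <-> ~ A y.
Proof.
pose P := [set u | A u <-> A (h u)].
suff nP u : h u <> u -> ~ P u.
  move=> hy; split; first by move=> Ah Ay; case: (nP y hy); split.
  by move=> nA; apply: contrapT => nAh; case: (nP y hy); split.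
move=> hu Pu.
have hhu v : h v <> v -> h (h v) <> h v by rewrite hh => + /esym.
have PT : forall v, h v <> v -> P v.
  apply: off_fixed_constant => [v hv|v hv|]; last by exists u.
    have n1 := near_side hv.
    have n2 : \forall w \near v, A (h w) <-> A (h v) := ch (near_side (hhu v hv)).
    by apply: filterS (filterI n1 n2) => w [w1 w2]; rewrite /P /= w1 w2.
  have [c [d [pc hd [cv c0] pcd df]]] := fixed_folds hv.
  have [a [b ab]] := fold_sides pc hd cv c0 pcd df.
  exists (a <-> b); apply: filterS ab => w [w0 wp wn] hw; rewrite /P /=.
  have [w1|w1|w1] := ltgtP 0 (complex.Im (c w)).
  - by have [-> ->] := wp w1.
  - by have [-> ->] := wn w1; tauto.
  - by case: hw; exact: w0.
have AT : forall v, h v <> v -> A v.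
  apply: off_fixed_constant => [v hv|v hv|]; first exact: near_side.
    have [c [d [pc hd [cv c0] pcd df]]] := fixed_folds hv.
    have [a [b ab]] := fold_sides pc hd cv c0 pcd df.
    exists a; apply: filterS ab => w [w0 wp wn] hw; have Pw := PT w hw.
    have [w1|w1|w1] := ltgtP 0 (complex.Im (c w)).
    - by have [-> _] := wp w1.
    - by have [_ <-] := wn w1.
    - by case: hw; exact: w0.
  by case: A0 => v Av; exists v => //; apply/AB; left.
case: B0 => v Bv; have hv : h v <> v by apply/AB; right.
by case: (dAB (AT v hv)).
Qed.

End Sides.
End Schottky.

(** * The quotients of the fibre product *)

Section PlaneCharts.
Context {R : realType}.
Local Notation C := (Cplx R).
Implicit Types X Y Z : klein_surface R.

Lemma plane_image_open (T : topologicalType) (c : chart R T) :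
  chart_into [set: C] c -> open (cimage c).
Proof. by move=> [V oV ->]; rewrite setTI. Qed.

Lemma plane_local_homeo (T : topologicalType) (c : chart R T) :
  chart_into [set: C] c -> local_homeo c (cdom c) (cinv c).
Proof.
move=> pc; have oc := plane_image_open pc.
split; first exact: cdom_open.
- exact: oc.
- by move=> x cx; exact: cmapK.
- by move=> x cx; exact: cmap_continuous.
- move=> _ [x cx <-] P; rewrite cmapK// => nP.
  have nc : nbhs (c x) (cimage c).
    by apply: open_nbhs_nbhs; split=> //; exact: cimage_cmap.
  by apply: filterS (filterI nc (near_cinv cx nP)) => z [cz]; exact.
Qed.

Lemma conjn_local_homeo s : local_homeo (@conjn R s) setT (conjn s).
Proof.
have sT : @conjn R s @` setT = setT.
  by apply/seteqP; split=> // z _; exists (conjn s z) => //; rewrite conjnK.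
split; rewrite ?sT; try exact: openT.
- by move=> z _; exact: conjnK.
- by move=> z _; exact: conjn_continuous.
- by move=> z _; exact: conjn_continuous.
Qed.

Lemma plane_charts_dian Y Z s (c : chart R Y) (d : chart R Z) y :
  compatible_chart c -> plane_chart d -> cdom c y ->
  cimage d (conjn s (c y)) -> {for y, continuous (cinv d \o (conjn s \o c))} ->
  dian (cinv d \o (conjn s \o c)) y.
Proof.
move=> cc [pd cd] cy dy cf; split=> //; exists c, d; split=> //.
  by case: dy => v dv vy; rewrite /= -vy cmapK.
exists s; apply: dianalytic_atW (dianalytic_at_conjn s (c y) setT).
have nd : nbhs (conjn s (c y)) (cimage d).
  by apply: open_nbhs_nbhs; split=> //; exact: plane_image_open.
have nd' : \forall z \near c y, cimage d (conjn s z).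
  exact: (near_continuous (@conjn_continuous R s (c y)) nd).
apply: filterS nd' => z [v dv vz] [u [cu _] uz]; split=> //=.
by rewrite -uz cmapK// uz -vz cmapK.
Qed.

(** The model of the projection to the Schottky double at a mirror: two fold charts compared
    directly or through conjugation. *)
Lemma plane_charts_liso Y Z s (c : chart R Y) (d : chart R Z) y :
  plane_chart c -> plane_chart d -> cdom c y -> cimage d (conjn s (c y)) ->
  liso_at (cinv d \o (conjn s \o c)) y.
Proof.
move=> [pc cc] [pd cd] cy dy.
have H1 := local_homeo_comp (plane_local_homeo pc) (conjn_local_homeo s).
have H2 := local_homeo_comp H1 (local_homeo_inv (plane_local_homeo pd)).
exists (cdom c `&` c @^-1` setT `&` (conjn s \o c) @^-1` (cimage d)).
exists (cinv c \o (conjn s \o d)); split; first by split.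
have [_ _ gf cf cg] := H2.
split=> [|u uU|v [u uU uv]]; first exact: H2.
  by apply: plane_charts_dian; [| |case: uU => -[]|case: uU|exact: cf].
have [[cu _] [w dw wu]] := uU.
have wv : w = v by rewrite -uv -[LHS](cmapK dw) wu.
apply: plane_charts_dian => //; rewrite -?wv//.
  by exists u => //; rewrite wu /= conjnK.
by apply: cg; exists u; rewrite // uv wv.
Qed.

End PlaneCharts.

(** * Agreement of the local orientations of two doubles *)

Section Agreement.
Context {R : realType} (X Y Z : klein_surface R) (p : Y -> X) (q : Z -> X).
Local Notation C := (Cplx R).
Context (P : set (chart R Y)) (Q : set (chart R Z)).
Hypotheses (dp : double_map p) (dq : double_map q).
Hypothesis uq : forall z, unbranched_at q z.
Hypotheses (oP : orientation P) (oQ : orientation Q).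
Hypotheses (kp : forall y, rsign P P true (deck p) y)
  (kq : forall z, rsign Q Q true (deck q) z).

Let hP := orientation_coherent oP.
Let hQ := orientation_coherent oQ.

Lemma rsign_change (W V : klein_surface R) (P' : set (chart R W)) s u (f : W -> V)
    (e e' : chart R V) y : {for y, continuous f} ->
  rsign P' [set e] s f y -> chart_sign u e e' id (f y) -> cdom e' (f y) ->
  rsign P' [set e'] (s (+) u) f y.
Proof.
move=> cf [c [_ [Pc -> cy ey fs]]] eu ey'.
by exists c, e'; split=> //; exact: (chart_sign_compr cy ey ey' cf fs eu).
Qed.

Lemma deck_rsign (W : klein_surface R) (f : W -> X) (P' : set (chart R W)) s e y :
  double_map f -> orientation P' -> (forall y, rsign P' P' true (deck f) y) ->
  rsign P' [set e] s f y -> rsign P' [set e] (~~ s) f (deck f y).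
Proof.
move=> df oP' kf fs; have cf : continuous f by case: df => -[].
have := @rsign_comp _ _ _ _ P' P' [set e] true s (deck f) f (deck f y)
  (orientation_coherent oP') (deck_continuous df (x := deck f y)) (cf _) (kf _).
rewrite (deckK df) addTb => /(_ fs); apply: rsign_near.
by near=> w; rewrite /= (deck_proj df).
Unshelve. all: by end_near. Qed.

(* The orientations of [Y] near [y] and of [Z] near [z], where [p y = q z], induce
   the same local orientation of [X]; meaningful only off the fold locus of [p]. *)
Definition agree y z := exists s e, [/\ compatible_chart e,
  rsign P [set e] s p y & rsign Q [set e] s q z].

(** Replacing [e] by another chart of [X] adds the same sign to both sides, so any chart decides
    agreement. *)
Lemma agreeP s t e y z : unbranched_at p y -> p y = q z -> compatible_chart e ->
  rsign P [set e] s p y -> rsign Q [set e] t q z -> agree y z <-> s = t.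
Proof.
move=> uy pq ce ps qt; split=> [|st]; last by exists s, e; split=> //; rewrite st.
move=> [s' [e' [ce' ps' qs']]].
have ly := unbranched_liso uy; have lz := unbranched_liso (uq z).
have cy := liso_at_continuous ly; have cz := liso_at_continuous lz.
have ey : cdom e (p y) by case: ps => c [_ [_ -> _ +]] _.
have ey' : cdom e' (p y) by case: ps' => c [_ [_ -> _ +]] _.
have [u eu] := compatible_sign ce' ce ey' ey.
have se := rsign_uniq hP (coherent1 ce) ly (rsign_change cy ps' eu ey) ps.
rewrite pq in eu ey.
have te := rsign_uniq hQ (coherent1 ce) lz (rsign_change cz qs' eu ey) qt.
by rewrite -se -te.
Qed.

Lemma rsign_chart_exists (W : klein_surface R) (f : W -> X) (P' : set (chart R W)) e y :
  orientation P' -> dian f y -> compatible_chart e -> cdom e (f y) ->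
  exists s, rsign P' [set e] s f y.
Proof.
move=> oP' df ce ey; have [c Pc cy] := orientation_cover y oP'.
exact: (rsign_exists (orientation_coherent oP') (coherent1 ce) df Pc erefl cy ey).
Qed.

Lemma agree_signs y z : unbranched_at p y -> p y = q z ->
  exists e s t, [/\ compatible_chart e, rsign P [set e] s p y & rsign Q [set e] t q z].
Proof.
move=> uy pq; have [e ae ey] := atlas_cover (p y); have ce := atlas_compatible ae.
have [s ps] := rsign_chart_exists oP (liso_at_dian (unbranched_liso uy)) ce ey.
rewrite pq in ey.
have [t qt] := rsign_chart_exists oQ (liso_at_dian (unbranched_liso (uq z))) ce ey.
by exists e, s, t.
Qed.

Lemma agree_deckl y z : unbranched_at p y -> p y = q z ->
  agree (deck p y) z <-> ~ agree y z.
Proof.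
move=> uy pq; have [e [s [t [ce ps qt]]]] := agree_signs uy pq.
have [_ pd ud] := deck_unbranched dp uy.
rewrite (agreeP uy pq ce ps qt).
rewrite (agreeP ud (etrans pd pq) ce (deck_rsign dp oP kp ps) qt).
by case: (s) (t) => [] [].
Qed.

Lemma agree_deckr y z : unbranched_at p y -> p y = q z ->
  agree y (deck q z) <-> ~ agree y z.
Proof.
move=> uy pq; have [e [s [t [ce ps qt]]]] := agree_signs uy pq.
have pq' : p y = q (deck q z) by rewrite (deck_proj dq).
rewrite (agreeP uy pq ce ps qt) (agreeP uy pq' ce ps (deck_rsign dq oQ kq qt)).
by case: (s) (t) => [] [].
Qed.

Lemma agree_near y z : unbranched_at p y -> p y = q z ->
  exists A B, [/\ nbhs y A, nbhs z B & forall u v, A u -> B v -> p u = q v ->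
    (agree u v <-> agree y z)].
Proof.
move=> uy pq; have [e [s [t [ce ps qt]]]] := agree_signs uy pq.
have ly := unbranched_liso uy; have lz := unbranched_liso (uq z).
have n1 := rsign_open (liso_at_continuous ly) ps.
have n2 := rsign_open (liso_at_continuous lz) qt.
have n3 : \forall u \near y, unbranched_at p u.
  have [U [g [Uy pU]]] := ly.
  have nU : nbhs y U by case: pU => -[oU _ _ _ _] _ _; exact: open_nbhs_nbhs.
  by apply: filterS nU => u Uu; apply: liso_unbranched; exists U, g.
exists [set u | rsign P [set e] s p u /\ unbranched_at p u].
exists [set v | rsign Q [set e] t q v].
apply: And3; [exact: (filterI n1 n3)|exact: n2|].
move=> u v [pu uu] qv puv.
by rewrite (agreeP uy pq ce ps qt) (agreeP uu puv ce pu qv).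
Qed.

(** Across the real axis [fold] changes from the identity to conjugation, so the sign of [p] flips
    while that of [q] stays constant. *)
Lemma agree_folds y z (c : chart R Y) (d : chart R X) :
  plane_chart c -> dianalytic_chart d -> cdom c y -> complex.Im (c y) = 0 ->
  p @` cdom c `<=` cdom d -> (forall y', cdom c y' -> d (p y') = fold (c y')) ->
  p y = q z ->
  exists a : Prop, exists A B, [/\ nbhs y A, nbhs z B & forall u v, A u -> B v ->
    p u = q v -> (0 < complex.Im (c u) -> (agree u v <-> a)) /\
      (complex.Im (c u) < 0 -> (agree u v <-> ~ a))].
Proof.
move=> pc hd cy c0 pcd df pq.
have [e0 Pe0 ey] := orientation_cover y oP.
have [s0 es] := compatible_sign (hP.1 _ Pe0) (proj2 pc) ey cy.
have dy : cdom d (p y) by apply: pcd; exists y.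
have [t qt] : exists t, rsign Q [set d] t q z.
  rewrite pq in dy.
  exact: (rsign_chart_exists oQ (liso_at_dian (unbranched_liso (uq z))) (proj2 hd) dy).
have n2 := rsign_open (liso_at_continuous (unbranched_liso (uq z))) qt.
have n1 := chart_sign_open ey es.
exists (s0 = t), [set u | [/\ chart_sign s0 e0 c id u, cdom e0 u & cdom c u]].
exists [set v | rsign Q [set d] t q v]; apply: And3; [|exact: n2|].
  apply: filterS (filterI n1 (filterI (near_cdom ey) (near_cdom cy))).
  by move=> u [u1 [u2 u3]]; exact: (And3 (u1 u2) u2 u3).
move=> u v [eu e0u cu] qv puv.
have du : cdom d (p u) by apply: pcd; exists u.
have uu : complex.Im (c u) != 0 -> unbranched_at p u.
  move=> cN; have [[]//|[/folds_boundary bu _]] := double_cases dp u.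
  case/negP: cN; have := (boundaryP hd du).1 bu; rewrite df//=.
  by move=> /eqP; rewrite normr_eq0.
have sgn s : (forall w, w = c u -> \forall z' \near w, fold z' = conjn s z') ->
    rsign P [set d] (s0 (+) s) p u.
  move=> fs; suff cs : chart_sign s c d p u.
    by exists e0, d; exact: (And5 Pe0 erefl e0u du (chart_sign_compl e0u cu du eu cs)).
  apply: dianalytic_atW (dianalytic_at_conjn s (c u) setT).
  apply: filterS (fs _ erefl) => z' fz [w [cw dw] wz]; split=> //.
  by rewrite -wz cmapK// df// wz.
split=> cI.
  have ps : rsign P [set d] (s0 (+) false) p u.
    apply: sgn => w wE; rewrite -wE in cI; apply: filterS (near_Im_gt0 cI) => z' z0.
    by rewrite fold_Im_ge0// ltW.
  have cN : complex.Im (c u) != 0 by rewrite gt_eqF.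
  by rewrite (agreeP (uu cN) puv (proj2 hd) ps qv) addbF.
have ps : rsign P [set d] (s0 (+) true) p u.
  apply: sgn => w wE; rewrite -wE in cI; apply: filterS (near_Im_lt0 cI) => z' z0.
  by rewrite foldE z0.
have cN : complex.Im (c u) != 0 by rewrite lt_eqF.
rewrite (agreeP (uu cN) puv (proj2 hd) ps qv).
by case: (s0) (t) => [] [].
Qed.

End Agreement.

Lemma iff_notF (a b : Prop) : (a <-> b) -> (b <-> ~ a) -> False.
Proof. tauto. Qed.

Lemma iff_notr (a b : Prop) : ~ (a <-> b) -> b <-> ~ a.
Proof. by have := EM a; have := EM b; tauto. Qed.

Lemma iff_notl (a b : Prop) : (a <-> b) -> ~ (~ a <-> b).
Proof. tauto. Qed.

Lemma opposite_sides (a b c d : Prop) :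
  (b <-> c) -> (b <-> ~ a) -> ~ (d <-> c) -> (a <-> d).
Proof. by have := EM a; have := EM c; have := EM d; tauto. Qed.

(** * The involutions of the fibre product and their quotients *)

Section DoubleOfDoubles.
Context {R : realType} (X Y Z : klein_surface R) (p : Y -> X) (q : Z -> X).
Local Notation C := (Cplx R).
Context (P : set (chart R Y)) (Q : set (chart R Z)).
Hypotheses (dp : double_map p) (dq : double_map q).
Hypothesis uq : forall z, unbranched_at q z.
Hypothesis fp : exists y, folds_at p y.
Hypotheses (oP : orientation P) (oQ : orientation Q).
Hypotheses (kp : forall y, rsign P P true (deck p) y)
  (kq : forall z, rsign Q Q true (deck q) z).

Let D := fibre_surface dp dq uq fp.
Let pi1 : D -> Y := @fst_proj R X Y Z p q.
Let pi2 : D -> Z := @snd_proj R X Y Z p q.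
Let cp : continuous p. Proof. by case: dp => -[]. Qed.
Let cq : continuous q. Proof. by case: dq => -[]. Qed.

Lemma pi_comm (t : D) : p (pi1 t) = q (pi2 t).
Proof. exact: fibre_productE. Qed.

Lemma pi1_liso (t : D) : liso_at pi1 t.
Proof. exact: pullback_liso. Qed.

Lemma pi2_continuous : continuous pi2.
Proof. exact: snd_continuous. Qed.

Lemma pi_inj (t u : D) : pi1 t = pi1 u -> pi2 t = pi2 u -> t = u.
Proof. exact: fibre_eq. Qed.

Lemma pi_near (t : D) A B : nbhs (pi1 t) A -> nbhs (pi2 t) B ->
  \forall u \near t, A (pi1 u) /\ B (pi2 u).
Proof.
move=> nA nB; apply: filterI; first exact: (liso_at_continuous (pi1_liso t)).
exact: pi2_continuous.
Qed.

Definition deck1 (t : D) : D := fibre_pair (etrans (deck_proj dp (pi1 t)) (pi_comm t)).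
Definition deck2 (t : D) : D :=
  fibre_pair (etrans (pi_comm t) (esym (deck_proj dq (pi2 t)))).

Lemma pi1_deck1 t : pi1 (deck1 t) = deck p (pi1 t). Proof. by []. Qed.
Lemma pi2_deck1 t : pi2 (deck1 t) = pi2 t. Proof. by []. Qed.
Lemma pi1_deck2 t : pi1 (deck2 t) = pi1 t. Proof. by []. Qed.
Lemma pi2_deck2 t : pi2 (deck2 t) = deck q (pi2 t). Proof. by []. Qed.

Lemma deck1K : involutive deck1.
Proof. by move=> t; apply: pi_inj; rewrite ?pi1_deck1 ?pi2_deck1 ?deckK. Qed.

Lemma deck2K : involutive deck2.
Proof. by move=> t; apply: pi_inj; rewrite ?pi1_deck2 ?pi2_deck2 ?deckK. Qed.

Lemma deck12 t : deck1 (deck2 t) = deck2 (deck1 t).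
Proof. by apply: pi_inj; rewrite !(pi1_deck1, pi2_deck1, pi1_deck2, pi2_deck2). Qed.

Lemma deck1_continuous : continuous deck1.
Proof.
move=> t; apply: fibre_continuous.
  apply: (@continuous_comp _ _ _ pi1 (deck p)); last exact: deck_continuous.
  exact: liso_at_continuous (pi1_liso t).
exact: pi2_continuous.
Qed.

Lemma deck2_continuous : continuous deck2.
Proof.
move=> t; apply: fibre_continuous; first exact: liso_at_continuous (pi1_liso t).
apply: (@continuous_comp _ _ _ pi2 (deck q)); last exact: deck_continuous.
exact: pi2_continuous.
Qed.

Lemma pi1_surjective y : exists t, pi1 t = y.
Proof.
have [z zy] := double_surjective dq (p y).
by exists (fibre_pair (esym zy) : D).
Qed.

Lemma pi2_surjective z : exists t, pi2 t = z.
Proof.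
have [y yz] := double_surjective dp (q z).
by exists (fibre_pair yz : D).
Qed.

Let Po := pullback_orientation P : set (chart R D).

Lemma deck1_sign c d t : Po c -> Po d -> cdom c t -> cdom d (deck1 t) ->
  chart_sign true c d deck1 t.
Proof.
move=> [_ Pc] [_ Pd]; apply: (pullback_in_charts (f0 := deck p)) Pc Pd => // y e e'.
move=> Pe Pe' ey ey'; have hP := orientation_coherent oP.
exact: (rsign_chart hP hP (deck_continuous dp (x := y)) (kp y) Pe Pe' ey ey').
Qed.

(** The structure of [D] is pulled back from [Y], and [deck2] lies over the identity of [Y]; hence
    it is conformal although [deck q] is not. *)
Lemma deck2_sign c d t : Po c -> Po d -> cdom c t -> cdom d (deck2 t) ->
  chart_sign false c d deck2 t.
Proof.
move=> [_ Pc] [_ Pd]; apply: (pullback_in_charts (f0 := id)) Pc Pd => // y e e'.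
move=> Pe Pe' ey ey'.
exact: (coherent_sign (orientation_coherent oP) Pe Pe' ey ey').
Qed.

Lemma deck12_sign c d t : Po c -> Po d -> cdom c t -> cdom d (deck1 (deck2 t)) ->
  chart_sign true c d (deck1 \o deck2) t.
Proof.
move=> [_ Pc] [_ Pd]; apply: (pullback_in_charts (f0 := deck p)) Pc Pd => // y e e'.
move=> Pe Pe' ey ey'; have hP := orientation_coherent oP.
exact: (rsign_chart hP hP (deck_continuous dp (x := y)) (kp y) Pe Pe' ey ey').
Qed.

Lemma Po_orientation : orientation Po.
Proof. exact: pullback_orientationP. Qed.

Lemma deck1_Aut : Aut_pm D deck1.
Proof.
exists Po, deck1; split; [exact: Po_orientation|exact: deck1K|exact: deck1K|right].
have a : anticonformal Po deck1; last by split.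
split; first exact: deck1_continuous.
by move=> c d Pc Pd _ [t [ct dt] <-]; exact: deck1_sign.
Qed.

Lemma deck2_Aut : Aut_pm D deck2.
Proof.
exists Po, deck2; split; [exact: Po_orientation|exact: deck2K|exact: deck2K|left].
have a : conformal Po deck2; last by split.
split; first exact: deck2_continuous.
by move=> c d Pc Pd _ [t [ct dt] <-]; exact: deck2_sign.
Qed.

Lemma deck12_Aut : Aut_pm D (deck1 \o deck2).
Proof.
have K : involutive (deck1 \o deck2) by move=> t; rewrite /= -deck12 deck2K deck1K.
exists Po, (deck1 \o deck2); split; [exact: Po_orientation|exact: K|exact: K|right].
have a : anticonformal Po (deck1 \o deck2); last by split.
split; last by move=> c d Pc Pd _ [t [ct dt] <-]; exact: deck12_sign.
move=> t; apply: continuous_comp; [exact: deck2_continuous|exact: deck1_continuous].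
Qed.

Lemma id_Aut : Aut_pm D id.
Proof.
exists Po, id; split=> //; [exact: Po_orientation|left].
have a : conformal Po id; last by split.
split; first by move=> t; exact: cvg_id.
move=> c d Pc Pd _ [t [ct dt] <-].
exact: (coherent_sign (orientation_coherent Po_orientation) Pc Pd ct dt).
Qed.

Lemma fibre_riemann : boundary Y = set0 -> riemann_surface D.
Proof.
move=> bY; split; last exact: pullback_boundary.
by exists Po; exact: Po_orientation.
Qed.

Lemma deck2_neq t : deck2 t <> t.
Proof.
move=> /(congr1 pi2); rewrite pi2_deck2.
by have [] := deck_unbranched dq (uq (pi2 t)).
Qed.

(** Unlike [deck2], this involution has fixed points, namely over the folds of [p]; a point close to
    a fold is moved. *)
Lemma deck1_neq : exists t, deck1 t <> t.
Proof.
have [y fy] := fp; have nT : nbhs y [set: Y] by exact: filterT.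
have [u [u' [_ _ uu' puu']]] := fold_pairs fy nT.
have [t tu] := pi1_surjective u; exists t => /(congr1 pi1).
rewrite pi1_deck1 tu => ku; have [/esym//|u'E] := deck_fibre dp (esym puu').
by apply: uu'; rewrite u'E ku.
Qed.

Lemma deck12_neq t : deck1 (deck2 t) <> t.
Proof.
move=> /(congr1 pi2); rewrite pi2_deck1 pi2_deck2.
by have [] := deck_unbranched dq (uq (pi2 t)).
Qed.

Lemma pi1_quotient : is_quotient [set id; deck2] Y.
Proof.
exists pi1; split.
- split=> [t|t]; first exact: liso_at_continuous (pi1_liso t).
  by left; exact: liso_unbranched (pi1_liso t).
- by apply/seteqP; split=> // y _; have [t <-] := pi1_surjective y; exists t.
move=> t u; split=> [tu|[_ [->|->] <-]]; rewrite ?pi1_deck2//.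
have := pi_comm u; rewrite -tu pi_comm => /esym/(deck_fibre dq)[e|e].
  by exists id; [left|apply: pi_inj].
by exists deck2; [right|apply: pi_inj; rewrite ?pi1_deck2 ?pi2_deck2].
Qed.

(** Where [p] is unbranched, [pi2] is locally [g \o (p \o pi1)] with [g] a local inverse of [q];
    over a fold of [p] it folds, by [folds_transport]. *)
Lemma pi2_quotient : is_quotient [set id; deck1] Z.
Proof.
exists pi2; split.
- split=> [t|t]; first exact: pi2_continuous.
  have [[ut _]|[ft _]] := double_cases dp (pi1 t).
    left; apply: liso_unbranched.
    have [U [g [Ut qU]]] := unbranched_liso (uq (pi2 t)).
    have qg := liso_inv qU.
    have lg : liso_at g (p (pi1 t)).
      by exists (q @` U), q; split=> //; rewrite pi_comm; exists (pi2 t).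
    have lpg : liso_at (g \o (p \o pi1)) t.
      apply: liso_at_comp lg; apply: liso_at_comp (pi1_liso t) _.
      exact: unbranched_liso.
    have nU : \forall u \near t, U (pi2 u).
      by apply: pi2_continuous; case: qU => -[oU _ _ _ _] _ _; exact: open_nbhs_nbhs.
    apply: liso_at_near lpg; apply: filterS nU => u Uu /=.
    by rewrite pi_comm; case: qU => -[_ _ gq _ _] _ _; exact: gq.
  right; apply: (folds_transport ft (pi1_liso t) (unbranched_liso (uq _))).
    exact: pi2_continuous.
  by near=> u; rewrite pi_comm.
- by apply/seteqP; split=> // y _; have [t <-] := pi2_surjective y; exists t.
move=> t u; split=> [tu|[_ [->|->] <-]]; rewrite ?pi2_deck1//.
have := pi_comm u; rewrite -tu -pi_comm => /(deck_fibre dp)[e|e].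
  by exists id; [left|apply: pi_inj].
by exists deck1; [right|apply: pi_inj; rewrite ?pi1_deck1 ?pi2_deck1].
Unshelve. all: by end_near. Qed.

Section SchottkyQuotient.
Context (S : klein_surface R) (h : S -> S) (r : S -> X) (A B : set S).
Hypotheses (bY : boundary Y = set0) (bS : boundary S = set0).
Hypotheses (ch : continuous h) (hh : involutive h) (hN : h <> id)
  (sr : smooth_morphism r) (rT : range r = setT)
  (fibre : forall y u, r y = r u <-> u = y \/ u = h y).
Hypotheses (oA : open A) (oB : open B) (A0 : A !=set0) (B0 : B !=set0)
  (AB : forall y, h y <> y <-> A y \/ B y) (dAB : forall y, A y -> ~ B y).

Let swap y (hy : h y <> y) : A (h y) <-> ~ A y :=
  sides_swapped ch hh hN sr fibre oA oB A0 B0 AB dAB hy.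

Let fixP s : h s = s <-> boundary X (r s).
Proof.
split=> [/(fixed_folds ch hN sr fibre)/folds_boundary//|bs].
apply: (folds_fixed ch fibre); case: sr => _ /(_ s)[us|//].
by have := (unbranched_boundary us).1 bs; rewrite bS.
Qed.

Let foldP y : folds_at p y <-> boundary X (p y) := double_folds_boundary y dp bY.

Let interior_unbranched y : ~ boundary X (p y) -> unbranched_at p y.
Proof. by move=> by_; have [[]//|[/foldP]] := double_cases dp y. Qed.

Let agr (t : D) := agree p q P Q (pi1 t) (pi2 t).

(** Over a boundary point the fibre of [r] is a single point and agreement has no meaning; elsewhere
    the side selects one of the two points. *)
Let lies_over (t : D) (s : S) :=
  r s = p (pi1 t) /\ (~ boundary X (p (pi1 t)) -> (A s <-> agr t)).

Let lies_over_exists t : exists s, lies_over t s.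
Proof.
have [s _ rs] : range r (p (pi1 t)) by rewrite rT.
have [bt|bt] := pselect (boundary X (p (pi1 t))); first by exists s.
have hs : h s <> s by rewrite fixP rs.
have [st|st] := pselect (A s <-> agr t); first by exists s.
exists (h s); split=> [|_]; first by rewrite (quotient_image fibre).
by rewrite (swap hs); have := EM (agr t); tauto.
Qed.

Let lies_over_uniq t s s' : lies_over t s -> lies_over t s' -> s = s'.
Proof.
move=> [rs As] [rs' As'].
have [//|s'E] := (fibre s s').1 (etrans rs (esym rs')).
have [bt|bt] := pselect (boundary X (p (pi1 t))).
  by rewrite s'E; apply/esym/fixP; rewrite rs.
have hs : h s <> s by rewrite fixP rs.
have := As' bt; rewrite s'E (swap hs) -(As bt); tauto.
Qed.

(* The point over [p (pi1 t)] on the side [A] of the mirrors of [h] exactly when the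
   local orientations given by the two components of [t] agree. *)
Definition schottky_proj (t : D) : S := proj1_sig (cid (lies_over_exists t)).

Lemma schottky_projP t : lies_over t (schottky_proj t).
Proof. by rewrite /schottky_proj; case: cid. Qed.

Lemma schottky_proj_eq t s : lies_over t s -> schottky_proj t = s.
Proof. exact: lies_over_uniq (schottky_projP t). Qed.

Lemma agr_deck12 t : ~ boundary X (p (pi1 t)) -> agr (deck1 (deck2 t)) <-> agr t.
Proof.
move=> /interior_unbranched ut; have e := pi_comm t.
have [_ pd ud] := deck_unbranched dp ut.
have [_ e' _] := deck_unbranched dq (uq (pi2 t)).
rewrite /agr pi1_deck1 pi2_deck1 pi1_deck2 pi2_deck2.
rewrite (agree_deckl dp uq oP oQ kp ut (etrans e (esym e'))).
rewrite (agree_deckr dq uq oP oQ kq ut e).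
by have := EM (agree p q P Q (pi1 t) (pi2 t)); tauto.
Qed.

Lemma schottky_proj_fibre t u :
  schottky_proj t = schottky_proj u <-> exists2 g, [set id; deck1 \o deck2] g & g t = u.
Proof.
split=> [tu|[_ [->|->] <-//]]; last first.
  apply/esym/schottky_proj_eq; have [rt At] := schottky_projP t.
  have pt : p (pi1 (deck1 (deck2 t))) = p (pi1 t) by exact: deck_proj.
  have lo : lies_over (deck1 (deck2 t)) (schottky_proj t).
    split; first by rewrite pt.
    rewrite pt => bt; exact: (iff_trans (At bt) (iff_sym (agr_deck12 bt))).
  exact: lo.
have [rt At] := schottky_projP t; have [ru Au] := schottky_projP u.
rewrite -tu in ru Au; have ptu : p (pi1 u) = p (pi1 t) by rewrite -ru.
have qtu : q (pi2 u) = q (pi2 t) by rewrite -!pi_comm.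
(* Over the boundary [deck p] fixes the first component, so [deck1 \o deck2] acts there as [deck2].
   Elsewhere, changing exactly one component would destroy the agreement. *)
have [bt|bt] := pselect (boundary X (p (pi1 t))).
  have kt : deck p (pi1 t) = pi1 t by apply: deck_folds => //; apply/foldP.
  have ut : pi1 u = pi1 t by have [|->] := deck_fibre dp ptu.
  have [zu|zu] := deck_fibre dq qtu.
    by exists id; [left|apply/esym/pi_inj].
  by exists (deck1 \o deck2); [right|apply/esym/pi_inj; rewrite ?ut//= kt].
have uu := interior_unbranched bt; have e := pi_comm t.
have bu : ~ boundary X (p (pi1 u)) by rewrite ptu.
have ag : agr t <-> agr u by rewrite -(At bt) -(Au bu).
have [yu|yu] := deck_fibre dp ptu; have [zu|zu] := deck_fibre dq qtu.
- by exists id; [left|apply/esym/pi_inj].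
- case: (iff_notF ag); rewrite /agr yu zu; exact: (agree_deckr dq uq oP oQ kq uu e).
- case: (iff_notF ag); rewrite /agr yu zu; exact: (agree_deckl dp uq oP oQ kp uu e).
- by exists (deck1 \o deck2); [right|apply/esym/pi_inj].
Qed.

Lemma schottky_proj_surjective s : exists t, schottky_proj t = s.
Proof.
have [y yr] := double_surjective dp (r s).
have [z zr] := double_surjective dq (r s).
have e : p y = q z by rewrite yr.
pose t : D := fibre_pair e.
have pt : p (pi1 t) = r s by [].
have [bt|bt] := pselect (boundary X (r s)).
  by exists t; apply: schottky_proj_eq; split; rewrite pt// => /(_ bt).
have [st|st] := pselect (A s <-> agr t).
  by exists t; apply: schottky_proj_eq; split; rewrite pt.
exists (deck2 t); apply: schottky_proj_eq; split; first by rewrite pi1_deck2 pt.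
move=> _; have uy : unbranched_at p (pi1 t) by apply: interior_unbranched; rewrite pt.
rewrite /agr pi1_deck2 pi2_deck2 (agree_deckr dq uq oP oQ kq uy e).
change (A s <-> ~ agr t).
by have := EM (agr t); have := EM (A s); tauto.
Qed.

(** Side and agreement are both locally constant here, so the map is locally a local inverse of [r]
    after [p \o pi1]. *)
Lemma schottky_proj_interior t : ~ boundary X (p (pi1 t)) -> liso_at schottky_proj t.
Proof.
move=> bt; have ut := interior_unbranched bt; have [rt At] := schottky_projP t.
have hs : h (schottky_proj t) <> schottky_proj t by rewrite fixP rt.
have us : unbranched_at r (schottky_proj t).
  by case: sr => _ /(_ (schottky_proj t))[//|/folds_boundary/fixP].
have [U [g [Us rU]]] := unbranched_liso us.
have lg : liso_at g (p (pi1 t)).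
  by exists (r @` U), r; split; [rewrite -rt; exists (schottky_proj t)|exact: liso_inv].
have lf : liso_at (g \o (p \o pi1)) t.
  apply: liso_at_comp lg; apply: liso_at_comp (pi1_liso t) _.
  exact: unbranched_liso.
have ft : g (p (pi1 t)) = schottky_proj t by rewrite -rt; case: rU => -[_ _ ->].
apply: (liso_at_near _ lf).
have n1 : \forall u \near t, A (g (p (pi1 u))) <-> A (schottky_proj t).
  have nA : \forall s \near (g \o (p \o pi1)) t, A s <-> A (schottky_proj t).
    by rewrite /= ft; exact: (near_side oA oB AB dAB hs).
  exact: (liso_at_continuous lf nA).
have [A1 [B1 [nA1 nB1 ag]]] := agree_near uq oP oQ ut (pi_comm t).
have n2 := pi_near nA1 nB1.
have n3 : \forall u \near t, (r @` U) (p (pi1 u)).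
  have cpt : {for t, continuous (p \o pi1)}.
    by apply: continuous_comp; [exact: liso_at_continuous (pi1_liso t)|exact: cp].
  apply: cpt; apply: open_nbhs_nbhs; split; first by case: rU => -[].
  by rewrite /= -rt; exists (schottky_proj t).
apply: filterS (filterI n1 (filterI n2 n3)) => u [Au [[A1u B1u] [v Uv vu]]].
apply/esym/schottky_proj_eq; split.
  by rewrite /= -vu; case: rU => -[_ _ gr _ _] _ _; rewrite gr.
move=> bu; rewrite /= Au (At bt) /agr.
by apply: iff_sym; apply: ag => //; exact: pi_comm.
Qed.

(** Fold charts [c] of [Y] and [c'] of [S] are taken over the same chart [d] of [X], by
    [folds_at_chart]. Read in them, the map is the identity or conjugation on a whole
    neighbourhood. *)
Lemma schottky_proj_boundary t : boundary X (p (pi1 t)) -> liso_at schottky_proj t.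
Proof.
move=> bt; have [rt At] := schottky_projP t.
have fy : folds_at p (pi1 t) by apply/foldP.
have [c [d [pc hd [cy c0] pcd df]]] := fy.
have dy : cdom d (p (pi1 t)) by apply: pcd; exists (pi1 t).
have fs : folds_at r (schottky_proj t).
  by apply: (fixed_folds ch hN sr fibre); apply/fixP; rewrite rt.
have drs : cdom d (r (schottky_proj t)) by rewrite rt.
have [c' [pc' [cs' c0'] rcd' df']] := folds_at_chart fs hd drs.
have cc' : c' (schottky_proj t) = c (pi1 t).
  by rewrite -(fold_Im_ge0 (z := c' _)) ?c0'// -(fold_Im_ge0 (z := c _)) ?c0// -df'// -df// rt.
have [a [b ab]] := fold_sides ch fibre oA oB AB dAB pc' hd cs' c0' rcd' df'.
have [al [A1 [B1 [nA1 nB1 ag]]]] :=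
  agree_folds dp uq oP oQ pc hd cy c0 pcd df (pi_comm t).
(* Here [al] is agreement over the upper half-disc of [c], and [a] says that the upper half-disc of
   [c'] is on side [A]. Conjugation is inserted exactly when they differ. *)
have [s sP] : exists s : bool, (al <-> a) <-> s = false.
  by have [?|?] := pselect (al <-> a); [exists false|exists true]; split.
pose f := cinv c' \o (conjn s \o c).
have ds : cimage c' (conjn s (c (pi1 t))).
  by rewrite conjn_Im0// -cc'; exact: cimage_cmap.
have lf : liso_at (f \o pi1) t.
  by apply: liso_at_comp (pi1_liso t) _; exact: plane_charts_liso.
have ft : f (pi1 t) = schottky_proj t by rewrite /f /= conjn_Im0// -cc' cmapK.
apply: (liso_at_near _ lf).
have n1 : \forall u \near t, [/\ complex.Im (c' (f (pi1 u))) = 0 ->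
      h (f (pi1 u)) = f (pi1 u),
    0 < complex.Im (c' (f (pi1 u))) -> (A (f (pi1 u)) <-> a) /\ (A (h (f (pi1 u))) <-> b) &
    complex.Im (c' (f (pi1 u))) < 0 -> (A (f (pi1 u)) <-> b) /\ (A (h (f (pi1 u))) <-> a)].
  by rewrite -ft in ab; exact: (liso_at_continuous lf ab).
have nd : \forall y \near pi1 t, cimage c' (conjn s (c y)).
  have nc : \forall z \near c (pi1 t), cimage c' (conjn s z).
    apply: (near_continuous (@conjn_continuous R s (c (pi1 t)))).
    by apply: open_nbhs_nbhs; split=> //; apply: plane_image_open; case: pc'.
  exact: near_cmap cy nc.
have nA2 : \forall y \near pi1 t, A1 y /\ (cimage c' (conjn s (c y)) /\ cdom c y).
  by apply: filterI nA1 _; exact: filterI nd (near_cdom cy).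
have n2 := pi_near nA2 nB1.
apply: filterS (filterI n1 n2) => u [[_ up un] [[A1u [[v cv' vu] cu]] B1u]].
have fuE : f (pi1 u) = v by rewrite /f /= -vu cmapK.
have rv : r v = p (pi1 u).
  have dv : cdom d (r v) by apply: rcd'; exists v.
  have du : cdom d (p (pi1 u)) by apply: pcd; exists (pi1 u).
  rewrite -(cmapK dv) -(cmapK du) df'// df// vu.
  by case: (s) => //=; rewrite fold_conjc.
apply/esym/schottky_proj_eq; split; rewrite /= -/(f (pi1 u)) fuE// => bu.
have hv : h v <> v by rewrite fixP rv.
rewrite fuE vu in up un.
have [gp gn] := ag _ _ A1u B1u (pi_comm u).
have sv := swap hv.
have uu := interior_unbranched bu.
have cN : complex.Im (c (pi1 u)) != 0.
  apply/eqP => cI; apply: (folds_not_liso _ (unbranched_liso uu)).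
  by exists c, d; split.
(* Four cases, with [s]. When [v] falls in the lower half-disc, its side can be read from that of
   [h v], which is [a], and the exchange [sv]. *)
have [cI|cI] : 0 < complex.Im (c (pi1 u)) \/ complex.Im (c (pi1 u)) < 0.
  by have [|?|/esym/eqP] := ltgtP 0 (complex.Im (c (pi1 u))); [left|right|rewrite (negbTE cN)].
- rewrite /agr (gp cI); case: (s) sP up un => sP up un.
    have nal : ~ (al <-> a) by move=> /sP.
    have [|_ hva] := un _; first by rewrite /= Im_conjc oppr_lt0.
    exact: opposite_sides hva sv nal.
  have [va _] := up cI; exact: (iff_trans va (iff_sym (sP.2 erefl))).
- rewrite /agr (gn cI); case: (s) sP up un => sP up un.
    have nal : ~ (al <-> a) by move=> /sP.
    have [|va _] := up _; first by rewrite /= Im_conjc oppr_gt0.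
    exact: iff_trans va (iff_notr nal).
  have [_ hva] := un cI.
  exact: opposite_sides hva sv (iff_notl (sP.2 erefl)).
Qed.

Lemma schottky_quotient : is_quotient [set id; deck1 \o deck2] S.
Proof.
have lf t : liso_at schottky_proj t.
  have [|] := pselect (boundary X (p (pi1 t))).
    exact: schottky_proj_boundary.
  exact: schottky_proj_interior.
exists schottky_proj; split.
- split=> [t|t]; first exact: liso_at_continuous (lf t).
  by left; exact: liso_unbranched.
- apply/seteqP; split=> // s _; have [t <-] := schottky_proj_surjective s.
  by exists t.
- exact: schottky_proj_fibre.
Qed.

End SchottkyQuotient.
End DoubleOfDoubles.

(** * Two commuting involutions, and the assembly of the theorem *)

Section Klein4.
Context (T : Type) (s t : T -> T).
Hypotheses (ss : s \o s = id) (tt : t \o t = id) (st : s \o t = t \o s).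

Let ssx x : s (s x) = x. Proof. exact: (congr1 (@^~ x) ss). Qed.
Let ttx x : t (t x) = x. Proof. exact: (congr1 (@^~ x) tt). Qed.
Let stx x : s (t x) = t (s x). Proof. exact: (congr1 (@^~ x) st). Qed.

Definition klein4 (a b : bool) : T -> T := (if a then s else id) \o (if b then t else id).

Lemma klein4_comp a b c d : klein4 a b \o klein4 c d = klein4 (a (+) c) (b (+) d).
Proof.
by apply/funext => x; case: a b c d => [] [] [] []; rewrite /klein4 /= ?stx ?ssx ?ttx ?stx ?ssx.
Qed.

Lemma generated2 : generated [set s; t] = [set f | exists a b, f = klein4 a b].
Proof.
apply/seteqP; split=> f.
  apply; split; last by move=> _ [->|->]; [exists true, false|exists false, true].
  split; first by exists false, false.
    by move=> _ _ [a [b ->]] [c [d ->]]; rewrite klein4_comp; exists (a (+) c), (b (+) d).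
  move=> _ [a [b ->]]; exists (klein4 a b); split; first by exists a, b.
    by move=> x; rewrite -[LHS]/((klein4 a b \o klein4 a b) x) klein4_comp !addbb.
  by move=> x; rewrite -[LHS]/((klein4 a b \o klein4 a b) x) klein4_comp !addbb.
move=> [a [b ->]] G [[G1 GM _] stG].
have Gs : G s by apply: stG; left.
have Gt : G t by apply: stG; right.
by case: a; case: b; apply: GM.
Qed.

Lemma klein4_isomorphic : s <> id -> t <> id -> s \o t <> id ->
  isomorphic_C2xC2 (generated [set s; t]).
Proof.
move=> sN tN stN; rewrite generated2.
pose odd2 (a : 'Z_2) : bool := a != 0.
have odd2D a b : odd2 (a + b) = odd2 a (+) odd2 b.
  by case: a b => [[|[|//]] ?] [[|[|//]] ?].
have odd2_inj : injective odd2.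
  by move=> [[|[|//]] ?] [[|[|//]] ?] //= _; apply: val_inj.
have odd2_surj b : exists a, odd2 a = b by case: b; [exists 1|exists 0].
exists (fun ab => klein4 (odd2 ab.1) (odd2 ab.2)); split.
- have ker a b : klein4 a b = id -> (a = false) /\ (b = false).
    by case: a; case: b.
  move=> [a b] [c d] /= abcd.
  have : klein4 (odd2 a (+) odd2 c) (odd2 b (+) odd2 d) = id.
    by rewrite -klein4_comp abcd klein4_comp !addbb.
  move: (@odd2_inj a c) (@odd2_inj b d).
  case: (odd2 a) (odd2 c) => [] [] ac; case: (odd2 b) (odd2 d) => [] [] bd /ker[] //= _ _;
    by rewrite ac// bd.
- apply/seteqP; split=> [_ [[a b] _ <-]|_ [a [b ->]]].
    by exists (odd2 a), (odd2 b).
  have [a' <-] := odd2_surj a; have [b' <-] := odd2_surj b.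
  by exists (a', b').
- by move=> [a b] [c d]; rewrite klein4_comp /= !odd2D.
Qed.

End Klein4.

(** As [F] is closed, sets relatively open in its complement are open in [T]; a proper relatively
    clopen subset and its complement give the two sides. *)
Lemma not_connected_sides (T : topologicalType) (F : set T) :
  closed F -> ~ connected (~` F) -> exists A B : set T,
    [/\ open A, open B, A !=set0, B !=set0 &
      (forall x, ~ F x <-> A x \/ B x) /\ forall x, A x -> ~ B x].
Proof.
move=> cF nc; apply: contrapT => H; apply: nc => E E0 [V oV EV] [W cW EW].
apply/seteqP; split=> [x|x Fx]; first by rewrite EV => -[].
apply: contrapT => nEx; apply: H.
exists E, (~` F `&` ~` W); split=> //.
- by rewrite EV; apply: openI => //; exact: closed_openC.
- by apply: openI; exact: closed_openC.
- by exists x; split=> // Wx; apply: nEx; rewrite EW.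
split=> [y|y]; last by rewrite EW => -[_ Wy] [].
split=> [Fy|[|[]//]]; last by rewrite EV => -[].
by have [Wy|nWy] := pselect (W y); [left; rewrite EW|right].
Qed.

Theorem theorem3 (R : realType) (X SX OX Xplus : klein_surface R)
  (X_nonorientable : ~ orientable X)
  (X_boundary : boundary X !=set0)
  (SX_double : schottky_double X SX)
  (OX_double : orienting_double X OX)
  (Xplus_double : complex_double X Xplus) :
  exists DX : klein_surface R,
    riemann_surface DX /\
    exists s t : DX -> DX,
      [/\ generated [set s; t] `<=` Aut_pm DX,
          isomorphic_C2xC2 (generated [set s; t]),
          is_quotient (generated [set s]) OX,
          is_quotient (generated [set t]) SX &
          is_quotient (generated [set s \o t]) Xplus].
Proof.
have [[[P oP] bY] [p dp]] := Xplus_double.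
have [[Q oQ] [q [dq uq]] _] := OX_double.
have [bS _ [h [[ch _] [hh hN] nc [r [sr rT fibre0]]]]] := SX_double.
(* [Xplus] has no boundary, so it must fold over the boundary points of [X]. *)
have fp : exists y, folds_at p y.
  have [x bx] := X_boundary; have [y yx] := double_surjective dp x.
  by exists y; apply/(double_folds_boundary y dp bY); rewrite yx.
have kp := deck_anticonformal dp oP fp.
have kq := deck_reverses dq uq oQ X_nonorientable.
have hK : involutive h by move=> x; exact: (congr1 (@^~ x) hh).
have fibre y u : r y = r u <-> u = y \/ u = h y.
  rewrite fibre0 (generated1 hh); split=> [[g [->|->] <-]|[->|->]]; [by left|by right|..].
    by exists id; [left|].
  by exists h; [right|].
have cF : closed [set y | h y = y].
  rewrite -openC openE => y hy.
  exact: (near_not_fixed ch hy).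
have [A [B [oA oB A0 B0 [AB dAB]]]] := not_connected_sides cF nc.
exists (fibre_surface dp dq uq fp); split; first exact: fibre_riemann oP bY.
pose s1 := @deck1 R X Xplus OX p q dp dq uq fp.
pose s2 := @deck2 R X Xplus OX p q dp dq uq fp.
have s1K : s1 \o s1 = id by apply/funext => t; exact: deck1K.
have s2K : s2 \o s2 = id by apply/funext => t; exact: deck2K.
have s12 : s1 \o s2 = s2 \o s1 by apply/funext => t; exact: deck12.
have s12K : (s1 \o s2) \o (s1 \o s2) = id.
  by apply/funext => t; rewrite /s1 /s2 /= -deck12 deck2K deck1K.
have s1s12 : s1 \o (s1 \o s2) = s2 by apply/funext => t; exact: deck1K.
have comm : s1 \o (s1 \o s2) = (s1 \o s2) \o s1.
  by apply/funext => t; rewrite /s1 /s2 /= -deck12.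
(* With [s := s1] and [t := s1 \o s2] the product [s \o t] is [s2], whose quotient is [Xplus]. *)
exists s1, (s1 \o s2); split.
- rewrite generated2// => f [a [b ->]]; rewrite /klein4.
  case: a; case: b => /=; rewrite ?s1s12.
  + exact: deck2_Aut oP.
  + exact: deck1_Aut oP kp.
  + exact: deck12_Aut oP kp.
  + exact: id_Aut oP.
- have [t0 ht0] := deck1_neq dp dq uq fp.
  apply: klein4_isomorphic => //; rewrite ?s1s12.
  + by move=> /(congr1 (@^~ t0)).
  + by move=> /(congr1 (@^~ t0)); exact: deck12_neq.
  + by move=> /(congr1 (@^~ t0)); exact: deck2_neq.
- by rewrite generated1//; exact: pi2_quotient.
- rewrite generated1//.
  have := schottky_quotient dp dq uq fp oP oQ kp kq bY bS ch hK hN sr rT fibre oA oB A0 B0 AB dAB.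
  exact.
- by rewrite s1s12 generated1//; exact: pi1_quotient.
Qed.
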